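(* Let $f:\Omega\to\Omega'$ be a $K$-quasiconformal homeomorphism between two planar domains ($K\geqslant1$), and let $z_0\in\Omega$. Suppose there are radii $r_k\to0$, $r_k>0$, such that the limits $$\alpha=\lim_{k\to\infty}\frac{\log|f(z_0+r_k)-f(z_0)|}{\log r_k},\qquad \gamma=\lim_{k\to\infty}\frac{\arg\big(f(z_0+r_k)-f(z_0)\big)}{\log|f(z_0+r_k)-f(z_0)|}$$ both exist. Then the exponent $\tau=\alpha(1+i\gamma)$ satisfies $$\left|\tau-\frac12\Big(K+\frac1K\Big)\right|\ \leqslant\ \frac12\Big(K-\frac1K\Big).$$
   Context: A $K$-quasiconformal map is an orientation-preserving homeomorphism between planar domains, in $W^{1,2}_{loc}$, with $|Df(z)|^2\leqslant K\det Df(z)$ for a.e. $z$, where $|Df|$ is the operator norm. In the definition of $\gamma$ one uses some continuous branch of the argument $r\mapsto\arg(f(z_0+r)-f(z_0))$ for small $r>0$; the limit, if it exists, does not depend on the branch. *)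

(* Defs.v *)
From HB Require Import structures.
From mathcomp Require Import all_boot all_order all_algebra.
From mathcomp Require Import all_classical all_reals all_analysis.
From mathcomp Require Export complex.

Set Implicit Arguments.
Unset Strict Implicit.
Unset Printing Implicit Defensive.

Import Order.TTheory GRing.Theory Num.Theory.
Import numFieldNormedType.Exports.

Local Open Scope classical_set_scope.
Local Open Scope ring_scope.

(* The plane is [R * R]: it carries the product topology and the product
   sigma-algebra. Its canonical norm is the max norm, hence [modulus] for the
   Euclidean one. *)

Definition modulus {R : realType} (z : R * R) : R :=
  Num.sqrt (z.1 ^+ 2 + z.2 ^+ 2).

Definition cis {R : realType} (t : R) : R * R := (cos t, sin t).

Notation lebesgue2 := (lebesgue_measure \x lebesgue_measure)%E.

Definition planar_domain {R : realType} (W : set (R * R)) : Prop :=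
  [/\ open W, connected W & W !=set0].

(* Maps between domains are total functions on the plane; their values outside
   the source domain are irrelevant. *)
Definition homeo_between {R : realType} (W W' : set (R * R))
    (f : R * R -> R * R) : Prop :=
  set_bij W W' f /\ {within W, continuous f} /\
  exists g : R * R -> R * R,
    {within W', continuous g} /\ (forall z, W z -> g (f z) = z).

(* [theta] is a continuous branch on [I] of the argument of the curve [c]. *)
Definition arg_branch {R : realType} (I : set R) (c : R -> R * R)
    (theta : R -> R) : Prop :=
  {within I, continuous theta} /\
  (forall t, I t -> c t = modulus (c t) *: cis (theta t)).

(* For every closed disc in [W], the image of its positively oriented boundary
   circle has winding number +1 around the image of the centre. *)
Definition orientation_preserving {R : realType} (W : set (R * R))
    (f : R * R -> R * R) : Prop :=
  forall (z : R * R) (r : R), 0 < r ->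
    [set w | modulus (w - z) <= r] `<=` W ->
    exists theta : R -> R,
      arg_branch `[0, 2 * pi] (fun t => f (z + r *: cis t) - f z) theta /\
      theta (2 * pi) - theta 0 = 2 * pi.

Definition basis_vec {R : realType} (j : 'I_2) : R * R :=
  if j == 0 then (1, 0) else (0, 1).

Definition coord2 {R : realType} (i : 'I_2) (z : R * R) : R :=
  if i == 0 then z.1 else z.2.

Fixpoint iter_partial {R : realType} (s : seq 'I_2) (phi : R * R -> R) :
    R * R -> R :=
  if s is j :: s' then fun z => 'D_(basis_vec j) (iter_partial s' phi) z
  else phi.

(* C^oo: all iterated partial derivatives exist and are differentiable, hence
   continuous. *)
Definition smooth {R : realType} (phi : R * R -> R) : Prop :=
  forall (s : seq 'I_2) (z : R * R), differentiable (iter_partial s phi) z.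

Definition test_function {R : realType} (W : set (R * R))
    (phi : R * R -> R) : Prop :=
  [/\ smooth phi, compact (closure [set z | phi z != 0]) &
      closure [set z | phi z != 0] `<=` W].

Definition L2_loc {R : realType} (W : set (R * R)) (u : R * R -> R) : Prop :=
  measurable_fun W u /\
  forall C : set (R * R), C `<=` W -> compact C ->
    (\int[lebesgue2]_(z in C) ((u z) ^+ 2)%:E < +oo)%E.

Definition weak_partial {R : realType} (W : set (R * R)) (j : 'I_2)
    (u v : R * R -> R) : Prop :=
  forall phi : R * R -> R, test_function W phi ->
    (\int[lebesgue2]_(z in W) (u z * 'D_(basis_vec j) phi z)%:E =
     - \int[lebesgue2]_(z in W) (v z * phi z)%:E)%E.

(* [f] is in W^{1,2}_loc(W; R^2), with weak differential [Df]. *)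
Definition W12_loc_with {R : realType} (W : set (R * R))
    (f : R * R -> R * R) (Df : R * R -> 'M[R]_2) : Prop :=
  forall i : 'I_2,
    L2_loc W (coord2 i \o f) /\
    forall j : 'I_2,
      L2_loc W (fun z => Df z i j) /\
      weak_partial W j (coord2 i \o f) (fun z => Df z i j).

Definition eucl_norm {R : realType} {n : nat} (v : 'cV[R]_n) : R :=
  Num.sqrt (\sum_i v i 0 ^+ 2).

Definition op_norm {R : realType} {n : nat} (A : 'M[R]_n) : R :=
  sup [set eucl_norm (A *m v) | v in [set v : 'cV[R]_n | eucl_norm v <= 1]].

Definition quasiconformal {R : realType} (K : R) (W W' : set (R * R))
    (f : R * R -> R * R) : Prop :=
  [/\ homeo_between W W' f, orientation_preserving W f &
      exists Df : R * R -> 'M[R]_2,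
        W12_loc_with W f Df /\
        {ae lebesgue2, forall z, W z ->
           op_norm (Df z) ^+ 2 <= K * \det (Df z)}].

(* Main.v *)
From HB Require Import structures.
Require Import Defs.
From mathcomp Require Import all_boot all_order all_algebra.
From mathcomp Require Import all_classical all_reals all_analysis.
From mathcomp Require Import complex.
From mathcomp Require Import measurable_realfun.
From mathcomp Require Import ring lra.

Import Order.TTheory GRing.Theory Num.Theory.
Import numFieldNormedType.Exports.

Local Open Scope classical_set_scope.
Local Open Scope ring_scope.

(** The map is read in logarithmic coordinates at z0 and at f z0. Write
    z = z0 + exp (s + i t) and log (f z - f z0) = u + i v, so that u is
    2 pi-periodic in t and v increases by 2 pi over a circle. With
    K' = K + 1/K, the condition |Df|^2 <= K det Df gives
    |Df|_HS^2 <= K' det Df ([op_norm_HS]), and this form of quasiconformality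
    is invariant under the conformal changes of coordinates
    ([distort_rot], [energy_log]):
      u_s^2 + u_t^2 + v_s^2 + v_t^2 <= K' (u_s v_t - u_t v_s).
    With beta = alpha gamma, the claim is alpha^2 + beta^2 + 1 <= K' alpha, the
    equation of the disc of centre K'/2 and radius (K - 1/K)/2
    ([complex_disc]). It is the displayed inequality for the linear model
    u = alpha s, v = beta s + t.

    In general the displayed inequality is integrated over a <= s <= b,
    0 <= t <= 2 pi, where a = ln (r k) tends to -oo and b is fixed. On the left,
    X^2 >= 2 c X - c^2 with c = alpha, beta, 1 for X = u_s, v_s, v_t bounds the
    energy from below by increments of u and v along the radii. On the right,
    Green's identity ([green_C1]) bounds the integral of the Jacobian by 2 pi
    times the increment of u ([energy_bound]). All increments may be taken along
    the radius t = 0, because the oscillations of u and of v over a circle are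
    bounded independently of the circle ([osc_u], [osc_v]). The result is
    [strip_bound]; divided by -a, it becomes the claim ([exponent_ineq]).

    The oscillation bounds are length-area estimates: a coordinate path that
    joins two circles, or runs around a rectangle, is averaged over a family of
    such paths, and its length is compared with the energy. They also use the
    topology of f. Since f is open and injective, the minimum and the maximum
    of u over a circle are monotone in its radius ([circle_min_le], [circle_max_le]), and v
    satisfies the maximum principle on rectangles ([arg_open],
    [max_principle]).

    All integrations are done for C1 functions. On a neighbourhood of z0 the
    map f is mollified. Its weak gradient converges in L2 because translations
    are continuous in L2 ([L2_shift2], [moll_L2]), so the positive part of
    |D|_HS^2 - K' det of the mollified maps tends to 0 in L1 ([cart_approx]).
    The logarithm of a mollified map is then a C1 pair (U, V) on a strip, close
    to (u, v), for which the displayed inequality holds up to an error E of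
    small integral ([strip_approx_of_cart]); this uses only an inequality between
    integrals in polar and in Cartesian coordinates ([polar_le]). The record
    [strip_map] collects what the second half of the proof needs, and
    [quasiconformal_strip] shows that f provides it. *)

Set Implicit Arguments.
Unset Strict Implicit.
Unset Printing Implicit Defensive.

(** * Oriented integrals of continuous functions, calculus in one variable *)

Section Prim.
Context {R : realType}.
Implicit Types (f g P : R -> R).
Notation mu := (@lebesgue_measure R).

Definition is_prim f P := forall x : R, is_derive x 1 P (f x).

Lemma prim_uniq f P Q a b : is_prim f P -> is_prim f Q -> P b - P a = Q b - Q a.
Proof.
move=> hP hQ.
have h (x:R) : is_derive x 1 (P - Q) 0.
  by have ? := hP x; have ? := hQ x; apply: is_derive_eq; rewrite subrr.
have := @is_derive_0_is_cst _ _ b a h.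
move=> /= ?.
have : P b - Q b = P a - Q a by [].
lra.
Qed.

Lemma cont_integrable f a b : continuous f -> mu.-integrable `[a, b] (EFin \o f).
Proof.
move=> cf; apply: continuous_compact_integrable; first exact: segment_compact.
exact: continuous_subspaceT.
Qed.

(** The integral from 0 is glued from two one-sided integrals. Near x it
    differs by a constant from an integral G with a fixed lower bound a < min
    x 0, to which the fundamental theorem applies. *)
Lemma prim_exists f : continuous f -> exists P, is_prim f P.
Proof.
move=> cf.
pose P x := if 0 <= x then \int[mu]_(t in `[0, x]) f t else - \int[mu]_(t in `[x, 0]) f t.
exists P => x.
pose a := Num.min x 0 - 1.
have ax : a < x by rewrite /a; case: (leP x 0); lra.
have a0 : a < 0 by rewrite /a; case: (leP x 0); lra.
pose G y := \int[mu]_(t in `[a, y]) f t.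
have PG y : a < y -> P y = G y - G 0.
  move=> ay; rewrite /P /G; case: ifPn => [y0|]; last rewrite -ltNge => y0.
  rewrite Rintegral_itvB ?bnd_simp//; last exact: ltW.
  - rewrite Rintegral_itv_obnd_cbnd//.
    apply: integrableS (cont_integrable 0 y cf) => //.
    exact: subset_itv_oc_cc.
  - exact: cont_integrable.
  apply/eqP; rewrite eqr_oppLR opprB; apply/eqP.
  rewrite Rintegral_itvB ?bnd_simp//; try exact: ltW.
  - rewrite Rintegral_itv_obnd_cbnd//.
    apply: integrableS (cont_integrable y 0 cf) => //.
    exact: subset_itv_oc_cc.
  - exact: cont_integrable.
have x1 : x < x + 1 by lra.
have [dG G'] := continuous_FTC1_closed x1 (cont_integrable a (x+1) cf) ax (cf x).
have dG' : is_derive x 1 G (f x).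
  by rewrite -G' derive1E; apply: DeriveDef.
have h2 : is_derive x 1 (fun y => G y - G 0) (f x).
  by apply: is_derive_eq; rewrite subr0.
apply: near_eq_is_derive h2.
near=> y; rewrite PG//; near: y.
exact: lt_nbhsr.
Unshelve. all: by end_near. Qed.

(** The integral is read off from an arbitrary primitive. It is thus defined
    for both orders of the bounds, and the fundamental theorem of calculus and
    the substitution rule are immediate. *)
Definition oint (a b : R) f : R :=
  let P := xget (fun _ => 0) [set P | is_prim f P] in P b - P a.

Lemma ointE f P a b : is_prim f P -> oint a b f = P b - P a.
Proof.
move=> hP; rewrite /oint; case: xgetP => [Q _ hQ|/(_ P)]; last by move=> /(_ hP).
exact: prim_uniq hQ hP.
Qed.

Lemma oint_prim f a : continuous f -> is_prim f (fun x => oint a x f).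
Proof.
move=> /prim_exists[P hP].
have -> : (fun x => oint a x f) = (fun x => P x - P a).
  by apply/funext => x; rewrite (ointE _ _ hP).
by move=> x; have := hP x => ?; apply: is_derive_eq; rewrite subr0.
Qed.

Lemma oint_cat f a b c : continuous f -> oint a b f + oint b c f = oint a c f.
Proof. move=> /prim_exists[P hP]; rewrite !(ointE _ _ hP); ring. Qed.

Lemma ointC f a b : continuous f -> oint a b f = - oint b a f.
Proof. move=> /prim_exists[P hP]; rewrite !(ointE _ _ hP); ring. Qed.

Lemma ointD f g a b : continuous f -> continuous g ->
  oint a b (fun x => f x + g x) = oint a b f + oint a b g.
Proof.
move=> /prim_exists[P hP] /prim_exists[Q hQ].
rewrite (ointE _ _ hP) (ointE _ _ hQ) (@ointE _ (P + Q)).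
  by rewrite /= !fctE; ring.
by move=> x; have := hP x; have := hQ x => ? ?; apply: is_derive_eq.
Qed.

Lemma ointZ f k a b : continuous f ->
  oint a b (fun x => k * f x) = k * oint a b f.
Proof.
move=> /prim_exists[P hP].
rewrite (ointE _ _ hP) (@ointE _ (k \*: P)).
  by rewrite /= /GRing.scale/=; ring.
by move=> x; have := hP x => ?; apply: is_derive_eq.
Qed.

Lemma oint_cst k a b : oint a b (fun=> k) = k * (b - a).
Proof.
rewrite (@ointE _ (fun x => k * x)); first ring.
by move=> x; apply: is_derive_eq; rewrite /GRing.scale/=; ring.
Qed.

(** The mean value theorem, applied to the difference of the primitives. *)
Lemma le_oint f g a b : continuous f -> continuous g -> a <= b ->
  (forall x, a <= x <= b -> f x <= g x) -> oint a b f <= oint a b g.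
Proof.
move=> cf cg ab fg.
have [P hP] := prim_exists cf; have [Q hQ] := prim_exists cg.
rewrite (ointE _ _ hP) (ointE _ _ hQ).
have h (x : R) : is_derive x 1 (Q - P) (g x - f x).
  by have := hP x; have := hQ x => ? ?; apply: is_derive_eq.
have [c cab] : exists2 c, c \in `[a, b]%R & (Q - P) b - (Q - P) a = (g c - f c) * (b - a).
  apply: MVT_segment => //= .
  apply: derivable_within_continuous => x _.
  by have [] := h x.
rewrite !fctE /=.
have : 0 <= (g c - f c) * (b - a).
  by rewrite mulr_ge0 ?subr_ge0//; apply: fg; rewrite in_itv in cab.
lra.
Qed.

Lemma oint_lebesgue f a b : continuous f -> a <= b ->
  (\int[mu]_(x in `[a, b]) (f x)%:E = (oint a b f)%:E)%E.
Proof.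
move=> cf; rewrite le_eqVlt => /predU1P[<-|ab].
  by rewrite set_itv1 integral_set1 /oint subrr.
have [P hP] := prim_exists cf.
rewrite (ointE _ _ hP).
have cP : continuous P.
  by move=> x; apply: differentiable_continuous; apply/derivable1_diffP; have [] := hP x.
rewrite (@continuous_FTC2 _ f P)//.
- exact: continuous_subspaceT.
- split.
  + by move=> x _; have [] := hP x.
  + exact: cvg_at_right_filter (cP a).
  + exact: cvg_at_left_filter (cP b).
- by move=> x _; rewrite derive1E; have [_ ->] := hP x.
Qed.

End Prim.

Section Cont.
Context {R : realType} {T : topologicalType}.
Implicit Types (f g : T -> R).

Lemma cont_cst {U : topologicalType} (k : U) : continuous (fun _ : T => k).
Proof. move=> x; exact: cvg_cst. Qed.
Lemma cont_id : continuous (fun x : T => x).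
Proof. by move=> x; exact: cvg_id. Qed.
Lemma contD f g : continuous f -> continuous g -> continuous (fun x => f x + g x).
Proof. by move=> cf cg x; apply: cvgD; [exact: cf|exact: cg]. Qed.
Lemma contN f : continuous f -> continuous (fun x => - f x).
Proof. by move=> cf x; apply: cvgN; exact: cf. Qed.
Lemma contM f g : continuous f -> continuous g -> continuous (fun x => f x * g x).
Proof. by move=> cf cg x; apply: cvgM; [exact: cf|exact: cg]. Qed.
Lemma contX f n : continuous f -> continuous (fun x => f x ^+ n).
Proof.
move=> cf; elim: n => [|n ih]; first by under eq_fun do rewrite expr0; exact: cont_cst.
by under eq_fun do rewrite exprS; apply: contM.
Qed.
Lemma contV f : (forall x, f x != 0) -> continuous f -> continuous (fun x => (f x)^-1).
Proof. by move=> f0 cf x; apply: cvgV; [exact: f0|exact: cf]. Qed.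
Lemma cont_norm f : continuous f -> continuous (fun x => `|f x|).
Proof. by move=> cf x; apply: cvg_norm; exact: cf. Qed.
Lemma cont_comp {U V : topologicalType} (h : U -> V) (k : T -> U) :
  continuous h -> continuous k -> continuous (fun x => h (k x)).
Proof. by move=> ch ck x; apply: continuous_comp; [exact: ck|exact: ch]. Qed.
Lemma cont_pair {U V : topologicalType} (h : T -> U) (k : T -> V) :
  continuous h -> continuous k -> continuous (fun x => (h x, k x)).
Proof. by move=> ch ck x; apply: cvg_pair; [exact: ch|exact: ck]. Qed.
Lemma cont_max f g : continuous f -> continuous g ->
  continuous (fun x => Num.max (f x) (g x)).
Proof. by move=> cf cg x; apply: continuous_max; [exact: cf|exact: cg]. Qed.
Lemma cont_min f g : continuous f -> continuous g ->
  continuous (fun x => Num.min (f x) (g x)).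
Proof. by move=> cf cg x; apply: continuous_min; [exact: cf|exact: cg]. Qed.
End Cont.

Lemma cont_fst {U V : topologicalType} : continuous (fun z : U * V => z.1).
Proof. by move=> z; exact: cvg_fst. Qed.
Lemma cont_snd {U V : topologicalType} : continuous (fun z : U * V => z.2).
Proof. by move=> z; exact: cvg_snd. Qed.
Lemma cont_sin {R : realType} : continuous (@sin R). Proof. exact: continuous_sin. Qed.
Lemma cont_cos {R : realType} : continuous (@cos R). Proof. exact: continuous_cos. Qed.
Lemma cont_expR {R : realType} : continuous (@expR R). Proof. exact: continuous_expR. Qed.
Lemma cont_atan {R : realType} : continuous (@atan R). Proof. exact: continuous_atan. Qed.

Ltac cts_step := match goal with
  | H : continuous ?g |- continuous ?g => exact: H
  | |- continuous (fun z => z) => exact: cont_id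
  | |- continuous (fun z => z.1) => exact: cont_fst
  | |- continuous (fun z => z.2) => exact: cont_snd
  | |- continuous (fun _ => ?k) => exact: cont_cst
  | |- continuous (fun z => (@?f z + @?g z)%R) => apply: (@contD _ _ f g)
  | |- continuous (fun z => (- (@?f z))%R) => apply: (@contN _ _ f)
  | |- continuous (fun z => (@?f z * @?g z)%R) => apply: (@contM _ _ f g)
  | |- continuous (fun z => (@?f z ^+ ?n)%R) => apply: (@contX _ _ f n)
  | |- continuous (fun z => `|@?f z|%R) => apply: (@cont_norm _ _ f)
  | |- continuous (fun z => Num.max (@?f z) (@?g z)) => apply: (@cont_max _ _ f g)
  | |- continuous (fun z => Num.min (@?f z) (@?g z)) => apply: (@cont_min _ _ f g)
  | |- continuous (fun z => sin (@?f z)) => apply: (@cont_comp _ _ _ _ f cont_sin)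
  | |- continuous (fun z => cos (@?f z)) => apply: (@cont_comp _ _ _ _ f cont_cos)
  | |- continuous (fun z => expR (@?f z)) => apply: (@cont_comp _ _ _ _ f cont_expR)
  | |- continuous (fun z => atan (@?f z)) => apply: (@cont_comp _ _ _ _ f cont_atan)
  | |- continuous (fun z => (@?f z).1) => apply: (@cont_comp _ _ _ _ f cont_fst)
  | |- continuous (fun z => (@?f z).2) => apply: (@cont_comp _ _ _ _ f cont_snd)
  | |- continuous (fun z => (@?f z, @?g z)) => apply: (@cont_pair _ _ _ f g)
  | H : continuous ?g |- continuous (fun z => ?g (@?a z)) => apply: (@cont_comp _ _ _ g a H)
  end.
(** Continuity by recursion on the syntax of the function, using the
    continuity hypotheses of the context for its atoms. *)
Ltac cts := repeat cts_step.

Section Der.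
Context {R : realType}.
Implicit Types (f g : R -> R) (x a b : R).
Lemma der_eq f x a b : is_derive x 1 f a -> a = b -> is_derive x 1 f b.
Proof. by move=> h <-. Qed.
Lemma derD f g x a b : is_derive x 1 f a -> is_derive x 1 g b ->
  is_derive x 1 (fun t => f t + g t) (a + b).
Proof. exact: is_deriveD. Qed.
Lemma derN f x a : is_derive x 1 f a -> is_derive x 1 (fun t => - f t) (- a).
Proof. exact: is_deriveN. Qed.
Lemma derM f g x a b : is_derive x 1 f a -> is_derive x 1 g b ->
  is_derive x 1 (fun t => f t * g t) (a * g x + f x * b).
Proof. by move=> h1 h2; apply: (der_eq (is_deriveM h1 h2)); rewrite /GRing.scale/=; ring. Qed.
Lemma der_cst x a : is_derive x 1 (fun _ : R => a) 0.
Proof. exact: is_derive_cst. Qed.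
Lemma der_id x : is_derive x 1 (fun t : R => t) 1.
Proof. exact: is_derive_id. Qed.
Lemma der_comp f g x a b : is_derive (g x) 1 f a -> is_derive x 1 g b ->
  is_derive x 1 (fun t => f (g t)) (a * b).
Proof. exact: is_derive1_comp. Qed.
Lemma derX n f x a : is_derive x 1 f a -> is_derive x 1 (fun t => f t ^+ n) (n%:R * f x ^+ n.-1 * a).
Proof.
move=> h; rewrite (_ : (fun t => f t ^+ n) = f ^+ n); first exact: is_deriveX.
by apply/funext => t; rewrite exprfctE.
Qed.
Lemma derV f x a : f x != 0 -> is_derive x 1 f a -> is_derive x 1 (fun t => (f t)^-1) (- (f x) ^- 2 * a).
Proof. exact: is_deriveV. Qed.
Lemma der_exp f x a : is_derive x 1 f a -> is_derive x 1 (fun t => expR (f t)) (expR (f x) * a).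
Proof. by move=> h; apply: der_comp h; exact: is_derive_expR. Qed.
Lemma der_sin f x a : is_derive x 1 f a -> is_derive x 1 (fun t => sin (f t)) (cos (f x) * a).
Proof. by move=> h; apply: der_comp h; exact: is_derive_sin. Qed.
Lemma der_cos f x a : is_derive x 1 f a -> is_derive x 1 (fun t => cos (f t)) (- sin (f x) * a).
Proof. by move=> h; apply: der_comp h; exact: is_derive_cos. Qed.
Lemma der_ln f x a : 0 < f x -> is_derive x 1 f a -> is_derive x 1 (fun t => ln (f t)) ((f x)^-1 * a).
Proof. by move=> f0 h; apply: der_comp h; exact: is_derive1_ln. Qed.
Lemma der_atan f x a : is_derive x 1 f a -> is_derive x 1 (fun t => atan (f t)) ((1 + f x ^+ 2)^-1 * a).
Proof. by move=> h; apply: der_comp h; exact: is_derive1_atan. Qed.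
End Der.

(** Differentiation by recursion on the syntax of the function; what is left
    is an equation between the computed and the expected derivative. *)
Ltac der := eapply der_eq; [ repeat (first
  [ eassumption | match goal with H : _ |- _ => exact: H end
  | exact: der_cst | exact: der_id | apply: derD | apply: derN | apply: derM | apply: derX
  | apply: der_exp | apply: der_sin | apply: der_cos | apply: der_atan ]) | cbn beta ].

Section Param.
Context {R : realType}.
Implicit Types (g : R * R -> R).

(** Compactness of the square is used in its near-covering form, with the
    modulus d as the parameter that tends to 0. *)
Lemma ucont_box g (M e : R) : continuous g -> 0 < e ->
  exists2 d, 0 < d & forall z w : R * R, `|z.1| <= M -> `|z.2| <= M ->
    `|w.1 - z.1| < d -> `|w.2 - z.2| < d -> `|g w - g z| < e.
Proof.
move=> cg e0.
have cK : compact (`[- M, M] `*` `[- M, M] : set (R * R)).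
  by apply: compact_setX; exact: segment_compact.
move/compact_near_coveringP : cK.
move=> /(_ _ (0^'+ : set_system R) (fun d z => forall w : R * R,
  `|w.1 - z.1| < d -> `|w.2 - z.2| < d -> `|g w - g z| < e) _).
have H : forall x : R * R, (`[- M, M] `*` `[- M, M]) x -> \forall x' \near x & i \near 0^'+, forall w, `|w.1 - x'.1| < i -> `|w.2 - x'.2| < i -> `|g w - g x'| < e.
  move=> x _.
  have e2 : 0 < e / 2 by rewrite divr_gt0.
  have /cvgrPdist_lt /(_ _ e2) /nbhs_ballP[d /= d0 hd] := cg x.
  have d2 : 0 < d / 2 by rewrite divr_gt0.
  exists (ball x (d/2), [set i | i < d / 2]).
    split; first exact: nbhsx_ballx.
    by near=> i; near: i; exact: nbhs_right_lt.
  move=> [x' i] /= [[b1 b2]] id w w1 w2.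
  rewrite /ball/= in b1 b2.
  have := hd x' _; rewrite /ball/= /prod_ball /ball /= => h1.
  have := hd w _; rewrite /ball/= /prod_ball /ball /= => h2.
  have {}h1 : `|g x - g x'| < e / 2.
    by apply: h1; split => /=; [apply: (lt_trans b1)|apply: (lt_trans b2)]; lra.
  have {}h2 : `|g x - g w| < e / 2.
    apply: h2; split => /=.
    - rewrite (_ : x.1 - w.1 = (x.1 - x'.1) + (x'.1 - w.1)); last ring.
      apply: le_lt_trans (ler_normD _ _) _; rewrite (distrC x'.1); lra.
    - rewrite (_ : x.2 - w.2 = (x.2 - x'.2) + (x'.2 - w.2)); last ring.
      apply: le_lt_trans (ler_normD _ _) _; rewrite (distrC x'.2); lra.
  rewrite (_ : g w - g x' = (g x - g x') - (g x - g w)); last ring.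
  apply: le_lt_trans (ler_normB _ _) _; lra.
move=> /(_ H) h.
near ((0 : R)^'+) => d.
exists d; first by near: d; exact: nbhs_right_gt.
move=> z w z1 z2.
have : (`[- M, M] `*` `[- M, M]) `<=` (fun z => forall w : R * R,
  `|w.1 - z.1| < d -> `|w.2 - z.2| < d -> `|g w - g z| < e) by near: d.
by apply; split; rewrite /= in_itv/= -ler_norml.
Unshelve. all: by end_near. Qed.

(** For x' near x the two integrands are uniformly close on the compact
    interval [c, d], by the near-covering form of compactness. The parameter
    space is arbitrary, so that the lemma can be iterated. *)
Lemma cont_oint_param {T : topologicalType} (g : T * R -> R) c d : continuous g ->
  continuous (fun x : T => oint c d (fun y => g (x, y))).
Proof.
move=> cg x.
wlog cd : c d / c <= d.
  move=> H; have [|/ltW dc] := leP c d; first exact: H.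
  have -> : (fun x : T => oint c d (fun y => g (x, y))) =
            (fun x => - oint d c (fun y => g (x, y))).
    apply/funext => z; rewrite ointC//; cts.
  by apply: cvgN; apply: H.
apply/cvgrPdist_lt => e e0.
have e1 : 0 < e / (d - c + 1) by rewrite divr_gt0//; lra.
have cK : compact (`[c, d] : set R) by exact: segment_compact.
move/compact_near_coveringP : cK.
move=> /(_ T (nbhs x) (fun u y => `|g (u, y) - g (x, y)| < e / (d - c + 1)) _).
have H : forall y : R, `[c, d]%classic y -> \forall y' \near y & u \near nbhs x,
    `|g (u, y') - g (x, y')| < e / (d - c + 1).
  move=> y _.
  have e2 : 0 < e / (d - c + 1) / 2 by rewrite divr_gt0.
  have /cvgrPdist_lt /(_ _ e2) [[A B] /= [nA nB] AB] := cg (x, y).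
  exists (B, A) => //= -[y' u] /= [By Au].
  have h1 := AB (u, y') (conj Au By).
  have h2 := AB (x, y') (conj (nbhs_singleton nA) By).
  rewrite /= in h1 h2.
  rewrite (_ : g (u, y') - g (x, y') = (g (x, y) - g (x, y')) - (g (x, y) - g (u, y'))); last ring.
  apply: le_lt_trans (ler_normB _ _) _; lra.
move=> /(_ H) h.
near=> t.
have cgx u : continuous (fun y => g (u, y)) by cts.
have -> : oint c d (fun y => g (x, y)) - oint c d (fun y => g (t, y)) =
   oint c d (fun y => g (x, y) + (-1) * g (t, y)).
  rewrite ointD ?ointZ//; [ring|cts].
have k y : c <= y <= d -> `|g (t, y) - g (x, y)| <= e / (d - c + 1).
  move=> ycd; apply: ltW; move: y ycd.
  have : `[c, d] `<=` (fun y => `|g (t, y) - g (x, y)| < e / (d - c + 1)) by near: t.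
  by move=> ht y ycd; apply: ht; rewrite /= in_itv.
have ed : e / (d - c + 1) * (d - c) < e.
  rewrite -mulrA gtr_pMr// mulrC ltr_pdivrMr; lra.
apply: le_lt_trans ed.
rewrite ler_norml -mulNr -!oint_cst; apply/andP; split.
- apply: le_oint => //; [cts|cts|move=> y /k]; rewrite ler_norml; lra.
- apply: le_oint => //; [cts|cts|move=> y /k]; rewrite ler_norml; lra.
Unshelve. all: by end_near. Qed.

End Param.

(** * Continuous functions on the plane and rectangles *)

Section Plane.
Context {R : realType}.
Notation mu := (@lebesgue_measure R).
Notation mu2 := (lebesgue_measure \x lebesgue_measure)%E.
Implicit Types g : R * R -> R.

(** An open set is the union of the countably many boxes with rational corners
    that it contains. *)
Lemma plane_open_measurable (O : set (R * R)) : open O -> measurable O.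
Proof.
move=> oO.
pose box (q : (rat * rat) * (rat * rat)) : set (R * R) :=
  `]ratr q.1.1, ratr q.1.2[ `*` `]ratr q.2.1, ratr q.2.2[.
have -> : O = \bigcup_(q in [set q | box q `<=` O]) box q.
  apply/seteqP; split => [z Oz|z [q /= qO /qO //]].
  have := oO; rewrite openE => /(_ _ Oz) /nbhs_ballP[e /= e0 he].
  have h1 (t : R) : exists p : rat * rat, [/\ t - e < ratr p.1, ratr p.1 < t, t < ratr p.2 & ratr p.2 < t + e].
    have [|p /itvP hp] := @rat_in_itvoo R (t - e) t; first by lra.
    have [|q /itvP hq] := @rat_in_itvoo R t (t + e); first by lra.
    by exists (p, q); rewrite /= !hp !hq.
  have [p [p1 p2 p3 p4]] := h1 z.1; have [q [q1 q2 q3 q4]] := h1 z.2.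
  exists (p, q); last by split; rewrite /= in_itv/= ?p2 ?p3 ?q2 ?q3.
  move=> w [/=]; rewrite !in_itv/= => /andP[w1 w2] /andP[w3 w4].
  apply: he; split; rewrite /ball/= ltr_norml; apply/andP; split; lra.
rewrite bigcup_mkcond.
have [f bf] : exists f : nat -> (rat * rat) * (rat * rat), range f = setT.
  exists (fun n => odflt ((0,0),(0,0)) (choice.unpickle n)).
  by apply/seteqP; split => // q _; exists (choice.pickle q) => //; rewrite choice.pickleK.
rewrite -bf bigcup_image.
apply: bigcupT_measurable => n; case: ifPn => // _.
by apply: measurableX; exact: measurable_itv.
Qed.

Lemma plane_cont_measurable g : continuous g -> measurable_fun setT g.
Proof.
move=> /continuousP cg; apply: (measurability _ (measurable_realfun.RGenOpens.measurableE R)).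
move=> _ [_ [a [b ->] <-]]; rewrite setTI; apply: plane_open_measurable.
exact/cg/interval_open.
Qed.

Definition rect (a b c d : R) : set (R * R) := `[a, b] `*` `[c, d].

Lemma rect_measurable a b c d : measurable (rect a b c d).
Proof. by apply: measurableX; exact: measurable_itv. Qed.

Lemma rect_compact a b c d : compact (rect a b c d).
Proof. by apply: compact_setX; exact: segment_compact. Qed.

Lemma rect_measure a b c d : a <= b -> c <= d ->
  mu2 (rect a b c d) = ((b - a) * (d - c))%:E.
Proof.
move=> ab cd; rewrite /rect product_measure1E//= ?lebesgue_measure_itv/=.
rewrite !lte_fin; case: ltP => [_|ba]; case: ltP => [_|dc]; rewrite -?EFinD ?mule0 ?mul0e ?EFinM//.
- by rewrite (_ : d - c = 0) ?mule0//; lra.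
- by rewrite (_ : b - a = 0) ?mul0e//; lra.
- by rewrite (_ : b - a = 0) ?mul0e//; lra.
Qed.

Lemma cont_integrable2 g a b c d : continuous g ->
  mu2.-integrable (rect a b c d) (EFin \o g).
Proof.
move=> cg; apply: measurable_bounded_integrable.
- exact: rect_measurable.
- have [ab|ba] := leP a b; last first.
    by rewrite /rect set_itv_ge ?set0X ?measure0//= bnd_simp -ltNge.
  have [cd|dc] := leP c d; last first.
    by rewrite /rect (@set_itv_ge _ _ (BLeft c)) ?setX0 ?measure0//= bnd_simp -ltNge.
  by have := rect_measure ab cd => /= ->; rewrite ltry.
- exact: measurable_funS (plane_cont_measurable cg).
- have /compact_bounded[M [_ mrt]] := continuous_compact (continuous_subspaceT cg) (@rect_compact a b c d).
  by exists M; split; rewrite ?num_real // => ? ? ? ?; exact: mrt.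
Qed.

(** Fubini reduces the integral over a rectangle to iterated one-dimensional
    integrals, and those agree with the integrals given by primitives. *)
Lemma dint_lebesgue g a b c d : continuous g -> a <= b -> c <= d ->
  (\int[mu2]_(z in rect a b c d) (g z)%:E =
   (oint a b (fun x => oint c d (fun y => g (x, y))))%:E)%E.
Proof.
move=> cg ab cd.
rewrite integral_mkcond -integral12_prod_meas1; last first.
  by have /integrable_mkcond := cont_integrable2 a b c d cg; apply; exact: rect_measurable.
rewrite -oint_lebesgue//; last exact: cont_oint_param.
rewrite [RHS]integral_mkcond; apply: eq_integral => x _.
rewrite /fubini_F/= patchE; case: ifPn => xab.
  rewrite -oint_lebesgue//; last by cts.
  rewrite [RHS]integral_mkcond; apply: eq_integral => y _.
  rewrite !patchE; congr (if _ then _ else _).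
  by apply/idP/idP; rewrite !inE /rect/=; rewrite inE in xab => // -[].
apply: integral0_eq => y _; rewrite patchE ifF//.
by apply/negbTE; apply: contra xab; rewrite !inE => -[].
Qed.

Lemma dint_lebesgueC g a b c d : continuous g -> a <= b -> c <= d ->
  (\int[mu2]_(z in rect a b c d) (g z)%:E =
   (oint c d (fun y => oint a b (fun x => g (x, y))))%:E)%E.
Proof.
move=> cg ab cd.
rewrite integral_mkcond -integral21_prod_meas1; last first.
  by have /integrable_mkcond := cont_integrable2 a b c d cg; apply; exact: rect_measurable.
pose g' (z : R * R) := g (z.2, z.1).
have cg' : continuous g' by rewrite /g'; cts.
rewrite -oint_lebesgue//; last exact: (cont_oint_param (g := g')).
rewrite [RHS]integral_mkcond; apply: eq_integral => y _.
rewrite /fubini_G/= patchE; case: ifPn => ycd.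
  rewrite -oint_lebesgue//; last by cts.
  rewrite [RHS]integral_mkcond; apply: eq_integral => x _.
  rewrite !patchE; congr (if _ then _ else _).
  by apply/idP/idP; rewrite !inE /rect/=; rewrite inE in ycd => // -[].
apply: integral0_eq => x _; rewrite patchE ifF//.
by apply/negbTE; apply: contra ycd; rewrite !inE => -[].
Qed.

(** Both iterated integrals are the Lebesgue integral over the rectangle. *)
Lemma dint_swap g a b c d : continuous g -> a <= b -> c <= d ->
  oint a b (fun x => oint c d (fun y => g (x, y))) =
  oint c d (fun y => oint a b (fun x => g (x, y))).
Proof.
move=> cg ab cd; apply: EFin_inj.
by rewrite -dint_lebesgue// -dint_lebesgueC.
Qed.

(** The translated measure has the same value on intervals, which
    characterizes Lebesgue measure. *)
Lemma lebesgue_shift (a : R) (A : set R) : measurable A ->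
  pushforward mu (fun x : measurableTypeR R => (x + a : measurableTypeR R)) A = mu A.
Proof.
move=> mA.
have ms : measurable_fun setT (fun x : measurableTypeR R => (x + a : measurableTypeR R)).
  exact: measurable_funD.
pose s : {mfun measurableTypeR R >-> measurableTypeR R} := HB.pack (fun x : measurableTypeR R => (x + a : measurableTypeR R)) (isMeasurableFun.Build _ _ _ _ _ ms).
rewrite -/(pushforward mu s A).
apply/esym; apply: lebesgue_measure_unique => //= _ [[u v]] _ <-.
rewrite /pushforward /= (_ : s @^-1` _ = `]u - a, v - a]%classic).
  rewrite !lebesgue_measure_itv/= !lte_fin ltrD2r; case: ifP => // _.
  by rewrite -!EFinD; congr EFin; ring.
by apply/seteqP; split => x /=; rewrite !in_itv/= ltrBlDr lerBrDr.
Qed.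

Lemma ge0_integral_shift (a : R) (f : measurableTypeR R -> \bar R) :
  measurable_fun setT f -> (forall x, 0 <= f x)%E ->
  (\int[mu]_x f (x + a)%R = \int[mu]_x f x)%E.
Proof.
move=> mf f0.
have ms : measurable_fun setT (fun x : measurableTypeR R => (x + a : measurableTypeR R)).
  exact: measurable_funD.
pose s : {mfun measurableTypeR R >-> measurableTypeR R} := HB.pack (fun x : measurableTypeR R => (x + a : measurableTypeR R)) (isMeasurableFun.Build _ _ _ _ _ ms).
have := @ge0_integral_pushforward _ _ _ _ R _ ms mu setT f measurableT mf (fun y _ => f0 y).
rewrite preimage_setT => <-.
apply: eq_measure_integral => A mA _.
exact: (lebesgue_shift a mA).
Qed.

Lemma ge0_integral_shift2 (w : R * R) (f : measurableTypeR R * measurableTypeR R -> \bar R) :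
  measurable_fun setT f -> (forall x, 0 <= f x)%E ->
  (\int[mu2]_z f (z + w)%R = \int[mu2]_z f z)%E.
Proof.
move=> mf f0.
have ms : measurable_fun setT (fun z : measurableTypeR R * measurableTypeR R => (z.1 + w.1, z.2 + w.2)).
  by apply: measurable_fun_pair; apply: measurable_funD.
have mfs : measurable_fun setT (fun z : measurableTypeR R * measurableTypeR R => f (z + w)%R).
  exact: (measurableT_comp mf ms).
rewrite (fubini_tonelli1 _ mfs)// (fubini_tonelli1 _ mf)//.
rewrite /fubini_F.
transitivity (\int[mu]_x \int[mu]_y f (x + w.1, y)%R)%E.
  apply: eq_integral => x _.
  rewrite -[RHS](ge0_integral_shift w.2)//.
  exact: measurableT_comp mf _.
rewrite -[RHS](ge0_integral_shift w.1)//.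
  exact: measurable_fun_fubini_tonelli_F.
by move=> x; exact: integral_ge0.
Qed.

End Plane.

(** * Continuity of translations in L2 *)

Section L2.
Context {R : realType}.
Notation mu := (@lebesgue_measure R).
Notation mu2 := (lebesgue_measure \x lebesgue_measure)%E.
Local Notation rT := (measurableTypeR R).

Definition clip (M x : R) := Num.max (- M) (Num.min x M).

Lemma clip_spec M x : 0 <= M ->
  [\/ x < - M /\ clip M x = - M, - M <= x <= M /\ clip M x = x | M < x /\ clip M x = M].
Proof.
move=> M0; have [h1|h1] := ltP x (- M).
  apply: Or31; split => //; rewrite /clip min_l ?max_l//; lra.
have [h2|h2] := leP x M.
  apply: Or32; split => //.
  by rewrite /clip min_l ?max_r.
by apply: Or33; split => //; rewrite /clip min_r ?max_r//; lra.
Qed.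

Lemma clip_bound M x : 0 <= M -> `|clip M x| <= M.
Proof. by move=> M0; rewrite ler_norml; case: (clip_spec x M0) => -[? ->]; lra. Qed.

Lemma clip_id M x : `|x| <= M -> clip M x = x.
Proof.
move=> xM; have M0 : 0 <= M by exact: le_trans xM.
by move: xM; rewrite ler_norml; case: (clip_spec x M0) => -[? ->]; lra.
Qed.

Lemma clip_lip M x y : 0 <= M -> `|clip M x - clip M y| <= `|x - y|.
Proof.
move=> M0; have := ler_norm (x - y); have := ler_norm (y - x); rewrite (distrC y x) ler_norml.
have := normr_ge0 (x - y).
by case: (clip_spec x M0) => -[? ->]; case: (clip_spec y M0) => -[? ->]; lra.
Qed.

Lemma clip_dist M x : 0 <= M -> (x - clip M x) ^+ 2 <= x ^+ 2.
Proof. by move=> M0; case: (clip_spec x M0) => -[? ->]; nra. Qed.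

Lemma clip_cont M : continuous (clip M).
Proof. by rewrite /clip; cts. Qed.

Lemma measurable_clip (f : rT -> rT) M : measurable_fun setT f -> measurable_fun setT (fun x => clip M (f x) : rT).
Proof.
by move=> mf; apply: measurableT_comp mf; apply: continuous_measurable_fun; exact: clip_cont.
Qed.

Lemma cvge0_le (u : nat -> \bar R) :
  (forall r : R, 0 < r -> \forall n \near \oo, (0 <= u n <= r%:E)%E) -> u x @[x --> \oo] --> 0%E.
Proof.
move=> h; apply/fine_cvgP; split.
  near=> n; have /andP[u0 u1] : (0 <= u n <= 1%:E)%E by near: n; exact: h.
  by rewrite ge0_fin_numE//; apply: le_lt_trans u1 _; rewrite ltry.
apply/cvgrPdist_le => r r0; near=> n.
have /andP[u0 u1] : (0 <= u n <= r%:E)%E by near: n; exact: h.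
have fn : u n \is a fin_num by rewrite ge0_fin_numE//; apply: le_lt_trans u1 _; rewrite ltry.
rewrite sub0r normrN /= ger0_norm ?fine_ge0//.
by rewrite -lee_fin fineK.
Unshelve. all: by end_near. Qed.

Lemma cvge0_lt (u : nat -> \bar R) (e : R) : u x @[x --> \oo] --> 0%E -> 0 < e ->
  exists n, (u n < e%:E)%E.
Proof.
move=> h e0.
have e0' : (0 < e%:E)%E by rewrite lte_fin.
by have [n _ /(_ n (leqnn n))] := h _ (open_ereal_lt' e0'); exists n.
Qed.

(** Dominated convergence: the integrand is at most g^2, and it vanishes as
    soon as |g x| <= M. *)
Lemma clip_L2 (g : rT -> rT) : measurable_fun setT g ->
  (\int[mu]_x ((g x) ^+ 2)%:E < +oo)%E ->
  forall e : R, 0 < e -> exists2 M : R, 0 < M & (\int[mu]_x ((g x - clip M (g x)) ^+ 2)%:E <= e%:E)%E.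
Proof.
move=> mg g2 e e0.
have mg2 : measurable_fun setT (fun x => ((g x) ^+ 2)%:E).
  by apply/measurable_EFinP; exact: measurable_funX.
have := @dominated_convergence _ _ _ mu setT measurableT
  (fun (n : nat) x => ((g x - clip n.+1%:R (g x)) ^+ 2)%:E) (cst 0%E) (fun x => ((g x) ^+ 2)%:E).
case.
- move=> n; apply/measurable_EFinP; apply: measurable_funX; apply: measurable_funB => //.
  exact: measurable_clip.
- exact: measurable_cst.
- apply: aeW => x _; apply: cvg_near_cst.
  near=> n; rewrite clip_id ?subrr ?expr0n//.
  apply: (@le_trans _ _ n%:R); last by rewrite ler_nat.
  near: n; exact: nbhs_infty_ger.
- apply/integrableP; split => //.
  by under eq_integral do rewrite gee0_abs ?lee_fin ?sqr_ge0//.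
- apply: aeW => x n _; rewrite gee0_abs ?lee_fin ?sqr_ge0//.
  exact: clip_dist.
move=> _ _ ; rewrite integral0 => h.
have [n /= hn] := cvge0_lt h e0.
by exists n.+1%:R => //; exact: ltW.
Unshelve. all: by end_near. Qed.

(** Continuity of translations in L2. The function g is clipped at a level M;
    the clipped function has a continuous approximation phi in L1, and after
    phi is clipped too this is an approximation in L2, since the difference is
    at most 2 M. The translates of phi are close to phi by uniform
    continuity. *)
Lemma L2_shift1 (g : rT -> rT) (N : R) : measurable_fun setT g ->
  (forall x, N < `|x| -> g x = 0) ->
  (\int[mu]_x ((g x) ^+ 2)%:E < +oo)%E ->
  forall e : R, 0 < e -> exists2 d : R, 0 < d & forall t : R, `|t| < d ->
    (\int[mu]_x ((g (x + t)%R - g x) ^+ 2)%:E <= e%:E)%E.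
Proof.
move=> mg gN g2 e0 e0_gt0.
(* 27 = 3 (4 + 1 + 4): the three terms of the final decomposition cost 4 e, e
   and 4 e, and the square of their sum costs a factor 3 *)
pose e := e0 / 27.
have e_gt0 : 0 < e by rewrite divr_gt0.
have [M M0 hM] := clip_L2 mg g2 e_gt0.
pose gM x := clip M (g x).
have mgM : measurable_fun setT (gM : rT -> rT) by exact: measurable_clip.
(* the margin 2 leaves room for shifts of size at most 1 on both sides *)
pose L := `|N| + 2.
have L0 : 0 < L by rewrite /L; have := normr_ge0 N; lra.
pose E : set rT := `[- L, L]%classic.
have mE : measurable E by exact: measurable_itv.
have muE : mu E = (L + L)%:E.
  by rewrite /E lebesgue_measure_itv/= lte_fin ifT ?opprK//; lra.
have iM : mu.-integrable E (EFin \o gM).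
  apply: measurable_bounded_integrable => //.
  - by rewrite [ltLHS]muE ltry.
  - exact: measurable_funS mgM.
  - exists M; split; first exact: num_real.
    move=> y My x _; apply: le_trans (ltW My); apply: clip_bound; exact: ltW.
have muElt : (mu E < +oo)%E by rewrite [ltLHS]muE ltry.
have [phi_ [cphi iphi hphi]] := approximation_continuous_integrable mE muElt iM.
have eM : 0 < e / (2 * M) by rewrite divr_gt0// mulr_gt0.
have [n /= hn] := cvge0_lt hphi eM.
pose phi x := clip M (phi_ n x).
have cp : continuous phi by apply: cont_comp; [exact: clip_cont|exact: cphi].
have mphi : measurable_fun setT (phi : rT -> rT) by exact: continuous_measurable_fun.
have h1 : (\int[mu]_(z in E) ((gM z - phi z) ^+ 2)%:E <= e%:E)%E.
  apply: (@le_trans _ _ (\int[mu]_(z in E) ((2 * M)%:E * `|(gM z - phi_ n z)%:E|))%E).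
    apply: ge0_le_integral => //.
    - by move=> x _; rewrite lee_fin sqr_ge0.
    - by apply/measurable_EFinP/measurable_funX/measurable_funB; exact: measurable_funS (measurableT) _ _.
    - apply: measurable_funeM; apply: measurableT_comp => //; apply/measurable_EFinP/measurable_funB; [exact: measurable_funS mgM|].
      exact: measurable_funS (continuous_measurable_fun (cphi n)).
    - move=> x _; rewrite lee_fin -real_normK ?num_real// expr2.
      apply: ler_pM => //.
        have := clip_bound (g x) (ltW M0); have := clip_bound (phi_ n x) (ltW M0).
        rewrite -/(phi x) -/(gM x) => *; apply: le_trans (ler_normB _ _) _; lra.
      rewrite (_ : gM x - phi x = clip M (gM x) - clip M (phi_ n x)).
        exact: clip_lip (ltW M0).
      by rewrite (clip_id (x := gM x))//; exact: clip_bound (ltW M0).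
  rewrite ge0_integralZl//; first last.
  - by rewrite lee_fin mulr_ge0// ltW.
  - apply: measurableT_comp => //; apply/measurable_EFinP/measurable_funB; [exact: measurable_funS mgM|].
      exact: measurable_funS (continuous_measurable_fun (cphi n)).
  apply: le_trans (_ : ((2 * M)%:E * (e / (2 * M))%:E <= _)%E).
    by rewrite lee_pmul2l ?lte_fin// ?mulr_gt0// ltW.
  by rewrite -EFinM lee_fin mulrC divfK// gt_eqF// mulr_gt0.
have eL : 0 < e / (2 * L) by rewrite divr_gt0// mulr_gt0.
have cp' : continuous (fun z : R * R => phi z.1) by cts.
have r0 : 0 < Num.min 1 (e / (2 * L)) by rewrite lt_min eL ltr01.
have [d d0 hd] := ucont_box L cp' r0.
exists (Num.min 1 d); first by rewrite lt_min d0 ltr01.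
move=> t; rewrite lt_min => /andP[t1 td].
pose E1 : set rT := `[- (L - 1), L - 1]%classic.
have mE1 : measurable E1 by exact: measurable_itv.
have muE1 : mu E1 = (L - 1 + (L - 1))%:E.
  by rewrite /E1 lebesgue_measure_itv/= lte_fin ifT ?opprK//; have := normr_ge0 N; rewrite /L; lra.
pose D x := ((g x - phi x) ^+ 2)%:E.
have mD : measurable_fun setT (D : rT -> \bar R).
  by apply/measurable_EFinP/measurable_funX/measurable_funB.
have D0 x : (0 <= D x)%E by rewrite lee_fin sqr_ge0.
have sh : measurable_fun setT (fun x : rT => x + t : rT) by exact: measurable_funD.
have h2 : (\int[mu]_(x in E) D x <= (4 * e)%:E)%E.
  apply: (@le_trans _ _ (\int[mu]_(x in E) (2%:E * ((g x - gM x) ^+ 2)%:E + 2%:E * ((gM x - phi x) ^+ 2)%:E))%E).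
    apply: ge0_le_integral => //.
    - exact: measurable_funS mD.
    - apply: emeasurable_funD; apply: measurable_funeM; apply/measurable_EFinP/measurable_funX/measurable_funB => //;
      apply: measurable_funS (measurableT) _ _ => //.
    - move=> x _; rewrite /D -!EFinM -EFinD lee_fin.
      have := sqr_ge0 (g x - gM x - (gM x - phi x)); nra.
  rewrite ge0_integralD//; first last.
  - apply: measurable_funeM; apply/measurable_EFinP/measurable_funX/measurable_funB => //;
      apply: measurable_funS (measurableT) _ _ => //.
  - by move=> x _; rewrite mule_ge0// lee_fin sqr_ge0.
  - apply: measurable_funeM; apply/measurable_EFinP/measurable_funX/measurable_funB => //;
      apply: measurable_funS (measurableT) _ _ => //.
  - by move=> x _; rewrite mule_ge0// lee_fin sqr_ge0.
  rewrite !ge0_integralZl//; first last.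
  - by move=> x _; rewrite lee_fin sqr_ge0.
  - apply/measurable_EFinP/measurable_funX/measurable_funB => //;
      apply: measurable_funS (measurableT) _ _ => //.
  - by move=> x _; rewrite lee_fin sqr_ge0.
  - apply/measurable_EFinP/measurable_funX/measurable_funB => //;
      apply: measurable_funS (measurableT) _ _ => //.
  rewrite (_ : 4 * e = 2 * e + 2 * e); last ring.
  rewrite [leRHS]EFinD !(EFinM 2 e); apply: leeD; rewrite lee_pmul2l ?lte_fin//.
  apply: le_trans hM; apply: ge0_subset_integral => //.
    by apply/measurable_EFinP/measurable_funX/measurable_funB.
  by move=> x _; rewrite lee_fin sqr_ge0.
have h3 : (\int[mu]_(x in E1) D (x + t)%R <= (4 * e)%:E)%E.
  apply: le_trans h2.
  rewrite [leRHS]integral_mkcond -(ge0_integral_shift t); last 2 first.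
  - by apply/(measurable_restrictT _ mE); exact: measurable_funS mD.
  - by move=> x; rewrite patchE; case: ifP.
  rewrite [leLHS]integral_mkcond; apply: ge0_le_integral => //.
  - by move=> x _; rewrite patchE; case: ifP.
  - apply/(measurable_restrictT _ mE1); apply: measurable_funS (measurableT) _ _ => //.
    exact: measurableT_comp mD sh.
  - apply: measurableT_comp sh; apply/(measurable_restrictT _ mE); exact: measurable_funS mD.
  - move=> x _; rewrite !patchE; case: ifPn => xE1; last by case: ifP.
    rewrite ifT// inE /E/= in_itv/=; move: xE1; rewrite inE /E1/= in_itv/=.
    move: t1; rewrite ltr_norml; lra.
pose S x := ((phi (x + t) - phi x) ^+ 2)%:E.
have mS : measurable_fun setT (S : rT -> \bar R).
  apply/measurable_EFinP/measurable_funX/measurable_funB => //.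
  exact: measurableT_comp mphi sh.
have S0 x : (0 <= S x)%E by rewrite lee_fin sqr_ge0.
have h4 : (\int[mu]_(x in E1) S x <= e%:E)%E.
  apply: (@le_trans _ _ (\int[mu]_(x in E1) (cst (e / (2 * L))%:E x))%E).
    apply: ge0_le_integral => //.
      exact: measurable_funS mS.
    move=> x; rewrite /E1/= in_itv/= => xE1; rewrite lee_fin -real_normK ?num_real//.
    have : `|phi (x + t) - phi x| < Num.min 1 (e / (2 * L)).
      apply: (hd (x, 0) (x + t, 0)) => /=.
      - by rewrite ler_norml; lra.
      - by rewrite normr0 ltW.
      - by rewrite addrC addKr.
      - by rewrite subrr normr0.
    rewrite lt_min => /andP[u1 u2]; rewrite expr2.
    have := normr_ge0 (phi (x + t) - phi x); nra.
  rewrite integral_cst// [X in (_ * X)%E](_ : _ = (L - 1 + (L - 1))%:E); last first.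
    exact: muE1.
  rewrite -EFinM lee_fin -mulrA ger_pMr// mulrC ler_pdivrMr ?mulr_gt0//; lra.
apply: (@le_trans _ _ (\int[mu]_(x in E1) (3%:E * (D (x + t)%R + S x + D x)))%E).
  rewrite [leRHS]integral_mkcond; apply: ge0_le_integral => //.
  - by move=> x _; rewrite lee_fin sqr_ge0.
  - apply/measurable_EFinP/measurable_funX/measurable_funB => //.
    exact: measurableT_comp mg sh.
  - apply/(measurable_restrictT _ mE1); apply: measurable_funS (measurableT) _ _ => //.
    apply: measurable_funeM; apply: emeasurable_funD => //; apply: emeasurable_funD => //.
    exact: measurableT_comp mD sh.
  move=> x _; rewrite patchE; case: ifPn => xE1.
    rewrite /D /S -!EFinD -EFinM lee_fin.
    set a := g (x + t); set b := phi (x + t); set c := phi x; set f := g x.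
    have := sqr_ge0 (a - b - (b - c)); have := sqr_ge0 (a - b - (c - f)).
    have := sqr_ge0 (b - c - (c - f)); nra.
  have xN : L - 1 < `|x|.
    rewrite ltNge ler_norml; apply: contra xE1.
    by rewrite inE /E1/= in_itv/=.
  rewrite !gN ?subrr ?expr0n//.
  - by have := ler_norm N; rewrite /L in xN; lra.
  - have : `|x| <= `|x + t| + `|t|.
      by rewrite -{1}(addrK t x); exact: ler_normB.
    by have := ler_norm N; rewrite /L in xN; lra.
have mDt : measurable_fun E1 (fun x : rT => D (x + t)).
  apply: measurable_funS (measurableT) _ _ => //.
  exact: measurableT_comp mD sh.
have mD1 : measurable_fun E1 (D : rT -> \bar R) by exact: measurable_funS mD.
have mS1 : measurable_fun E1 (S : rT -> \bar R) by exact: measurable_funS mS.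
have hD : (\int[mu]_(x in E1) D x <= (4 * e)%:E)%E.
  apply: le_trans h2; apply: ge0_subset_integral => //.
    exact: measurable_funS mD.
  by move=> x; rewrite /E1 /E/= !in_itv/=; lra.
rewrite ge0_integralZl//; last 2 first.
- by apply: emeasurable_funD => //; apply: emeasurable_funD.
- by move=> x _; rewrite !adde_ge0.
rewrite ge0_integralD//; last 2 first.
- by move=> x _; rewrite adde_ge0.
- by apply: emeasurable_funD.
rewrite ge0_integralD//.
have -> : e0%:E = (3%:E * ((4 * e)%:E + e%:E + (4 * e)%:E))%E.
  by rewrite -!EFinD -EFinM; congr EFin; rewrite /e; field.
by rewrite lee_pmul2l ?lte_fin//; apply: leeD => //; apply: leeD.
Qed.

Local Notation rT2 := (rT * rT)%type.

(** Tonelli in the two orders. *)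
Lemma ge0_integral_swap2 (f : rT2 -> \bar R) : measurable_fun setT f ->
  (forall z, 0 <= f z)%E -> (\int[mu2]_z f (z.2, z.1) = \int[mu2]_z f z)%E.
Proof.
move=> mf f0.
have ms : measurable_fun setT (fun z : rT2 => (z.2, z.1) : rT2).
  by apply: measurable_fun_pair; [exact: measurable_snd|exact: measurable_fst].
have mfs : measurable_fun setT (fun z : rT2 => f (z.2, z.1)) by exact: measurableT_comp mf ms.
by rewrite (fubini_tonelli1 _ mfs)// (fubini_tonelli2 _ mf).
Qed.

Lemma measurable_shift2 (w : rT2) : measurable_fun setT (fun z : rT2 => (z.1 + w.1, z.2 + w.2) : rT2).
Proof. by apply: measurable_fun_pair; apply: measurable_funD. Qed.

(** On almost every horizontal line the one-dimensional result applies. The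
    integrals over the lines are dominated by four times those of D^2, so
    dominated convergence excludes a sequence of shifts for which the
    conclusion fails. *)
Lemma L2_shiftx (D : rT2 -> R) (N : R) : measurable_fun setT D ->
  (forall x y, N < `|x| -> D (x, y) = 0) ->
  (\int[mu2]_z ((D z) ^+ 2)%:E < +oo)%E ->
  forall e : R, 0 < e -> exists2 d : R, 0 < d & forall t : R, `|t| < d ->
    (\int[mu2]_z ((D (z.1 + t, z.2) - D z) ^+ 2)%:E <= e%:E)%E.
Proof.
move=> mD DN D2 e e0.
apply: contrapT => hn.
have {}hn (n : nat) : exists t : R, `|t| < n.+1%:R^-1 /\
    ~ (\int[mu2]_z ((D (z.1 + t, z.2) - D z) ^+ 2)%:E <= e%:E)%E.
  apply: contrapT => /forallNP h; apply: hn; exists n.+1%:R^-1; first by rewrite invr_gt0.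
  by move=> t tn; apply: contrapT => k; apply: (h t).
have [t ht] := choice hn.
have mDt (s : R) : measurable_fun setT (fun z : rT2 => D (z.1 + s, z.2)).
  apply: measurableT_comp mD _.
  by apply: measurable_fun_pair => //; apply: measurable_funD.
have mDts (s : R) : measurable_fun setT (fun z : rT2 => ((D (z.1 + s, z.2) - D z) ^+ 2)%:E).
  by apply/measurable_EFinP/measurable_funX/measurable_funB.
have mD2 : measurable_fun setT (fun z : rT2 => ((D z) ^+ 2)%:E).
  by apply/measurable_EFinP/measurable_funX.
have D2_0 z : (0 <= ((D z) ^+ 2)%:E)%E by rewrite lee_fin sqr_ge0.
pose F n (y : rT) : \bar R := (\int[mu]_x ((D (x + t n, y)%R - D (x, y)) ^+ 2)%:E)%E.
pose G (y : rT) : \bar R := (4%:E * \int[mu]_x ((D (x, y)) ^+ 2)%:E)%E.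
have mF n : measurable_fun setT (F n).
  apply: (measurable_fun_fubini_tonelli_G (m1 := mu) (fun z : rT2 => ((D (z.1 + t n, z.2) - D z) ^+ 2)%:E)) => //.
  by move=> z; rewrite lee_fin sqr_ge0.
have mG : measurable_fun setT G.
  apply: measurable_funeM.
  exact: (measurable_fun_fubini_tonelli_G (m1 := mu) (fun z : rT2 => ((D z) ^+ 2)%:E)).
have G0 y : (0 <= G y)%E by rewrite mule_ge0// integral_ge0.
have F0 n y : (0 <= F n y)%E by rewrite integral_ge0// => x _; rewrite lee_fin sqr_ge0.
have mDy (y : rT) : measurable_fun setT (fun x : rT => D (x, y)).
  by apply: measurableT_comp mD _; exact: measurable_fun_pair.
have mshift (s : R) : measurable_fun setT (fun x : rT => x + s : rT) by exact: measurable_funD.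
have FG n y : (F n y <= G y)%E.
  pose h (x : rT) := ((D (x, y)) ^+ 2)%:E.
  have mh : measurable_fun setT h by apply/measurable_EFinP/measurable_funX.
  have mhs : measurable_fun setT (fun x : rT => h (x + t n)) by exact: measurableT_comp mh (mshift _).
  have h0 x : (0 <= h x)%E by rewrite lee_fin sqr_ge0.
  apply: (@le_trans _ _ (\int[mu]_x (2%:E * (h (x + t n)%R + h x)))%E).
    apply: ge0_le_integral => //.
    - by move=> x _; rewrite lee_fin sqr_ge0.
    - apply/measurable_EFinP/measurable_funX/measurable_funB => //.
      exact: measurableT_comp (mDy y) (mshift _).
    - by apply: measurable_funeM; exact: emeasurable_funD.
    move=> x _; rewrite /h -EFinD -EFinM lee_fin.
    have := sqr_ge0 (D (x + t n, y) + D (x, y)); nra.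
  rewrite ge0_integralZl//; [|exact: emeasurable_funD|by move=> x _; rewrite adde_ge0].
  rewrite ge0_integralD// ge0_integral_shift// /G -/h.
  rewrite -[X in (X + X)%E]mul1e -ge0_muleDl// -EFinD muleA -EFinM.
  by rewrite lee_wpmul2r ?integral_ge0// lee_fin; lra.
have iG : mu.-integrable setT G.
  apply/integrableP; split => //.
  under eq_integral do rewrite gee0_abs//.
  rewrite ge0_integralZl//; first last.
  - by move=> y _; exact: integral_ge0.
  - exact: (measurable_fun_fubini_tonelli_G (m1 := mu) (fun z : rT2 => ((D z) ^+ 2)%:E)).
  rewrite -(fubini_tonelli2 _ mD2)//.
  by apply: lte_mul_pinfty.
have := @dominated_convergence _ _ _ mu setT measurableT F (cst 0%E) G mF (measurable_cst _).
case.
- have := integrable_ae measurableT iG.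
  apply: filterS => y /(_ I) Gy _.
  have fy : (\int[mu]_x ((D (x, y)) ^+ 2)%:E < +oo)%E.
    have : (G y < +oo)%E by rewrite ltey_eq Gy.
    apply: le_lt_trans; rewrite -[leLHS]mul1e /G; apply: lee_wpmul2r; last by rewrite lee_fin; lra.
    by apply: integral_ge0 => x _; exact: (D2_0 (x, y)).
  have sh := L2_shift1 (mDy y) (fun x => DN x y) fy.
  apply: cvge0_le => r r0.
  have [d d0 hd] := sh _ r0.
  near=> n; rewrite F0/=; apply: hd.
  have [tn _] := ht n; apply: lt_trans tn _.
  near: n; exact: near_infty_natSinv_lt (PosNum d0).
- exact: iG.
- by apply: aeW => y n _; rewrite gee0_abs.
move=> _ _; rewrite integral0 => h.
have [n /= hn'] := cvge0_lt h e0.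
have [_ ] := ht n; apply.
rewrite (fubini_tonelli2 _ (mDts (t n))); first exact: ltW.
by move=> z; rewrite lee_fin sqr_ge0.
Unshelve. all: by end_near. Qed.

(** A translation of the plane is a horizontal one followed by a vertical one;
    the vertical one is reduced to the horizontal one by exchanging the
    coordinates. *)
Lemma L2_shift2 (D : rT2 -> R) (N : R) : measurable_fun setT D ->
  (forall x y, N < `|x| -> D (x, y) = 0) ->
  (forall x y, N < `|y| -> D (x, y) = 0) ->
  (\int[mu2]_z ((D z) ^+ 2)%:E < +oo)%E ->
  forall e : R, 0 < e -> exists2 d : R, 0 < d & forall w : R * R, `|w.1| < d -> `|w.2| < d ->
    (\int[mu2]_z ((D (z + w)%R - D z) ^+ 2)%:E <= e%:E)%E.
Proof.
move=> mD DN1 DN2 D2 e e0.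
have e4 : 0 < e / 4 by rewrite divr_gt0.
have [d1 d10 h1] := L2_shiftx mD DN1 D2 e4.
pose D' (z : rT2) := D (z.2, z.1).
have ms : measurable_fun setT (fun z : rT2 => (z.2, z.1) : rT2).
  by apply: measurable_fun_pair; [exact: measurable_snd|exact: measurable_fst].
have mD' : measurable_fun setT D' by exact: measurableT_comp mD ms.
have [|d2 d20 h2] := L2_shiftx mD' (fun x y => DN2 y x) _ e4.
  rewrite -(ge0_integral_swap2 (f := fun z => ((D' z) ^+ 2)%:E))//=; last 2 first.
  - by apply/measurable_EFinP/measurable_funX.
  - by move=> z; rewrite lee_fin sqr_ge0.
  by apply: le_lt_trans D2; rewrite le_eqVlt; apply/orP; left; apply/eqP; apply: eq_integral => -[].
exists (Num.min d1 d2); first by rewrite lt_min d10.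
move=> [a b]; rewrite !lt_min /= => /andP[a1 _] /andP[_ b2].
have mDw (w : R * R) : measurable_fun setT (fun z : rT2 => D (z + w)%R).
  exact: measurableT_comp mD (measurable_shift2 w).
have mf1 : measurable_fun setT (fun z : rT2 => ((D (z.1 + a, z.2) - D z) ^+ 2)%:E).
  apply/measurable_EFinP/measurable_funX/measurable_funB => //.
  have := mDw (a, 0); congr (measurable_fun _ _); apply/funext => z /=; congr D; congr pair; exact: addr0.
pose S1 (z : rT2) := ((D (z + (a, b))%R - D (z + (0, b))%R) ^+ 2)%:E.
pose S2 (z : rT2) := ((D (z + (0, b))%R - D z) ^+ 2)%:E.
have mS1 : measurable_fun setT S1 by apply/measurable_EFinP/measurable_funX/measurable_funB.
have mS2 : measurable_fun setT S2 by apply/measurable_EFinP/measurable_funX/measurable_funB.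
have S10 z : (0 <= S1 z)%E by rewrite lee_fin sqr_ge0.
have S20 z : (0 <= S2 z)%E by rewrite lee_fin sqr_ge0.
apply: (@le_trans _ _ (\int[mu2]_z (2%:E * (S1 z + S2 z)))%E).
  apply: ge0_le_integral => //.
  - by move=> z _; rewrite lee_fin sqr_ge0.
  - by apply/measurable_EFinP/measurable_funX/measurable_funB.
  - by apply: measurable_funeM; exact: emeasurable_funD.
  move=> z _; rewrite /S1 /S2 -EFinD -EFinM lee_fin.
  set p := D (z + (a, b))%R; set q := D (z + (0, b))%R; set r := D z.
  have := sqr_ge0 (p - q - (q - r)); nra.
rewrite ge0_integralZl//; [|exact: emeasurable_funD|by move=> z _; rewrite adde_ge0].
rewrite ge0_integralD//.
have pE (p q : R * R) : p + q = (p.1 + q.1, p.2 + q.2) by [].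
have k1 : (\int[mu2]_z S1 z <= (e / 4)%:E)%E.
  apply: le_trans (h1 a a1).
  rewrite -[leRHS](ge0_integral_shift2 (0, b) mf1); last first.
    by move=> z; rewrite lee_fin sqr_ge0.
  rewrite le_eqVlt; apply/orP; left; apply/eqP; apply: eq_integral => -[x y] _.
  by rewrite /S1 !pE /= !addr0.
have k2 : (\int[mu2]_z S2 z <= (e / 4)%:E)%E.
  apply: le_trans (h2 b b2).
  rewrite -[leRHS](ge0_integral_swap2 (f := fun z => ((D' (z.1 + b, z.2) - D' z) ^+ 2)%:E))//=; last 2 first.
  - apply/measurable_EFinP/measurable_funX/measurable_funB => //.
    apply: measurableT_comp mD _.
    by apply: (measurable_fun_pair (f := fun z : rT2 => z.2) (g := fun z : rT2 => z.1 + b)); [exact: measurable_snd|apply: measurable_funD].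
  - by move=> z; rewrite lee_fin sqr_ge0.
  rewrite le_eqVlt; apply/orP; left; apply/eqP; apply: eq_integral => -[x y] _.
  by rewrite /S2 /D' !pE /= !addr0.
apply: (@le_trans _ _ (2%:E * ((e / 4)%:E + (e / 4)%:E))%E).
  by rewrite lee_pmul2l// ?lte_fin//; apply: leeD.
by rewrite -EFinD -EFinM lee_fin; lra.
Qed.

End L2.

(** * Smooth cutoffs and kernels *)

Section Smooth.
Context {R : realType}.

(** The derivatives of exp (- 1/t), extended by 0 to t <= 0, are linear
    combinations of these functions. *)
Definition flat (k : nat) (t : R) : R := if 0 < t then t^-1 ^+ k * expR (- t^-1) else 0.

Lemma flat_ge0 k t : 0 <= flat k t.
Proof.
rewrite /flat; case: ifP => // t0.
by rewrite mulr_ge0 ?expR_ge0// exprn_ge0// invr_ge0 ltW.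
Qed.

(** The exponential series of exp (1/t) dominates its term of degree k + 2.
    The factor t^2 is what differentiability at 0 needs. *)
Lemma flat_le k t : flat k t <= (k.+2)`!%:R * t ^+ 2.
Proof.
have f0 : 0 < (k.+2)`!%:R :> R by rewrite ltr0n fact_gt0.
rewrite /flat; case: ifPn => t0; last by rewrite mulr_ge0 ?sqr_ge0// ltW.
have ti : 0 < t^-1 by rewrite invr_gt0.
have := expR_ge1Dxn k.+1 (ltW ti) => h.
have {}h : t^-1 ^+ k.+2 / k.+2`!%:R <= expR t^-1 by rewrite (le_trans _ h)// lerDr.
rewrite expRN ler_pdivrMr ?expR_gt0//.
rewrite ler_pdivrMr// in h.
have -> : t^-1 ^+ k = t ^+ 2 * t^-1 ^+ k.+2.
  by rewrite !exprS expr0; field; rewrite gt_eqF.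
rewrite [leRHS](_ : _ = t ^+ 2 * (expR t^-1 * (k.+2)`!%:R)); last ring.
by apply: ler_wpM2l => //; exact: sqr_ge0.
Qed.

Lemma is_derive_flat k (t : R) : is_derive t 1 (flat k) (flat k.+2 t - k%:R * flat k.+1 t).
Proof.
have [t0|t0|->] := ltgtP t 0.
- rewrite /flat !ifF; [|by apply/negbTE; rewrite -leNgt ltW..].
  rewrite mulr0 subr0.
  have H : is_derive t 1 (fun _ : R => 0 : R) (0 : R) by exact: is_derive_cst.
  apply: near_eq_is_derive H.
  near=> u; rewrite ifF//; apply/negbTE; rewrite -leNgt ltW//.
  by near: u; exact: lt_nbhsl.
- pose h (u : R) := u^-1 ^+ k * expR (- u^-1).
  apply: (near_eq_is_derive (f := h)).
    near=> u; rewrite /flat ifT//; near: u; exact: lt_nbhsr.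
  have d1 : is_derive t 1 (fun u : R => u^-1) (- t ^- 2).
    have := @is_deriveV _ id t 1 1; rewrite /= scaler1; apply => //; by rewrite gt_eqF.
  have d2 : is_derive t 1 (fun u : R => expR (- u^-1)) (t ^- 2 * expR (- t^-1)).
    have := @is_derive1_comp R expR (fun u => - u^-1) t _ _ (is_derive_expR _) (is_deriveN d1).
    by rewrite opprK mulrC.
  have d3 : is_derive t 1 (fun u : R => u^-1 ^+ k) (- k%:R * t^-1 ^+ k.+1).
    apply: der_eq (derX k d1) _.
    case: k {h} => [|k]; first by rewrite !mul0r oppr0 mul0r.
    rewrite -exprVn !exprS; ring.
  apply: der_eq (derM d3 d2) _.
  rewrite /flat t0 -exprVn !exprS; ring.
- rewrite /flat ltxx mulr0 subr0.
  have hc : (h^-1 *: (flat k (h + 0) - flat k 0)) @[h --> 0^'] --> (0 : R).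
    apply/cvgrPdist_le => e e0; near=> h.
    have h0 : h != 0 by near: h; exact: nbhs_dnbhs_neq.
    have he : `|h| <= e / (k.+2)`!%:R.
      near: h; apply: dnbhs0_le; rewrite divr_gt0// ltr0n fact_gt0.
    rewrite addr0 {2}/flat ltxx subr0 sub0r normrN /GRing.scale/= normrM normfV.
    rewrite ler_pdivrMl ?normr_gt0// ger0_norm ?flat_ge0//.
    apply: le_trans (flat_le _ _) _.
    rewrite -real_normK ?num_real// expr2 mulrA mulrC.
    apply: ler_wpM2l => //; rewrite mulrC -ler_pdivlMr// ltr0n; exact: fact_gt0.
  have dd : derivable (flat k) (0 : R) 1.
    apply/cvg_ex; exists 0; rewrite /=.
    by under eq_fun do rewrite [_%:A]mulr1.
  apply: DeriveDef => //.
  rewrite /derive; apply/cvg_lim => //.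
  by under eq_fun do rewrite [_%:A]mulr1.
Unshelve. all: by end_near. Qed.

(** A class of functions described by their syntax, closed under
    differentiation and containing a bump function. Smoothness of test
    functions is proved by induction on it. *)
Inductive smooth1 : (R -> R) -> Prop :=
| smooth1_cst c : smooth1 (fun _ => c)
| smooth1_flat k : smooth1 (flat k)
| smooth1_add f g : smooth1 f -> smooth1 g -> smooth1 (fun t => f t + g t)
| smooth1_mul f g : smooth1 f -> smooth1 g -> smooth1 (fun t => f t * g t)
| smooth1_aff f a b : smooth1 f -> smooth1 (fun t => f (a * t + b)).

Lemma smooth1_derive f : smooth1 f -> exists2 g, smooth1 g & is_prim g f.
Proof.
elim => {f} [c|k|f g sf [f' sf' pf] sg [g' sg' pg]|f g sf [f' sf' pf] sg [g' sg' pg]|f a b sf [f' sf' pf]].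
- by exists (fun _ => 0) => [|x]; [exact: smooth1_cst|exact: is_derive_cst].
- exists (fun t => flat k.+2 t + (- k%:R) * flat k.+1 t).
    apply: smooth1_add; first exact: smooth1_flat.
    by apply: (smooth1_mul (smooth1_cst _)); exact: smooth1_flat.
  by move=> x; have := is_derive_flat k x; rewrite -mulNr.
- exists (fun t => f' t + g' t); first exact: smooth1_add.
  by move=> x; have ? := pf x; have ? := pg x; apply: is_derive_eq.
- exists (fun t => f t * g' t + g t * f' t).
    by apply: smooth1_add; apply: smooth1_mul.
  by move=> x; have ? := pf x; have ? := pg x; apply: is_derive_eq.
- exists (fun t => a * f' (a * t + b)).
    by apply: (smooth1_mul (smooth1_cst _)); exact: smooth1_aff.
  move=> x.
  have d1 : is_derive x 1 (fun t : R => a * t + b) a.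
    by apply: is_derive_eq; rewrite /GRing.scale/=; ring.
  have := @is_derive1_comp R f (fun t => a * t + b) x _ _ (pf _) d1.
  by rewrite mulrC.
Qed.

Lemma is_prim_cont (f F : R -> R) : is_prim f F -> continuous F.
Proof.
by move=> h x; apply: differentiable_continuous; apply/derivable1_diffP; have [] := h x.
Qed.

Lemma smooth1_cont f : smooth1 f -> continuous f.
Proof. by move=> /smooth1_derive[g _ /is_prim_cont]. Qed.

Lemma is_derive_cvg {V : normedModType R} (f : V -> R) (x v : V) (df : R) : is_derive x v f df ->
  h^-1 *: (f (h *: v + x) - f x) @[h --> 0^'] --> df.
Proof.
move=> [/cvg_ex[l hl] <-].
by rewrite /derive (cvg_lim _ hl).
Qed.

Lemma cvg_is_derive {V : normedModType R} (f : V -> R) (x v : V) (df : R) :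
  h^-1 *: (f (h *: v + x) - f x) @[h --> 0^'] --> df -> is_derive x v f df.
Proof.
move=> hl; apply: DeriveDef; first by apply/cvg_ex; exists df.
by rewrite /derive (cvg_lim _ hl).
Qed.

(** Partial derivatives as directional derivatives along the basis vectors,
    the form in which test functions are differentiated. *)
Lemma is_derive_plane1 (f : R * R -> R) (z : R * R) (df : R) :
  is_derive z.1 1 (fun x => f (x, z.2)) df -> is_derive z (1, 0) f df.
Proof.
move=> /is_derive_cvg h; apply: cvg_is_derive.
rewrite (_ : (fun h : R => _) = (fun h : R => h^-1 *: (f (h *: 1 + z.1, z.2) - f (z.1, z.2))))//.
apply/funext => u.
by rewrite [in LHS]/GRing.scale/= /GRing.add/= /Algebra.add/= /add_pair/= /GRing.scale/= !mulr1 !mulr0 !add0r -surjective_pairing.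
Qed.

Lemma is_derive_plane2 (f : R * R -> R) (z : R * R) (df : R) :
  is_derive z.2 1 (fun y => f (z.1, y)) df -> is_derive z (0, 1) f df.
Proof.
move=> /is_derive_cvg h; apply: cvg_is_derive.
rewrite (_ : (fun h : R => _) = (fun h : R => h^-1 *: (f (z.1, h *: 1 + z.2) - f (z.1, z.2))))//.
apply/funext => u.
by rewrite [in LHS]/GRing.scale/= /GRing.add/= /Algebra.add/= /add_pair/= /GRing.scale/= !mulr1 !mulr0 !add0r -surjective_pairing.
Qed.

(** Every iterated partial derivative of a product a(x) b(y) is again such a
    product, with factors in the class. *)
Lemma smooth_prod1 (a b : R -> R) : smooth1 a -> smooth1 b ->
  smooth (fun z : R * R => a z.1 * b z.2).
Proof.
move=> sa sb s z.
have [a' [b' [sa' [sb' ->]]]] : exists a' b' : R -> R, smooth1 a' /\ smooth1 b' /\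
    iter_partial s (fun z : R * R => a z.1 * b z.2) = (fun z : R * R => a' z.1 * b' z.2).
  elim: s => [|j s [a' [b' [sa' [sb' E]]]]] /=; first by exists a, b.
  rewrite E.
  have [da sda pda] := smooth1_derive sa'; have [db sdb pdb] := smooth1_derive sb'.
  rewrite /basis_vec; case: eqP => _.
    exists da, b'; split=> //; split=> //; apply/funext => w.
    have h : is_derive w.1 1 (fun x => a' x * b' w.2) (da w.1 * b' w.2).
      by have ? := pda w.1; apply: is_derive_eq; rewrite /GRing.scale/=; ring.
    by have := @is_derive_plane1 (fun z => a' z.1 * b' z.2) w _ h; move=> h1; rewrite derive_val.
  exists a', db; split=> //; split=> //; apply/funext => w.
  have h : is_derive w.2 1 (fun y => a' w.1 * b' y) (a' w.1 * db w.2).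
    by have ? := pdb w.2; apply: is_derive_eq; rewrite /GRing.scale/=; ring.
  by have := @is_derive_plane2 (fun z => a' z.1 * b' z.2) w _ h; move=> h1; rewrite derive_val.
have [da sda pda] := smooth1_derive sa'; have [db sdb pdb] := smooth1_derive sb'.
apply: differentiableM.
- apply: (@differentiable_comp _ _ _ _ fst a'); first exact: linear_differentiable cont_fst.
  by apply/derivable1_diffP; have [] := pda z.1.
- apply: (@differentiable_comp _ _ _ _ snd b'); first exact: linear_differentiable cont_snd.
  by apply/derivable1_diffP; have [] := pdb z.2.
Qed.

(** The product of flat 0 t and flat 0 (1 - t) is positive exactly on ]0, 1[;
    it is divided by its integral. *)
Lemma kernel_exists : exists k : R -> R, [/\ smooth1 k, forall t, 0 <= k t,
  forall t, t <= 0 \/ 1 <= t -> k t = 0 & oint 0 1 k = 1].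
Proof.
pose b (t : R) := flat 0 t * flat 0 (-1 * t + 1).
have sb : smooth1 b.
  apply: smooth1_mul; first exact: smooth1_flat.
  apply: smooth1_aff; exact: smooth1_flat.
have b0 t : 0 <= b t by rewrite mulr_ge0// flat_ge0.
have cb := smooth1_cont sb.
have c0 : 0 < oint 0 1 b.
  have [P hP] := prim_exists cb.
  rewrite (ointE _ _ hP).
  have [c cab ->] : exists2 c, c \in `]0, 1[%R & P 1 - P 0 = b c * (1 - 0).
    apply: MVT => //; exact: continuous_subspaceT (is_prim_cont hP).
  rewrite subr0 mulr1 /b /flat.
  move: cab; rewrite in_itv/= => /andP[c1 c2].
  rewrite !ifT//; last by lra.
  by rewrite !expr0 !mul1r mulr_gt0// expR_gt0.
exists (fun t => (oint 0 1 b)^-1 * b t); split.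
- exact: (smooth1_mul (smooth1_cst _)).
- by move=> t; rewrite mulr_ge0// invr_ge0 ltW.
- move=> t ht; rewrite /b /flat; case: ht => ht.
    by rewrite ifF ?mul0r ?mulr0//; apply/negbTE; rewrite -leNgt.
  by rewrite [X in _ * (_ * X)]ifF ?mul0r ?mulr0//; apply/negbTE; rewrite -leNgt; lra.
- by rewrite ointZ// mulVf// gt_eqF.
Qed.

(** Differentiation under the integral sign: by the exchange of two
    integrations, a primitive of the integral of gx over [c, d] is the
    integral of g, up to a constant. *)
Lemma oint_leibniz (g gx : R * R -> R) (c d : R) : c <= d -> continuous g -> continuous gx ->
  (forall x y : R, is_derive x 1 (fun t => g (t, y)) (gx (x, y))) ->
  forall x : R, is_derive x 1 (fun t => oint c d (fun y => g (t, y))) (oint c d (fun y => gx (x, y))).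
Proof.
move=> cd cg cgx gd x.
pose G t := oint c d (fun y => g (t, y)).
pose Gx t := oint c d (fun y => gx (t, y)).
have cGx : continuous Gx by exact: cont_oint_param.
have E t : x - 1 <= t -> G t = G (x - 1) + oint (x - 1) t Gx.
  move=> xt; rewrite /Gx dint_swap// /G -ointD//; [|cts|].
    congr oint; apply/funext => y.
    rewrite (@ointE _ _ (fun t => g (t, y))); last by move=> u; exact: gd.
    by rewrite addrC subrK.
  apply: (cont_oint_param (g := fun z : R * R => gx (z.2, z.1))); cts.
have h : is_derive x 1 (fun t => G (x - 1) + oint (x - 1) t Gx) (Gx x).
  have ? := oint_prim (x - 1) cGx x.
  by der; rewrite add0r.
apply: near_eq_is_derive h.
near=> t; rewrite -E//; apply/ltW; near: t; apply: lt_nbhsr; lra.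
Unshelve. all: by end_near. Qed.

(** The partial derivatives are carried along explicitly, since they are the
    functions that get integrated. *)
Definition C1 (g gx gy : R * R -> R) := [/\ continuous g, continuous gx, continuous gy,
  (forall x y : R, is_derive x 1 (fun t => g (t, y)) (gx (x, y))) &
  (forall x y : R, is_derive y 1 (fun t => g (x, t)) (gy (x, y)))].

End Smooth.

(** * Mollification of weak derivatives *)

Section Moll.
Context {R : realType}.
Notation mu := (@lebesgue_measure R).
Notation mu2 := (lebesgue_measure \x lebesgue_measure)%E.
Local Notation rT := (measurableTypeR R).
Local Notation rT2 := (rT * rT)%type.

Lemma sigma_finite_lebesgue2 : sigma_finite (setT : set rT2) (product_measure1 mu mu).
Proof.
exists (fun n => rect (- n%:R) n%:R (- n%:R) n%:R).
  apply/esym/seteqP; split => // -[x y] _.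
  have [n hn] : exists n : nat, `|x| <= n%:R /\ `|y| <= n%:R.
    exists (Num.truncn (`|x| + `|y|)).+1.
    have := truncnS_gt (`|x| + `|y|); have := normr_ge0 x; have := normr_ge0 y; lra.
  by exists n => //; split; rewrite /= in_itv/= -ler_norml; case: hn.
move=> n; split; first exact: rect_measurable.
have n0 : - n%:R <= n%:R :> R by have := ler0n R n; lra.
by have := rect_measure n0 n0; rewrite /= => ->; rewrite ltry.
Qed.

(** Lebesgue measure of the plane with its sigma-finite structure, in the form
    required by Tonelli's theorem on the product of two planes. *)
Definition lebesgue2_sf : {sigma_finite_measure set rT2 -> \bar R} :=
  HB.pack (product_measure1 mu mu) (Measure_isSigmaFinite.Build _ _ _ (product_measure1 mu mu) sigma_finite_lebesgue2).

(** The integral of g against k (a - x) l (b - y) over a fixed rectangle. The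
    kernels are free parameters, so the partial derivatives of a mollification
    have the same form. *)
Definition moll (c d c' d' : R) (g : R * R -> R) (k l : R -> R) (z : R * R) : R :=
  oint c' d' (fun b => oint c d (fun a => g (a, b) * k (a - z.1)) * l (b - z.2)).

Lemma moll_cont c d c' d' g k l : continuous g -> continuous k -> continuous l ->
  continuous (moll c d c' d' g k l).
Proof.
move=> cg ck cl; rewrite /moll.
pose G (p : (R * R) * R) := oint c d (fun a => g (a, p.2) * k (a - p.1.1)) * l (p.2 - p.1.2).
have cG : continuous G.
  rewrite /G; apply: contM; last by cts.
  apply: (cont_oint_param (g := fun q : ((R * R) * R) * R => g (q.2, q.1.2) * k (q.2 - q.1.1.1))).
  by cts.
exact: (cont_oint_param (g := G)).
Qed.

Lemma moll_C1 c d c' d' g k k' l l' : c <= d -> c' <= d' -> continuous g ->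
  continuous k' -> continuous l' -> is_prim k' k -> is_prim l' l ->
  C1 (moll c d c' d' g k l) (moll c d c' d' g (fun t => - k' t) l)
     (moll c d c' d' g k (fun t => - l' t)).
Proof.
move=> cd cd' cg ck' cl' pk pl.
have ck : continuous k by exact: is_prim_cont pk.
have cl : continuous l by exact: is_prim_cont pl.
split.
- exact: moll_cont.
- by apply: moll_cont => //; cts.
- by apply: moll_cont => //; cts.
- move=> x y; rewrite /moll/=.
  apply: (oint_leibniz (g := fun p : R * R => oint c d (fun a => g (a, p.2) * k (a - p.1)) * l (p.2 - y))
    (gx := fun p : R * R => oint c d (fun a => g (a, p.2) * - k' (a - p.1)) * l (p.2 - y))) => //.
  + apply: contM; last by cts.
    by apply: (cont_oint_param (g := fun q : (R * R) * R => g (q.2, q.1.2) * k (q.2 - q.1.1))); cts.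
  + apply: contM; last by cts.
    by apply: (cont_oint_param (g := fun q : (R * R) * R => g (q.2, q.1.2) * - k' (q.2 - q.1.1))); cts.
  + move=> {}x b /=.
    have h : is_derive x 1 (fun t => oint c d (fun a => g (a, b) * k (a - t)))
      (oint c d (fun a => g (a, b) * - k' (a - x))).
      apply: (oint_leibniz (g := fun p : R * R => g (p.2, b) * k (p.2 - p.1))
        (gx := fun p : R * R => g (p.2, b) * - k' (p.2 - p.1))) => //; [cts|cts|].
      move=> t a /=.
      have h1 : is_derive t 1 (fun t0 : R => a - t0) (-1) by der; rewrite ?add0r.
      have h2 := der_comp (g := fun t0 : R => a - t0) (pk (a - t)) h1.
      by der; ring.
    by der; ring.
- move=> x y; rewrite /moll/=.
  apply: (oint_leibniz (g := fun p : R * R => oint c d (fun a => g (a, p.2) * k (a - x)) * l (p.2 - p.1))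
    (gx := fun p : R * R => oint c d (fun a => g (a, p.2) * k (a - x)) * - l' (p.2 - p.1))) => //.
  + apply: contM; last by cts.
    by apply: (cont_oint_param (g := fun q : (R * R) * R => g (q.2, q.1.2) * k (q.2 - x))); cts.
  + apply: contM; last by cts.
    by apply: (cont_oint_param (g := fun q : (R * R) * R => g (q.2, q.1.2) * k (q.2 - x))); cts.
  + move=> t b /=.
    have h1 : is_derive t 1 (fun t0 : R => b - t0) (-1) by der; rewrite ?add0r.
    have h2 := der_comp (g := fun t0 : R => b - t0) (pl (b - t)) h1.
    by der; ring.
Qed.

(** The kernel is a test function, so moving the derivative from the kernel to
    u is the definition of the weak derivative. *)
Lemma moll_weak (W : set (R * R)) (u v ge : R * R -> R) (j : 'I_2) c d c' d' (z : R * R) (k k' l l' : R -> R) (h : R) :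
  c <= d -> c' <= d' ->
  rect c d c' d' `<=` W -> continuous ge -> (forall w, rect c d c' d' w -> ge w = u w) ->
  weak_partial W j u v ->
  smooth1 k -> smooth1 l -> is_prim k' k -> is_prim l' l -> continuous k' -> continuous l' ->
  (forall t, t <= 0 \/ h <= t -> k t = 0) -> (forall t, t <= 0 \/ h <= t -> l t = 0) ->
  (forall t, t <= 0 \/ h <= t -> k' t = 0) -> (forall t, t <= 0 \/ h <= t -> l' t = 0) ->
  c <= z.1 -> z.1 + h <= d -> c' <= z.2 -> z.2 + h <= d' ->
  (((if j == 0 then moll c d c' d' ge (fun t => - k' t) l z else moll c d c' d' ge k (fun t => - l' t) z))%:E
    = \int[mu2]_(w in rect c d c' d') (v w * (k (w.1 - z.1) * l (w.2 - z.2)))%:E)%E.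
Proof.
move=> cd cd' BW cge geu wp sk sl pk pl ck' cl' k0 l0 k'0 l'0 cz1 dz1 cz2 dz2.
have ck : continuous k by exact: is_prim_cont pk.
have cl : continuous l by exact: is_prim_cont pl.
set B := rect c d c' d'.
pose phi (w : R * R) := k (w.1 - z.1) * l (w.2 - z.2).
have phi0 w : ~ B w -> phi w = 0.
  move=> nB; rewrite /phi.
  have [h1|h1] := leP (w.1 - z.1) 0; first by rewrite (k0 _ (or_introl h1)) mul0r.
  have [h2|h2] := leP h (w.1 - z.1); first by rewrite (k0 _ (or_intror h2)) mul0r.
  have [h3|h3] := leP (w.2 - z.2) 0; first by rewrite (l0 _ (or_introl h3)) mulr0.
  have [h4|h4] := leP h (w.2 - z.2); first by rewrite (l0 _ (or_intror h4)) mulr0.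
  by exfalso; apply: nB; split; rewrite /= in_itv/=; lra.
have sk' : smooth1 (fun t => k (1 * t + - z.1)) by exact: smooth1_aff.
have sl' : smooth1 (fun t => l (1 * t + - z.2)) by exact: smooth1_aff.
have supB : closure [set w | phi w != 0] `<=` B.
  have cB : closed B by apply: compact_closed; [exact: norm_hausdorff|exact: rect_compact].
  rewrite [X in _ `<=` X]((closure_id B).1 cB); apply: closure_subset => w /= /eqP pw.
  by apply: contrapT => /phi0.
have tf : test_function W phi.
  split.
  - have := smooth_prod1 sk' sl'; congr smooth.
    by apply/funext => w; rewrite !mul1r.
  - apply: subclosed_compact supB; [exact: closed_closure|exact: rect_compact].
  - exact: subset_trans BW.
have := wp _ tf.
pose dphi (w : R * R) := if j == 0 then k' (w.1 - z.1) * l (w.2 - z.2) else k (w.1 - z.1) * l' (w.2 - z.2).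
have dphiE w : 'D_(basis_vec j) phi w = dphi w.
  rewrite /basis_vec /dphi; case: eqP => _.
    have h0 : is_derive w.1 1 (fun x => phi (x, w.2)) (k' (w.1 - z.1) * l (w.2 - z.2)).
      have h1 : is_derive w.1 1 (fun t : R => t - z.1) 1 by der; rewrite addr0.
      have h2 := der_comp (g := fun t : R => t - z.1) (pk (w.1 - z.1)) h1.
      by rewrite /phi /=; der; ring.
    by have h1 := is_derive_plane1 h0; rewrite derive_val.
  have h0 : is_derive w.2 1 (fun y => phi (w.1, y)) (k (w.1 - z.1) * l' (w.2 - z.2)).
    have h1 : is_derive w.2 1 (fun t : R => t - z.2) 1 by der; rewrite addr0.
    have h2 := der_comp (g := fun t : R => t - z.2) (pl (w.2 - z.2)) h1.
    by rewrite /phi /=; der; ring.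
  by have h1 := is_derive_plane2 h0; rewrite derive_val.
have dphi0 w : ~ B w -> dphi w = 0.
  move=> nB; rewrite /dphi.
  have [h1|h1] := leP (w.1 - z.1) 0.
    by rewrite (k0 _ (or_introl h1)) (k'0 _ (or_introl h1)) !mul0r; case: ifP.
  have [h2|h2] := leP h (w.1 - z.1).
    by rewrite (k0 _ (or_intror h2)) (k'0 _ (or_intror h2)) !mul0r; case: ifP.
  have [h3|h3] := leP (w.2 - z.2) 0.
    by rewrite (l0 _ (or_introl h3)) (l'0 _ (or_introl h3)) !mulr0; case: ifP.
  have [h4|h4] := leP h (w.2 - z.2).
    by rewrite (l0 _ (or_intror h4)) (l'0 _ (or_intror h4)) !mulr0; case: ifP.
  by exfalso; apply: nB; split; rewrite /= in_itv/=; lra.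
have -> : (\int[mu2]_(w in W) (u w * 'D_(basis_vec j) phi w)%:E =
           \int[mu2]_(w in B) (ge w * dphi w)%:E)%E.
  rewrite integral_mkcond [RHS]integral_mkcond; apply: eq_integral => w _.
  rewrite !patchE dphiE; have [wB|wB] := pselect (B w).
    rewrite !ifT; last 2 first.
    - by rewrite inE.
    - by rewrite inE; exact: BW.
    by rewrite geu.
  by rewrite [in RHS]ifF ?dphi0 ?mulr0 ?if_same//; apply/negbTE; rewrite notin_setE.
have -> : (\int[mu2]_(w in W) (v w * phi w)%:E =
           \int[mu2]_(w in B) (v w * phi w)%:E)%E.
  rewrite integral_mkcond [RHS]integral_mkcond; apply: eq_integral => w _.
  rewrite !patchE; have [wB|wB] := pselect (B w).
    rewrite !ifT//; by rewrite inE//; exact: BW.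
  by rewrite [in RHS]ifF ?phi0 ?mulr0 ?if_same//; apply/negbTE; rewrite notin_setE.
have cdphi : continuous dphi by rewrite /dphi; case: (j == 0); cts.
rewrite dint_lebesgueC//; last by cts.
move=> /(congr1 (fun x => - x)%E); rewrite oppeK => <-.
rewrite -EFinN; congr EFin.
rewrite -mulN1r -ointZ; last first.
  by apply: (cont_oint_param (g := fun p : R * R => ge (p.2, p.1) * dphi (p.2, p.1))); cts.
rewrite /dphi /moll; case: (j == 0) => /=; congr oint; apply/funext => b.
- rewrite mulrC -!ointZ; [|cts..].
  by congr oint; apply/funext => a; ring.
- rewrite mulrC -!ointZ; [|cts..].
  by congr oint; apply/funext => a; ring.
Qed.

(** With m = lam - c, the tangent inequality (D - c)^2 >= 2 m (D - c) - m^2 is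
    integrated against the probability density k; the right-hand side
    integrates to m^2. *)
Lemma jensen_avg (D k : rT2 -> R) (C c lam : R) :
  mu2.-integrable setT (EFin \o D) ->
  mu2.-integrable setT (fun w => ((D w) ^+ 2)%:E) ->
  measurable_fun setT k -> (forall w, 0 <= k w <= C) ->
  mu2.-integrable setT (EFin \o k) -> (\int[mu2]_w (k w)%:E = 1%:E)%E ->
  (lam%:E = \int[mu2]_w (D w * k w)%:E)%E ->
  (((lam - c) ^+ 2)%:E <= \int[mu2]_w ((D w - c) ^+ 2 * k w)%:E)%E.
Proof.
move=> iD iD2 mk k0 ik k1 lamE.
have bk : [bounded k x | x in (setT : set rT2)].
  exists C; split; first exact: num_real.
  move=> y Cy x _ /=; have /andP[h1 h2] := k0 x; rewrite ger0_norm//; exact: le_trans (ltW Cy).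
have iDk : mu2.-integrable setT (fun w => (D w * k w)%:E).
  have := integrableMr measurableT mk bk iD.
  by apply: eq_integrable => // w _ /=; rewrite -EFinM mulrC.
have iD2k : mu2.-integrable setT (fun w => (D w ^+ 2 * k w)%:E).
  have := integrableMr measurableT mk bk iD2.
  by apply: eq_integrable => // w _ /=; rewrite -EFinM mulrC.
pose m := lam - c.
have E1 : (\int[mu2]_w ((2 * m)%:E * (D w * k w)%:E + (- (2 * m * c + m ^+ 2))%:E * (k w)%:E) = (m ^+ 2)%:E)%E.
  rewrite integralD//; [|exact: integrableZl|exact: integrableZl].
  rewrite !integralZl// k1 -lamE -!EFinM -EFinD; congr EFin; rewrite /m; ring.
rewrite -/m -E1.
apply: le_integral => //.
- by apply: integrableD => //; exact: integrableZl.
- have H : mu2.-integrable setT (fun w => (D w ^+ 2 * k w)%:E + ((- (2 * c))%:E * (D w * k w)%:E + (c ^+ 2)%:E * (k w)%:E))%E.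
    apply: integrableD => //; apply: integrableD => //; exact: integrableZl.
  move: H; apply: eq_integrable => // w _ /=.
  by rewrite -!EFinM -!EFinD; congr EFin; ring.
move=> w _; rewrite -!EFinM -!EFinD lee_fin.
have /andP[h1 h2] := k0 w.
rewrite -subr_ge0 (_ : _ - _ = (D w - c - m) ^+ 2 * k w); last ring.
by rewrite mulr_ge0// sqr_ge0.
Qed.

(** By Jensen the squared error at z is at most the k-average over w of (D (z
    + w) - D z)^2. Tonelli exchanges the integrals, and for each w in the
    support of k the integral over z is small by continuity of
    translations. *)
Lemma moll_L2 (D : rT2 -> R) (N : R) : measurable_fun setT D -> 0 <= N ->
  (forall x y, N < `|x| -> D (x, y) = 0) ->
  (forall x y, N < `|y| -> D (x, y) = 0) ->
  (\int[mu2]_z ((D z) ^+ 2)%:E < +oo)%E ->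
  forall e : R, 0 < e -> exists2 d : R, 0 < d & forall (Q : set rT2) (k lam : rT2 -> R) (C : R),
    measurable Q -> measurable_fun Q lam ->
    measurable_fun setT k -> (forall w, 0 <= k w <= C) ->
    (\int[mu2]_w (k w)%:E = 1%:E)%E ->
    (forall w : R * R, k w != 0 -> `|w.1| < d /\ `|w.2| < d) ->
    (forall z, Q z -> (lam z)%:E = \int[mu2]_w (D w * k (w - z)%R)%:E)%E ->
    (\int[mu2]_(z in Q) ((lam z - D z) ^+ 2)%:E <= e%:E)%E.
Proof.
move=> mD N0 DN1 DN2 D2 e e0.
have [d d0 hd] := L2_shift2 mD DN1 DN2 D2 e0.
exists d => //  Q k lam C mQ mlam mk kC k1 kd lamE.
have iD2 : mu2.-integrable setT (fun w => ((D w) ^+ 2)%:E).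
  apply/integrableP; split; first by apply/measurable_EFinP/measurable_funX.
  by under eq_integral do rewrite gee0_abs ?lee_fin ?sqr_ge0//.
have iB : mu2.-integrable setT (fun w : rT2 => ((\1_(rect (- N) N (- N) N) w) : R)%:E).
  apply/integrableP; split.
    by apply/measurable_EFinP/measurable_indic; exact: rect_measurable.
  under eq_integral do rewrite gee0_abs ?lee_fin//.
  rewrite integral_indic//; last exact: rect_measurable.
  rewrite setIT; have := @rect_measure R (- N) N (- N) N; rewrite /= => ->; [by rewrite ltry|lra|lra].
have iD : mu2.-integrable setT (EFin \o D).
  have := integrableD measurableT iD2 iB.
  apply: le_integrable => //; first exact/measurable_EFinP.
  move=> [x y] _; rewrite /= lee_fin.
  have [xN|xN] := ltP N `|x|; first by rewrite DN1// expr0n/= normr0.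
  have [yN|yN] := ltP N `|y|; first by rewrite DN2// expr0n/= normr0.
  rewrite indicE mem_set; last by split; rewrite /= in_itv/= -ler_norml.
  rewrite [leRHS]ger0_norm; last by rewrite addr_ge0// sqr_ge0.
  rewrite -(real_normK (num_real (D (x, y)))).
  have := normr_ge0 (D (x, y)); have := sqr_ge0 (`|D (x, y)| - 1) => /=; nra.
have k0 w : 0 <= k w by have /andP[] := kC w.
have mks (z : rT2) : measurable_fun setT (fun w : rT2 => k (w - z)%R).
  exact: measurableT_comp mk (measurable_shift2 (- z)).
have iks (z : rT2) : (\int[mu2]_w (k (w - z)%R)%:E = 1%:E)%E.
  rewrite -k1 -[RHS](ge0_integral_shift2 (- z) (f := fun w => (k w)%:E))//.
  exact/measurable_EFinP.
have step1 z : Q z -> (((lam z - D z) ^+ 2)%:E <= \int[mu2]_w ((D (z + w)%R - D z) ^+ 2 * k w)%:E)%E.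
  move=> Qz.
  have H := @jensen_avg D (fun w => k (w - z)%R) C (D z) (lam z) iD iD2 (mks z) (fun w => kC (w - z)) _ (iks z) (lamE z Qz).
  have {}H := H _.
  apply: (le_trans (H _)).
    apply/integrableP; split; first exact/measurable_EFinP.
    by under eq_integral do rewrite /= ger0_norm//; rewrite iks ltry.
  rewrite -(ge0_integral_shift2 z (f := fun w => ((D w - D z) ^+ 2 * k (w - z)%R)%:E)).
  - rewrite le_eqVlt; apply/orP; left; apply/eqP; apply: eq_integral => w _.
    have e1 (p q : R * R) : p + q = q + p by exact: addrC.
    have e2 (p q : R * R) : p + q - q = p by exact: addrK.
    have e3 : k (w + z - z) = k w := congr1 k (e2 w z).
    have e4 : D (w + z) = D (z + w) := congr1 D (e1 w z).
    by rewrite e3 e4.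
  - apply/measurable_EFinP/measurable_funM => //; apply/measurable_funX/measurable_funB => //.
  - by move=> w; rewrite lee_fin mulr_ge0// sqr_ge0.
pose F (p : rT2 * rT2) := ((D (p.1 + p.2)%R - D p.1) ^+ 2 * k p.2)%:E.
have F0 p : (0 <= F p)%E by rewrite lee_fin mulr_ge0// sqr_ge0.
have madd : measurable_fun setT (fun p : rT2 * rT2 => (p.1.1 + p.2.1, p.1.2 + p.2.2) : rT2).
  apply: measurable_fun_pair; apply: measurable_funD => //.
  - by apply: measurableT_comp (measurable_fst) _; exact: measurable_fst.
  - by apply: measurableT_comp (measurable_fst) _; exact: measurable_snd.
  - by apply: measurableT_comp (measurable_snd) _; exact: measurable_fst.
  - by apply: measurableT_comp (measurable_snd) _; exact: measurable_snd.
have mF : measurable_fun setT F.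
  apply/measurable_EFinP/measurable_funM.
    apply/measurable_funX/measurable_funB.
      exact: measurableT_comp mD madd.
    by apply: measurableT_comp mD _; exact: measurable_fst.
  by apply: measurableT_comp mk _; exact: measurable_snd.
pose M := lebesgue2_sf.
have mFF := measurable_fun_fubini_tonelli_F (m2 := M) F mF F0.
have mFG := measurable_fun_fubini_tonelli_G (m1 := M) F mF F0.
have tn : (\int[mu2]_z (fubini_F M F z) = \int[mu2]_w (fubini_G M F w))%E :=
  etrans (esym (fubini_tonelli1 (m1 := M) (m2 := M) F mF F0)) (fubini_tonelli2 (m1 := M) (m2 := M) F mF F0).
apply: (@le_trans _ _ (\int[mu2]_z (fubini_F M F z))%E).
  rewrite integral_mkcond; apply: ge0_le_integral => //.
  - by move=> z _; rewrite patchE; case: ifP => // _; rewrite lee_fin sqr_ge0.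
  - apply/(measurable_restrictT _ mQ)/measurable_EFinP/measurable_funX/measurable_funB => //.
    exact: measurable_funS mD.
  - move=> z _; rewrite patchE; case: ifPn => [|_]; first by rewrite inE => /step1.
    exact: integral_ge0.
rewrite tn.
apply: (@le_trans _ _ (\int[mu2]_w (e%:E * (k w)%:E))%E).
  apply: ge0_le_integral => //.
  - by move=> w _; exact: integral_ge0.
  - by apply: measurable_funeM; exact/measurable_EFinP.
  move=> w _; rewrite /fubini_G.
  have [kw0|kw0] := eqVneq (k w) 0.
    rewrite kw0 mule0 integral0_eq// => z _; by rewrite /F /= kw0 mulr0.
  have [w1 w2] := kd w kw0.
  under eq_integral do rewrite /F /= mulrC EFinM.
  rewrite ge0_integralZl//; last 3 first.
  - apply/measurable_EFinP/measurable_funX/measurable_funB => //.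
    exact: measurableT_comp mD (measurable_shift2 w).
  - by move=> z _; rewrite lee_fin sqr_ge0.
  - by rewrite lee_fin.
  rewrite [leRHS]muleC; apply: lee_wpmul2l; first by rewrite lee_fin.
  exact: hd.
rewrite ge0_integralZl//.
- by rewrite k1 mule1.
- exact/measurable_EFinP.
- by move=> w _; rewrite lee_fin.
- by rewrite lee_fin ltW.
Qed.

End Moll.

(** * The distortion inequality for the Hilbert-Schmidt norm *)

Section Linear.
Context {R : realType}.

(** The operator norm is a supremum, so the set of values must be bounded; the
    sum of the absolute values of the entries bounds it. *)
Lemma eucl_norm_le_op (A : 'M[R]_2) (v : 'cV[R]_2) : eucl_norm v <= 1 -> eucl_norm (A *m v) <= op_norm A.
Proof.
move=> v1; apply: ub_le_sup; last by exists v.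
pose S := \sum_i \sum_j `|A i j|.
exists (Num.sqrt (\sum_(i < 2) S ^+ 2)) => _ [w /= w1 <-].
apply: ler_wsqrtr; apply: ler_sum => i _.
have hw j : `|w j 0| <= 1.
  apply: le_trans w1; rewrite -sqrtr_sqr; apply: ler_wsqrtr.
  by rewrite (bigD1 j)//= lerDl sumr_ge0// => k _; exact: sqr_ge0.
rewrite -[leLHS]real_normK ?num_real//.
rewrite ler_pXn2r// ?nnegrE ?sumr_ge0//; last by move=> *; exact: sumr_ge0.
rewrite mxE; apply: le_trans (ler_norm_sum _ _ _) _.
apply: (@le_trans _ _ (\sum_j `|A i j|)).
  by apply: ler_sum => j _; rewrite normrM ler_piMr.
rewrite /S [leRHS](bigD1 i)//= lerDl; apply: sumr_ge0 => *; exact: sumr_ge0.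
Qed.

Lemma det2E (A : 'M[R]_2) : \det A = A 0 0 * A 1 1 - A 0 1 * A 1 0.
Proof.
rewrite (expand_det_row _ ord0) big_ord_recl big_ord1 /cofactor !det_mx11 !mxE/=.
rewrite expr0 mul1r expr1 mulN1r mulrN.
by congr (_ * A _ _ - A _ _ * A _ _); apply: val_inj.
Qed.

(** In terms of the singular values s1 >= s2, the hypothesis says that s1 <= K
    s2, and then s1/s2 + s2/s1 <= K + 1/K. Without singular values: K det A -
    A^T A is positive semidefinite, and the non-negativity of its determinant
    is the conclusion multiplied by K det A. *)
Lemma op_norm_HS (K : R) (A : 'M[R]_2) : 1 <= K -> op_norm A ^+ 2 <= K * \det A ->
  A 0 0 ^+ 2 + A 0 1 ^+ 2 + A 1 0 ^+ 2 + A 1 1 ^+ 2 <= (K + K^-1) * (A 0 0 * A 1 1 - A 0 1 * A 1 0).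
Proof.
move=> K1 h.
set a := A 0 0; set b := A 0 1; set c := A 1 0; set d := A 1 1.
have h1 (x y : R) : x ^+ 2 + y ^+ 2 = 1 -> (a * x + b * y) ^+ 2 + (c * x + d * y) ^+ 2 <= K * (a * d - b * c).
  move=> xy.
  pose v : 'cV[R]_2 := \col_i (if i == 0 then x else y).
  have nv : eucl_norm v <= 1.
    by rewrite /eucl_norm big_ord_recl big_ord1 !mxE/= xy sqrtr1.
  have := eucl_norm_le_op A nv.
  have -> : eucl_norm (A *m v) = Num.sqrt ((a * x + b * y) ^+ 2 + (c * x + d * y) ^+ 2).
    rewrite /eucl_norm big_ord_recl big_ord1 !mxE !big_ord_recl !big_ord0 !mxE/= !addr0.
    by rewrite /a /b /c /d; do ?[congr Num.sqrt; congr (_ ^+ 2 + _ ^+ 2)]; congr (A _ _ * _ + A _ _ * _); apply: val_inj.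
  move=> h2; rewrite -det2E in h *.
  apply: le_trans h.
  rewrite -[leLHS]sqr_sqrtr; last by rewrite addr_ge0// sqr_ge0.
  by rewrite ler_pXn2r// ?nnegrE ?sqrtr_ge0//; apply: le_trans h2; exact: sqrtr_ge0.
have h2 (x y : R) : (a * x + b * y) ^+ 2 + (c * x + d * y) ^+ 2 <= K * (a * d - b * c) * (x ^+ 2 + y ^+ 2).
  have [xy0|xy0] := eqVneq (x ^+ 2 + y ^+ 2) 0.
    have /andP[/eqP x0 /eqP y0] : (x == 0) && (y == 0).
      by move/eqP : xy0; rewrite paddr_eq0 ?sqr_ge0// !sqrf_eq0.
    by rewrite x0 y0 !mulr0 !addr0 !expr0n/= !addr0 mulr0.
  have s0 : 0 < x ^+ 2 + y ^+ 2 by rewrite lt_def xy0 addr_ge0// sqr_ge0.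
  pose s := Num.sqrt (x ^+ 2 + y ^+ 2).
  have s2 : s ^+ 2 = x ^+ 2 + y ^+ 2 by rewrite sqr_sqrtr// ltW.
  have sn0 : s != 0 by rewrite gt_eqF// sqrtr_gt0.
  have e1 : (x / s) ^+ 2 + (y / s) ^+ 2 = 1.
    by rewrite !expr_div_n -mulrDl -s2 divff// expf_neq0.
  have := h1 _ _ e1; rewrite -(ler_pM2r s0) -{2}s2; congr (_ <= _).
    by rewrite -s2; field.
  by rewrite s2.
have dK2 : a ^+ 2 + c ^+ 2 <= K * (a * d - b * c) by have := h2 1 0; lra.
have dK3 : b ^+ 2 + d ^+ 2 <= K * (a * d - b * c) by have := h2 0 1; lra.
set S := a ^+ 2 + b ^+ 2 + c ^+ 2 + d ^+ 2.
set D := a * d - b * c in dK2 dK3 h2 *.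
have D0 : 0 <= D.
  have : 0 <= K * D by apply: le_trans dK2; rewrite addr_ge0// sqr_ge0.
  by rewrite pmulr_rge0//; lra.
(* p, q, r are the entries of the positive semidefinite matrix K D - A^T A *)
pose p := K * D - (a ^+ 2 + c ^+ 2). pose r := K * D - (b ^+ 2 + d ^+ 2). pose q := - (a * b + c * d).
have p0 : 0 <= p by rewrite subr_ge0.
have r0 : 0 <= r by rewrite subr_ge0.
have psd x y : 0 <= p * x ^+ 2 + 2 * q * x * y + r * y ^+ 2.
  have := h2 x y; rewrite /p /q /r; lra.
have dpos : q ^+ 2 <= p * r.
  have [p00|pn0] := eqVneq p 0.
    have [q0|q0] := eqVneq q 0; first by rewrite p00 q0 expr0n/= mul0r.
    have := psd (- (r + 1) / (2 * q)) 1; rewrite p00 mul0r add0r expr1n !mulr1.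
    rewrite (_ : 2 * q * (- (r + 1) / (2 * q)) = - (r + 1)); last by rewrite mulrC divfK// mulf_neq0// pnatr_eq0.
    lra.
  have pp : 0 < p by rewrite lt_def pn0.
  have := psd (- q) p; rewrite (_ : _ + _ = p * (p * r - q ^+ 2)); last ring.
  by rewrite pmulr_rge0// subr_ge0.
have fin : K * D * S <= K ^+ 2 * D ^+ 2 + D ^+ 2.
  move: dpos; rewrite -subr_ge0 (_ : _ - _ = K ^+ 2 * D ^+ 2 + D ^+ 2 - K * D * S); last by rewrite /p /q /r /S /D; ring.
  lra.
have [D00|Dn0] := eqVneq D 0.
  move: dK2 dK3; rewrite D00 !mulr0 /S.
  lra.
have Dp : 0 < D by rewrite lt_def Dn0.
have Kp : 0 < K by lra.
have KD : 0 < K * D by rewrite mulr_gt0.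
rewrite -(ler_pM2l KD); apply: le_trans fin _.
rewrite le_eqVlt; apply/orP; left; apply/eqP; field; lra.
Qed.

(** A matrix satisfies the Hilbert-Schmidt form of quasiconformality when this
    is non-positive; the positive part measures the failure. *)
Definition distort (K a b c d : R) := a ^+ 2 + b ^+ 2 + c ^+ 2 + d ^+ 2 - K * (a * d - b * c).

(** Young's inequality 2 s t <= l s^2 + t^2 / l for the cross terms. *)
Lemma distort_perturb (K a b c d a' b' c' d' l : R) : 0 <= K -> 0 < l -> distort K a b c d <= 0 ->
  Num.max 0 (distort K a' b' c' d') <=
  (1 + K) * (l * (a ^+ 2 + b ^+ 2 + c ^+ 2 + d ^+ 2) +
    (1 + l^-1) * ((a' - a) ^+ 2 + (b' - b) ^+ 2 + (c' - c) ^+ 2 + (d' - d) ^+ 2)).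
Proof.
move=> K0 l0 h.
set x := a' - a; set y := b' - b; set z := c' - c; set w := d' - d.
have -> : a' = a + x by rewrite /x; ring.
have -> : b' = b + y by rewrite /y; ring.
have -> : c' = c + z by rewrite /z; ring.
have -> : d' = d + w by rewrite /w; ring.
have li : 0 < l^-1 by rewrite invr_gt0.
have P (s t : R) : 2 * s * t <= l * s ^+ 2 + l^-1 * t ^+ 2.
  rewrite -subr_ge0 (_ : _ - _ = l * (s - l^-1 * t) ^+ 2); last by field; lra.
  by rewrite mulr_ge0 ?sqr_ge0// ltW.
have P1 := P a x; have P2 := P b y; have P3 := P c z; have P4 := P d w.
have N (s t : R) : - (2 * s * t) <= l * s ^+ 2 + l^-1 * t ^+ 2.
  have := P s (- t); rewrite sqrrN; lra.
have Q : - (a * w + x * d + x * w - b * z - y * c - y * z) <=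
   l * (a ^+ 2 + b ^+ 2 + c ^+ 2 + d ^+ 2) + (1 + l^-1) * (x ^+ 2 + y ^+ 2 + z ^+ 2 + w ^+ 2).
  have := N a w; have := N d x; have := P b z; have := P c y.
  have := sqr_ge0 (x + w); have := sqr_ge0 (y - z).
  have := sqr_ge0 a; have := sqr_ge0 b; have := sqr_ge0 c; have := sqr_ge0 d.
  have := sqr_ge0 x; have := sqr_ge0 y; have := sqr_ge0 z; have := sqr_ge0 w.
  nra.
rewrite ge_max; apply/andP; split.
  by rewrite mulr_ge0 ?addr_ge0// ?mulr_ge0 ?addr_ge0// ?sqr_ge0// ltW.
have Q' := ler_wpM2l K0 Q.
move: h; rewrite /distort => h.
nra.
Qed.

End Linear.

(** * Approximation by C1 maps of almost non-positive distortion *)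

Section Cart.
Context {R : realType}.
Notation mu := (@lebesgue_measure R).
Notation mu2 := (lebesgue_measure \x lebesgue_measure)%E.
Local Notation rT := (measurableTypeR R).
Local Notation rT2 := (rT * rT)%type.

Lemma oint_eq0 (f : R -> R) a b : continuous f -> a <= b ->
  (forall t, a <= t <= b -> f t = 0) -> oint a b f = 0.
Proof.
move=> cf ab f0.
have c0 : continuous (fun _ : R => 0 : R) by cts.
have z : oint a b (fun _ => 0) = 0 by rewrite oint_cst mul0r.
apply/eqP; rewrite eq_le -{1}z -{2}z.
by apply/andP; split; apply: le_oint => // t /f0 ->.
Qed.

(** A probability density on [0, h] together with its derivative. *)
Definition bump (h : R) (k k' : R -> R) := [/\ smooth1 k, is_prim k' k, continuous k',
  (forall t, 0 <= k t) & [/\ (forall t, t <= 0 \/ h <= t -> k t = 0),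
  (forall t, t <= 0 \/ h <= t -> k' t = 0) & oint 0 h k = 1]].

Lemma bump_exists (h : R) : 0 < h -> exists k k', bump h k k'.
Proof.
move=> h0; have [k0 [sk0 k0_ge0 k0_out k0_int]] := @kernel_exists R.
have hV : 0 < h^-1 by rewrite invr_gt0.
pose k t := h^-1 * k0 (h^-1 * t + 0).
have sk : smooth1 k by apply: (smooth1_mul (smooth1_cst _)); exact: smooth1_aff.
have [k' sk' pk] := smooth1_derive sk.
have kge0 t : 0 <= k t by rewrite mulr_ge0// ltW.
have kout t : t <= 0 \/ h <= t -> k t = 0.
  move=> ht; rewrite /k addr0 k0_out ?mulr0//; case: ht => ht; [left|right].
    by rewrite pmulr_rle0.
  by rewrite -(mulVf (lt0r_neq0 h0)) ler_pM2l.
exists k, k'; split => //; [exact: smooth1_cont sk'|split=> //].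
- move=> t /kout kt.
  (* outside ]0, h[ the kernel attains its minimum 0, so its derivative
     vanishes *)
  have := @derive1_at_min R k (t - 1) (t + 1) t.
  case.
  + lra.
  + by move=> u _; have [] := pk u.
  + by rewrite in_itv/=; lra.
  + by move=> u _; rewrite kt.
  by move=> _ <-; have [_ ->] := pk t.
- have [P hP] := prim_exists (smooth1_cont sk0).
  rewrite (ointE _ _ hP) in k0_int.
  rewrite (@ointE _ _ (fun t => P (h^-1 * t + 0))).
    by rewrite mulVf ?gt_eqF// mulr0 !addr0.
  move=> t.
  have h1 : is_derive t 1 (fun t : R => h^-1 * t + 0) h^-1.
    by apply: der_eq (derD (derM (der_cst _ _) (der_id _)) (der_cst _ _)) _; ring.
  by have h2 := der_comp (g := fun t : R => h^-1 * t + 0) (hP _) h1; apply: der_eq h2 _; rewrite /k mulrC.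
Qed.

Lemma bump_int h k k' c d x : 0 < h -> bump h k k' -> c <= x -> x + h <= d ->
  oint c d (fun a => k (a - x)) = 1.
Proof.
move=> h0 [sk pk ck' k0 [ko k'o ki]] cx xd.
have ck := smooth1_cont sk.
have [P hP] := prim_exists ck.
rewrite (@ointE _ _ (fun t => P (t - x))); last first.
  move=> t.
  have h1 : is_derive t 1 (fun t : R => t - x) 1 by der; ring.
  by have h2 := der_comp (g := fun t : R => t - x) (hP _) h1; apply: der_eq h2 _; rewrite mulr1.
rewrite -(ointE _ _ hP) -(oint_cat _ 0)// -(oint_cat 0 h)// ki.
rewrite !oint_eq0//; first (by rewrite add0r addr0); try lra.
- by move=> t /andP[t1 _]; apply: ko; right.
- by move=> t /andP[_ t1]; apply: ko; left.
Qed.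

(** The kernel has total mass 1 and only sees points at which g is e-close to
    its value at z. *)
Lemma moll_close c d c' d' g h k k' (z : R * R) (e : R) : continuous g -> 0 < h -> bump h k k' ->
  c <= z.1 -> z.1 + h <= d -> c' <= z.2 -> z.2 + h <= d' ->
  (forall a b, z.1 <= a <= z.1 + h -> z.2 <= b <= z.2 + h -> `|g (a, b) - g z| <= e) ->
  `|moll c d c' d' g k k z - g z| <= e.
Proof.
move=> cg h0 bk cz zd cz' zd' hg.
have [sk pk ck' k0 [ko k'o ki]] := bk.
have ck := smooth1_cont sk.
have i1 := bump_int h0 bk cz zd; have i2 := bump_int h0 bk cz' zd'.
have cI : continuous (fun b : R => oint c d (fun a => g (a, b) * k (a - z.1))).
  by apply: (cont_oint_param (g := fun p : R * R => g (p.2, p.1) * k (p.2 - z.1))); cts.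
have out t x : ~ (x <= t <= x + h) -> k (t - x) = 0.
  move=> /negP; rewrite negb_and -!ltNge => /orP[] ht; apply: ko; [left|right]; lra.
(* the cases s = 1 and s = -1 are the upper and the lower bound *)
have inner (s : R) : s ^+ 2 = 1 -> forall b, z.2 <= b <= z.2 + h ->
    s * oint c d (fun a => g (a, b) * k (a - z.1)) <= s * g z + e.
  move=> s2 b bz; rewrite -ointZ; last by cts.
  rewrite -[leRHS]mulr1 -i1 -ointZ; last by cts.
  apply: le_oint; [cts|cts|lra|] => a _ /=.
  have [az|az] := pselect (z.1 <= a <= z.1 + h); last by rewrite out// !mulr0.
  rewrite mulrA; apply: ler_wpM2r => //.
  have := hg a b az bz; rewrite ler_norml => /andP[].
  have : (s - 1) * (s + 1) = 0 by rewrite -subr_sqr s2 expr1n subrr.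
  by move/eqP; rewrite mulf_eq0 => /orP[]/eqP; nra.
have outer (s : R) : s ^+ 2 = 1 -> s * moll c d c' d' g k k z <= s * g z + e.
  move=> s2; rewrite /moll -ointZ; last by cts.
  rewrite -[leRHS]mulr1 -i2 -ointZ; last by cts.
  apply: le_oint; [cts|cts|lra|] => b _ /=.
  have [bz|bz] := pselect (z.2 <= b <= z.2 + h); last by rewrite out// !mulr0.
  by rewrite mulrA; apply: ler_wpM2r => //; exact: inner.
have m1 : (-1) ^+ 2 = 1 :> R by ring.
have := outer 1 (expr1n _ _); have := outer (-1) m1.
rewrite ler_norml; lra.
Qed.

Lemma bump2_int (h : R) k k' : 0 < h -> bump h k k' ->
  (\int[mu2]_w (k w.1 * k w.2)%:E = 1%:E)%E.
Proof.
move=> h0 [sk pk ck' k0 [ko k'o ki]].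
have ck := smooth1_cont sk.
have -> : (\int[mu2]_w (k w.1 * k w.2)%:E = \int[mu2]_(w in rect 0 h 0 h) (k w.1 * k w.2)%:E)%E.
  rewrite [RHS]integral_mkcond; apply: eq_integral => w _; rewrite patchE.
  case: ifPn => //; rewrite notin_setE => hw.
  have [h1|h1] := leP w.1 0; first by rewrite (ko w.1) ?mul0r//; left.
  have [h2|h2] := leP h w.1; first by rewrite (ko w.1) ?mul0r//; right.
  have [h3|h3] := leP w.2 0; first by rewrite (ko w.2) ?mulr0//; left.
  have [h4|h4] := leP h w.2; first by rewrite (ko w.2) ?mulr0//; right.
  by exfalso; apply: hw; split; rewrite /= in_itv/=; lra.
rewrite dint_lebesgue; [|cts|exact: ltW|exact: ltW].
congr EFin => /=.
under eq_fun do rewrite ointZ// ki mulr1.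
exact: ki.
Qed.

(** The weak derivative v, extended by 0 outside B, is square integrable on
    the plane. On Q a kernel of size h < rho only sees points of B, so the
    derivative of the mollification is the mollification of v there. *)
Lemma component_approx (W : set (R * R)) (u v ge : R * R -> R) (j : 'I_2) (z0 : R * R) (rho : R) :
  0 < rho ->
  let B := rect (z0.1 - 2 * rho) (z0.1 + 2 * rho) (z0.2 - 2 * rho) (z0.2 + 2 * rho) in
  let Q := rect (z0.1 - rho) (z0.1 + rho) (z0.2 - rho) (z0.2 + rho) in
  B `<=` W -> continuous ge -> (forall w, B w -> ge w = u w) -> weak_partial W j u v ->
  measurable_fun B v -> (\int[mu2]_(z in B) ((v z) ^+ 2)%:E < +oo)%E ->
  forall e : R, 0 < e -> exists2 d : R, 0 < d & forall h k k', 0 < h < d -> bump h k k' ->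
    forall lam : R * R -> R, lam = (if j == 0
      then moll (z0.1 - 2 * rho) (z0.1 + 2 * rho) (z0.2 - 2 * rho) (z0.2 + 2 * rho) ge (fun t => - k' t) k
      else moll (z0.1 - 2 * rho) (z0.1 + 2 * rho) (z0.2 - 2 * rho) (z0.2 + 2 * rho) ge k (fun t => - k' t)) ->
    (\int[mu2]_(z in Q) ((lam z - v z) ^+ 2)%:E <= e%:E)%E.
Proof.
move=> rho0 B Q BW cge geu wp mv v2 e e0.
have mB : measurable (B : set rT2) by exact: rect_measurable.
have mQ : measurable (Q : set rT2) by exact: rect_measurable.
pose D : rT2 -> R := v \_ B.
have mD : measurable_fun setT D by apply/(measurable_restrictT _ mB).
pose N := `|z0.1| + `|z0.2| + 2 * rho.
have N0 : 0 <= N by rewrite /N; have := normr_ge0 z0.1; have := normr_ge0 z0.2; lra.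
have DN1 x y : N < `|x| -> D (x, y) = 0.
  move=> Nx; rewrite /D patchE ifF//; apply/negbTE; rewrite notin_setE => -[/=].
  rewrite in_itv/= => /andP[h1 h2] _; move: Nx; rewrite ltNge => /negP; apply.
  rewrite /N; have := ler_norm z0.1; have := ler_norm (- z0.1); rewrite normrN.
  have := normr_ge0 z0.2; rewrite ler_norml; lra.
have DN2 x y : N < `|y| -> D (x, y) = 0.
  move=> Nx; rewrite /D patchE ifF//; apply/negbTE; rewrite notin_setE => -[/= _].
  rewrite in_itv/= => /andP[h1 h2]; move: Nx; rewrite ltNge => /negP; apply.
  rewrite /N; have := ler_norm z0.2; have := ler_norm (- z0.2); rewrite normrN.
  have := normr_ge0 z0.1; rewrite ler_norml; lra.
have D2 : (\int[mu2]_z ((D z) ^+ 2)%:E < +oo)%E.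
  apply: le_lt_trans v2; rewrite [leRHS]integral_mkcond.
  rewrite le_eqVlt; apply/orP; left; apply/eqP; apply: eq_integral => z _.
  by rewrite /D !patchE; case: ifP => //; rewrite expr0n.
have [d d0 hd] := moll_L2 mD N0 DN1 DN2 D2 e0.
exists (Num.min d rho); first by rewrite lt_min d0.
move=> h k k' /andP[h0 hm] bk lam lamE.
have /andP[hd' hrho] : (h < d) && (h < rho) by rewrite -lt_min.
have [sk pk ck' k0 [ko k'o ki]] := bk.
have ck := smooth1_cont sk.
have clam : continuous lam by rewrite lamE; case: (j == 0); apply: moll_cont => //; cts.
have [C hC] : exists C, forall t, k t <= C.
  have [c _ hc] := EVT_max (ltW h0) (continuous_subspaceT ck).
  exists (k c) => t; have [h1|h1] := ltP t 0; first by rewrite (ko t)//; left; exact: ltW.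
  have [h2|h2] := leP t h; first by apply: hc; rewrite in_itv/= h1.
  by rewrite (ko t)//; right; exact: ltW.
have C0 : 0 <= C by exact: le_trans (k0 0) (hC 0).
have ckk : continuous (fun w : R * R => k w.1 * k w.2) by cts.
have := hd Q (fun w : rT2 => k w.1 * k w.2) lam (C * C) mQ _ _ _ _ _ _.
move=> H.
rewrite (_ : (\int[mu2]_(z in Q) ((lam z - v z) ^+ 2)%:E = \int[mu2]_(z in Q) ((lam z - D z) ^+ 2)%:E)%E); last first.
  apply: eq_integral => -[x y]; rewrite inE => -[/=]; rewrite !in_itv/= => h1 h2.
  rewrite /D patchE ifT// inE; clear -rho0 h1 h2; split; rewrite /= in_itv/=; lra.
apply: H.
- exact: measurable_funS (plane_cont_measurable clam).
- exact: plane_cont_measurable ckk.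
- by move=> w; rewrite mulr_ge0//= ler_pM.
- exact: bump2_int bk.
- move=> w kw0.
  have bd t : k t != 0 -> `|t| < d.
    move=> kt; have [h1|h1] := leP t 0; first by rewrite (ko t (or_introl h1)) eqxx in kt.
    have [h2|h2] := leP h t; first by rewrite (ko t (or_intror h2)) eqxx in kt.
    by rewrite ger0_norm; [exact: lt_trans hd'|exact: ltW].
  by split; apply: bd; apply: contra kw0 => /eqP ->; rewrite ?mul0r ?mulr0.
- move=> [x y] [/=]; rewrite !in_itv/= => h1 h2.
  have := moll_weak (z := (x, y)) (h := h) (k := k) (k' := k') (l := k) (l' := k') _ _ BW cge geu wp sk sk pk pk ck' ck' ko ko k'o k'o.
  move=> /= E.
  have -> : (lam (x, y))%:E = (\int[mu2]_(w in B) (v w * (k (w.1 - x) * k (w.2 - y)))%:E)%E.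
    by rewrite -E; [rewrite lamE; case: (j == 0)|clear -rho0 h0 hrho h1 h2; lra..].
  rewrite integral_mkcond; apply: eq_integral => w _.
  by rewrite /D !patchE; case: ifP => //; rewrite mul0r.
Qed.

(** The pointwise inequality for perturbed matrices, integrated over Q. *)
Lemma distort_int_le (K l e' : R) (Q : set rT2) (a b c d px py qx qy : rT2 -> R) (Ta Tb Tc Td : R) :
  measurable Q -> 0 <= K -> 0 < l ->
  measurable_fun Q a -> measurable_fun Q b -> measurable_fun Q c -> measurable_fun Q d ->
  measurable_fun Q px -> measurable_fun Q py -> measurable_fun Q qx -> measurable_fun Q qy ->
  (\int[mu2]_(z in Q) ((a z) ^+ 2)%:E <= Ta%:E)%E -> (\int[mu2]_(z in Q) ((b z) ^+ 2)%:E <= Tb%:E)%E ->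
  (\int[mu2]_(z in Q) ((c z) ^+ 2)%:E <= Tc%:E)%E -> (\int[mu2]_(z in Q) ((d z) ^+ 2)%:E <= Td%:E)%E ->
  (\int[mu2]_(z in Q) ((px z - a z) ^+ 2)%:E <= e'%:E)%E -> (\int[mu2]_(z in Q) ((py z - b z) ^+ 2)%:E <= e'%:E)%E ->
  (\int[mu2]_(z in Q) ((qx z - c z) ^+ 2)%:E <= e'%:E)%E -> (\int[mu2]_(z in Q) ((qy z - d z) ^+ 2)%:E <= e'%:E)%E ->
  {ae mu2, forall z, Q z -> distort K (a z) (b z) (c z) (d z) <= 0} ->
  measurable_fun Q (fun z => Num.max 0 (distort K (px z) (py z) (qx z) (qy z))) ->
  (\int[mu2]_(z in Q) (Num.max 0 (distort K (px z) (py z) (qx z) (qy z)))%:E <=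
    ((1 + K) * (l * (Ta + Tb + Tc + Td) + (1 + l^-1) * (e' + e' + e' + e')))%:E)%E.
Proof.
move=> mQ K0 l0 ma mb mc md mpx mpy mqx mqy hTa hTb hTc hTd Ia Ib Ic Id hae mdist.
have K1 : 0 <= 1 + K by rewrite addr_ge0.
have l10 : 0 < 1 + l^-1 by rewrite addr_gt0// invr_gt0.
pose sq (g : rT2 -> R) z := ((g z) ^+ 2)%:E.
have sq_ge (g : rT2 -> R) z : (0 <= sq g z)%E by rewrite lee_fin sqr_ge0.
have sq_meas (g : rT2 -> R) : measurable_fun Q g -> measurable_fun Q (sq g).
  by move=> mg; apply/measurable_EFinP/measurable_funX.
have mdiff (g g' : rT2 -> R) : measurable_fun Q g -> measurable_fun Q g' ->
   measurable_fun Q (fun z => g z - g' z) by move=> m1 m2; exact: measurable_funB.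
pose sum4 (g1 g2 g3 g4 : rT2 -> R) z := (sq g1 z + (sq g2 z + (sq g3 z + sq g4 z)))%E.
have sum4_ge g1 g2 g3 g4 z : (0 <= sum4 g1 g2 g3 g4 z)%E.
  by rewrite /sum4 !adde_ge0//; exact: sq_ge.
have sum4_meas g1 g2 g3 g4 : measurable_fun Q g1 -> measurable_fun Q g2 -> measurable_fun Q g3 -> measurable_fun Q g4 ->
   measurable_fun Q (sum4 g1 g2 g3 g4).
  move=> m1 m2 m3 m4.
  by do 3 (apply: emeasurable_funD; first exact: sq_meas); exact: sq_meas.
have int4 (g1 g2 g3 g4 : rT2 -> R) (t1 t2 t3 t4 : R) :
   measurable_fun Q g1 -> measurable_fun Q g2 -> measurable_fun Q g3 -> measurable_fun Q g4 ->
   (\int[mu2]_(z in Q) sq g1 z <= t1%:E -> \int[mu2]_(z in Q) sq g2 z <= t2%:E ->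
   \int[mu2]_(z in Q) sq g3 z <= t3%:E -> \int[mu2]_(z in Q) sq g4 z <= t4%:E ->
   \int[mu2]_(z in Q) sum4 g1 g2 g3 g4 z <= (t1 + t2 + t3 + t4)%:E)%E.
  move=> m1 m2 m3 m4 i1 i2 i3 i4.
  have s1 := sq_meas _ m1; have s2 := sq_meas _ m2; have s3 := sq_meas _ m3; have s4 := sq_meas _ m4.
  have s34 : measurable_fun Q (fun z => sq g3 z + sq g4 z)%E by exact: emeasurable_funD.
  have s234 : measurable_fun Q (fun z => sq g2 z + (sq g3 z + sq g4 z))%E by exact: emeasurable_funD.
  have p34 z : Q z -> (0 <= sq g3 z + sq g4 z)%E by move=> _; rewrite adde_ge0//; exact: sq_ge.
  have p234 z : Q z -> (0 <= sq g2 z + (sq g3 z + sq g4 z))%E by move=> _; rewrite !adde_ge0//; exact: sq_ge.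
  have p1 g z : Q z -> (0 <= sq g z)%E by move=> _; exact: sq_ge.
  rewrite (ge0_integralD mu2 mQ (p1 g1) s1 p234 s234) (ge0_integralD mu2 mQ (p1 g2) s2 p34 s34).
  rewrite (ge0_integralD mu2 mQ (p1 g3) s3 (p1 g4) s4).
  rewrite (_ : (t1 + t2 + t3 + t4)%:E = t1%:E + (t2%:E + (t3%:E + t4%:E)))%E; last by rewrite -!EFinD !addrA.
  by apply: leeD => //; apply: leeD => //; apply: leeD.
pose E1 z := px z - a z; pose E2 z := py z - b z; pose E3 z := qx z - c z; pose E4 z := qy z - d z.
have J1 := int4 _ _ _ _ _ _ _ _ ma mb mc md hTa hTb hTc hTd.
have J2 := int4 E1 E2 E3 E4 _ _ _ _ (mdiff _ _ mpx ma) (mdiff _ _ mpy mb) (mdiff _ _ mqx mc) (mdiff _ _ mqy md) Ia Ib Ic Id.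
have mS1 := sum4_meas _ _ _ _ ma mb mc md.
have mS2 := sum4_meas E1 E2 E3 E4 (mdiff _ _ mpx ma) (mdiff _ _ mpy mb) (mdiff _ _ mqx mc) (mdiff _ _ mqy md).
pose bd z := ((1 + K)%:E * (l%:E * sum4 a b c d z + (1 + l^-1)%:E * sum4 E1 E2 E3 E4 z))%E.
have bd0 z : (0 <= bd z)%E.
  apply: mule_ge0; first by rewrite lee_fin.
  by apply: adde_ge0; apply: mule_ge0 => //; rewrite lee_fin ltW.
have mbd : measurable_fun Q bd.
  by apply: measurable_funeM; apply: emeasurable_funD; exact: measurable_funeM.
apply: (@le_trans _ _ (\int[mu2]_(z in Q) bd z)%E).
  apply: ae_ge0_le_integral => //.
  - by move=> z _; rewrite lee_fin le_max lexx.
  - exact/measurable_EFinP.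
  apply: filterS hae => z hz Qz.
  have {}hz := hz Qz.
  rewrite (_ : bd z = ((1 + K) * (l * (a z ^+ 2 + (b z ^+ 2 + (c z ^+ 2 + d z ^+ 2))) + (1 + l^-1) * (E1 z ^+ 2 + (E2 z ^+ 2 + (E3 z ^+ 2 + E4 z ^+ 2)))))%:E)//.
  rewrite lee_fin.
  by apply: le_trans (distort_perturb _ _ _ _ K0 l0 hz) _; rewrite !addrA.
rewrite /bd ge0_integralZl//; last 2 first.
- by apply: emeasurable_funD; exact: measurable_funeM.
- by move=> z _; apply: adde_ge0; apply: mule_ge0 => //; rewrite lee_fin ltW.
rewrite ge0_integralD//; last 4 first.
- by move=> z _; rewrite mule_ge0// lee_fin ltW.
- exact: measurable_funeM.
- by move=> z _; rewrite mule_ge0// lee_fin ltW.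
- exact: measurable_funeM.
rewrite !ge0_integralZl//; last 2 first.
- by rewrite lee_fin ltW.
- by rewrite lee_fin ltW.
rewrite EFinM; apply: lee_wpmul2l; first by rewrite lee_fin.
rewrite [leRHS]EFinD (EFinM l) (EFinM (1 + l^-1)).
by apply: leeD; apply: lee_wpmul2l => //; rewrite lee_fin ltW.
Qed.

Lemma in_box_norm (x0 y0 rho x : R) : 0 < rho -> x0 - rho <= x <= x0 + rho ->
  `|x| <= `|x0| + `|y0| + 2 * rho.
Proof.
move=> r0 h; have := ler_norm x0; have := ler_norm (- x0); rewrite normrN.
have := normr_ge0 y0; rewrite ler_norml; lra.
Qed.

Lemma moll_close_box (g : R * R -> R) (z0 : R * R) (rho h d e : R) (k k' : R -> R) :
  0 < rho -> continuous g -> 0 < h -> h < rho -> h < d -> bump h k k' ->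
  (forall z w : R * R, `|z.1| <= `|z0.1| + `|z0.2| + 2 * rho -> `|z.2| <= `|z0.1| + `|z0.2| + 2 * rho ->
    `|w.1 - z.1| < d -> `|w.2 - z.2| < d -> `|g w - g z| < e) ->
  forall z, rect (z0.1 - rho) (z0.1 + rho) (z0.2 - rho) (z0.2 + rho) z ->
  `|moll (z0.1 - 2 * rho) (z0.1 + 2 * rho) (z0.2 - 2 * rho) (z0.2 + 2 * rho) g k k z - g z| <= e.
Proof.
move=> r0 cg h0 hr hd bk hu [x y] [/=]; rewrite !in_itv/= => xq yq.
have bx := @in_box_norm z0.1 z0.2 rho x r0 xq.
have := @in_box_norm z0.2 z0.1 rho y r0 yq; rewrite (addrC `|z0.2|) => by'.
apply: (moll_close cg h0 bk) => //=.
- by clear -xq r0; lra.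
- by clear -xq hr; lra.
- by clear -yq r0; lra.
- by clear -yq hr; lra.
move=> a b ax bY; apply/ltW/hu => //=.
- by clear -ax hd; rewrite ger0_norm; lra.
- by clear -bY hd; rewrite ger0_norm; lra.
Qed.

(** Both coordinates are mollified with the same kernel. The functions
    converge uniformly and the gradients in L2; the distortion is quadratic in
    the gradient and non-positive in the limit, so its positive part tends to
    0 in L1. *)
Lemma cart_approx (K : R) (W : set (R * R)) (u1 u2 a b c d ge1 ge2 : R * R -> R) (z0 : R * R) (rho : R) :
  0 <= K -> 0 < rho ->
  let B := rect (z0.1 - 2 * rho) (z0.1 + 2 * rho) (z0.2 - 2 * rho) (z0.2 + 2 * rho) in
  let Q := rect (z0.1 - rho) (z0.1 + rho) (z0.2 - rho) (z0.2 + rho) in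
  B `<=` W -> continuous ge1 -> continuous ge2 ->
  (forall w, B w -> ge1 w = u1 w) -> (forall w, B w -> ge2 w = u2 w) ->
  weak_partial W 0 u1 a -> weak_partial W 1 u1 b ->
  weak_partial W 0 u2 c -> weak_partial W 1 u2 d ->
  measurable_fun B a -> (\int[mu2]_(z in B) ((a z) ^+ 2)%:E < +oo)%E ->
  measurable_fun B b -> (\int[mu2]_(z in B) ((b z) ^+ 2)%:E < +oo)%E ->
  measurable_fun B c -> (\int[mu2]_(z in B) ((c z) ^+ 2)%:E < +oo)%E ->
  measurable_fun B d -> (\int[mu2]_(z in B) ((d z) ^+ 2)%:E < +oo)%E ->
  {ae mu2, forall z, W z -> distort K (a z) (b z) (c z) (d z) <= 0} ->
  forall e : R, 0 < e -> exists p px py q qx qy : R * R -> R,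
    [/\ C1 p px py, C1 q qx qy,
      (forall z, Q z -> `|p z - u1 z| <= e /\ `|q z - u2 z| <= e) &
      (\int[mu2]_(z in Q) (Num.max 0 (distort K (px z) (py z) (qx z) (qy z)))%:E <= e%:E)%E].
Proof.
move=> K0 rho0 B Q BW cge1 cge2 geu1 geu2 wa wb wc wd ma a2 mb b2 mc c2 md d2 hae e e0.
have mB : measurable (B : set rT2) by exact: rect_measurable.
have mQ : measurable (Q : set rT2) by exact: rect_measurable.
have QB : Q `<=` B.
  by move=> [x y] [/=]; rewrite !in_itv/= => h1 h2; split; rewrite /= in_itv/=; lra.
have sq_meas (g : rT2 -> R) : measurable_fun B g -> measurable_fun Q (fun z => ((g z) ^+ 2)%:E).
  by move=> mg; apply/measurable_EFinP/measurable_funX; exact: measurable_funS mg.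
have sq_ge (g : rT2 -> R) z : (0 <= ((g z) ^+ 2)%:E)%E by rewrite lee_fin sqr_ge0.
have fin (g : rT2 -> R) : measurable_fun B g -> (\int[mu2]_(z in B) ((g z) ^+ 2)%:E < +oo)%E ->
    exists2 T : R, 0 <= T & (\int[mu2]_(z in Q) ((g z) ^+ 2)%:E <= T%:E)%E.
  move=> mg g2.
  have fn : (\int[mu2]_(z in B) ((g z) ^+ 2)%:E)%E \is a fin_num.
    by rewrite ge0_fin_numE//; exact: integral_ge0.
  exists (fine (\int[mu2]_(z in B) ((g z) ^+ 2)%:E)%E).
    by apply: fine_ge0; exact: integral_ge0.
  rewrite fineK//; apply: ge0_subset_integral => //.
  by apply/measurable_EFinP/measurable_funX.
have [Ta Ta0 hTa] := fin _ ma a2; have [Tb Tb0 hTb] := fin _ mb b2.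
have [Tc Tc0 hTc] := fin _ mc c2; have [Td Td0 hTd] := fin _ md d2.
pose T := Ta + Tb + Tc + Td.
have T0 : 0 <= T by rewrite !addr_ge0.
have K1 : 0 < 1 + K by clear -K0; lra.
have T1 : 0 < T + 1 by clear -T0; lra.
(* l makes the first term of the perturbation bound at most e / 2, and then e'
   makes the second one equal to e / 2 *)
pose l := e / (2 * (1 + K) * (T + 1)).
have l0 : 0 < l by rewrite divr_gt0// !mulr_gt0.
have l10 : 0 < 1 + l^-1 by rewrite addr_gt0// invr_gt0.
pose e' := e / (2 * (1 + K) * (1 + l^-1) * 4).
have e'0 : 0 < e' by rewrite divr_gt0// !mulr_gt0.
have [da da0 hda] := component_approx rho0 BW cge1 geu1 wa ma a2 e'0.
have [db db0 hdb] := component_approx rho0 BW cge1 geu1 wb mb b2 e'0.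
have [dc dc0 hdc] := component_approx rho0 BW cge2 geu2 wc mc c2 e'0.
have [dd dd0 hdd] := component_approx rho0 BW cge2 geu2 wd md d2 e'0.
have [d1 d10 hd1] := ucont_box (`|z0.1| + `|z0.2| + 2 * rho) cge1 e0.
have [d2' d20 hd2] := ucont_box (`|z0.1| + `|z0.2| + 2 * rho) cge2 e0.
have [h [h0 [ha hb] [hc hd] [hr h1 h2]]] : exists h, [/\ 0 < h, h < da /\ h < db, h < dc /\ h < dd & [/\ h < rho, h < d1 & h < d2']].
  pose dm := Num.min (Num.min (Num.min da db) (Num.min dc dd)) (Num.min rho (Num.min d1 d2')).
  have dm0 : 0 < dm by rewrite !lt_min da0 db0 dc0 dd0 rho0 d10 d20.
  exists (dm / 2).
  have : dm / 2 < dm by clearbody dm; clear -dm0; lra.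
  rewrite {2}/dm !lt_min => /andP[/andP[/andP[ha hb] /andP[hc hd]] /andP[hr /andP[h1 h2]]].
  by split => //; rewrite divr_gt0.
have [k [k' bk]] := bump_exists h0.
have [sk pk ck' k0 [ko k'o ki]] := bk.
pose X0 := z0.1 - 2 * rho; pose X1 := z0.1 + 2 * rho.
pose Y0 := z0.2 - 2 * rho; pose Y1 := z0.2 + 2 * rho.
pose px := moll X0 X1 Y0 Y1 ge1 (fun t => - k' t) k.
pose py := moll X0 X1 Y0 Y1 ge1 k (fun t => - k' t).
pose qx := moll X0 X1 Y0 Y1 ge2 (fun t => - k' t) k.
pose qy := moll X0 X1 Y0 Y1 ge2 k (fun t => - k' t).
have X01 : X0 <= X1 by rewrite /X0 /X1; clear -rho0; lra.
have Y01 : Y0 <= Y1 by rewrite /Y0 /Y1; clear -rho0; lra.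
have C1p := moll_C1 X01 Y01 cge1 ck' ck' pk pk.
have C1q := moll_C1 X01 Y01 cge2 ck' ck' pk pk.
exists (moll X0 X1 Y0 Y1 ge1 k k), px, py, (moll X0 X1 Y0 Y1 ge2 k k), qx, qy.
split; [exact: C1p|exact: C1q| |].
  move=> z Qz; rewrite -geu1; last exact: QB. rewrite -geu2; last exact: QB.
  by split; [exact: (moll_close_box rho0 cge1 h0 hr h1 bk hd1)|exact: (moll_close_box rho0 cge2 h0 hr h2 bk hd2)].
have Ia := hda h k k' (introT andP (conj h0 ha)) bk px erefl.
have Ib := hdb h k k' (introT andP (conj h0 hb)) bk py erefl.
have Ic := hdc h k k' (introT andP (conj h0 hc)) bk qx erefl.
have Id := hdd h k k' (introT andP (conj h0 hd)) bk qy erefl.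
have [_ cpx cpy _ _] := C1p; have [_ cqx cqy _ _] := C1q.
rewrite -/px -/py -/qx -/qy in cpx cpy cqx cqy.
have mc' (g : R * R -> R) : continuous g -> measurable_fun Q (g : rT2 -> R).
  by move=> cg; exact: measurable_funS (plane_cont_measurable cg).
have mQ' (g : rT2 -> R) : measurable_fun B g -> measurable_fun Q g.
  by move=> mg; exact: measurable_funS mg.
have cdist : continuous (fun z => Num.max 0 (distort K (px z) (py z) (qx z) (qy z))).
  by rewrite /distort; cts.
have hae' : {ae mu2, forall z, Q z -> distort K (a z) (b z) (c z) (d z) <= 0}.
  apply: filterS hae; first exact: (ae_filter_ringOfSetsType lebesgue2_sf).
  by move=> z hz Qz; exact: hz (BW _ (QB _ Qz)).
have := distort_int_le mQ K0 l0 (mQ' _ ma) (mQ' _ mb) (mQ' _ mc) (mQ' _ md)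
  (mc' _ cpx) (mc' _ cpy) (mc' _ cqx) (mc' _ cqy) hTa hTb hTc hTd Ia Ib Ic Id hae' (mc' _ cdist).
move=> H; apply: (le_trans H); rewrite lee_fin -/T.
clear -l0 l10 K1 T1 T0 e0.
have E1 : (1 + K) * (l * T) <= e / 2.
  rewrite (_ : (1 + K) * (l * T) = (e / 2) * (T / (T + 1))); last first.
    rewrite /l; clear e' l l0 l10; clearbody T; field; apply/andP; split; lra.
  rewrite ler_piMr//; first by rewrite divr_ge0// ltW.
  by rewrite ler_pdivrMr// mul1r lerDl.
have E2 : (1 + K) * ((1 + l^-1) * (e' + e' + e' + e')) = e / 2.
  rewrite /e'; set m := 1 + l^-1 in l10 *; clearbody m.
  by clear -l10 K1; field; apply/andP; split; lra.
by rewrite mulrDr E2; clear -E1; lra.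
Qed.

End Cart.

(** * Double integrals and Green's identity *)

Section Dint.
Context {R : realType}.
Implicit Types (g : R * R -> R).

Definition dint (a b c d : R) g := oint a b (fun s => oint c d (fun t => g (s, t))).

Lemma cont_inner g c d : continuous g -> continuous (fun s : R => oint c d (fun t => g (s, t))).
Proof. exact: cont_oint_param. Qed.

Lemma cont_slice1 g s : continuous g -> continuous (fun t : R => g (s, t)).
Proof. by move=> cg; cts. Qed.
Lemma dintD a b c d g1 g2 : continuous g1 -> continuous g2 ->
  dint a b c d (fun z => g1 z + g2 z) = dint a b c d g1 + dint a b c d g2.
Proof.
move=> c1 c2; rewrite /dint -ointD; [|exact: cont_inner..].
by congr oint; apply/funext => s; rewrite ointD//; exact: cont_slice1.
Qed.

Lemma dintZ a b c d k g : continuous g -> dint a b c d (fun z => k * g z) = k * dint a b c d g.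
Proof.
move=> cg; rewrite /dint -ointZ; last exact: cont_inner.
by congr oint; apply/funext => s; rewrite ointZ//; exact: cont_slice1.
Qed.

Lemma dint_cst a b c d k : dint a b c d (fun=> k) = k * (b - a) * (d - c).
Proof. by rewrite /dint; under eq_fun do rewrite oint_cst; rewrite oint_cst; ring. Qed.

Lemma le_dint a b c d g1 g2 : continuous g1 -> continuous g2 -> a <= b -> c <= d ->
  (forall s t, a <= s <= b -> c <= t <= d -> g1 (s, t) <= g2 (s, t)) ->
  dint a b c d g1 <= dint a b c d g2.
Proof.
move=> c1 c2 ab cd h; apply: le_oint => //; try exact: cont_inner.
move=> s sab; apply: le_oint => //; try exact: cont_slice1.
by move=> t tcd; exact: h.
Qed.

Lemma dint_ge0 a b c d g : continuous g -> a <= b -> c <= d ->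
  (forall s t, a <= s <= b -> c <= t <= d -> 0 <= g (s, t)) -> 0 <= dint a b c d g.
Proof.
move=> cg ab cd h; have -> : 0 = dint a b c d (fun=> 0) by rewrite dint_cst !mul0r.
by apply: le_dint => //; cts.
Qed.

Lemma dint_cat a e b c d g : continuous g -> dint a e c d g + dint e b c d g = dint a b c d g.
Proof. by move=> cg; apply: oint_cat; exact: cont_inner. Qed.

Lemma le_dint_sub a b a' b' c d g : continuous g -> a <= a' -> a' <= b' -> b' <= b -> c <= d ->
  (forall s t, a <= s <= b -> c <= t <= d -> 0 <= g (s, t)) ->
  dint a' b' c d g <= dint a b c d g.
Proof.
move=> cg aa ab bb cd h.
rewrite -(dint_cat a a' b)// -(dint_cat a' b' b)//.
have h1 : 0 <= dint a a' c d g.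
  by apply: dint_ge0 => // s t sa td; apply: h => //; lra.
have h2 : 0 <= dint b' b c d g.
  by apply: dint_ge0 => // s t sa td; apply: h => //; lra.
lra.
Qed.

Lemma dintC a b c d g : continuous g -> a <= b -> c <= d ->
  dint a b c d g = oint c d (fun t => oint a b (fun s => g (s, t))).
Proof. exact: dint_swap. Qed.

Lemma ler_norm_dint a b c d g : continuous g -> a <= b -> c <= d ->
  `|dint a b c d g| <= dint a b c d (fun z => `|g z|).
Proof.
move=> cg ab cd; rewrite ler_norml -mulN1r -dintZ; last by cts.
by apply/andP; split; apply: le_dint => //; try (by cts); move=> s t _ _; have := ler_norm (g (s, t));
  have := ler_norm (- g (s, t)); rewrite normrN; lra.
Qed.

Lemma ftc_s a b g gx t : continuous gx -> (forall s t : R, is_derive s 1 (fun x => g (x, t)) (gx (s, t))) ->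
  oint a b (fun s => gx (s, t)) = g (b, t) - g (a, t).
Proof. by move=> cg h; rewrite (@ointE _ _ (fun s => g (s, t))). Qed.

Lemma ftc_t c d g gy s : continuous gy -> (forall s t : R, is_derive t 1 (fun x => g (s, x)) (gy (s, t))) ->
  oint c d (fun t => gy (s, t)) = g (s, d) - g (s, c).
Proof. by move=> cg h; rewrite (@ointE _ _ (fun t => g (s, t))). Qed.

Lemma oint_periodic (f : R -> R) (p a : R) : continuous f -> (forall t, f (t + p) = f t) ->
  oint a (a + p) f = oint 0 p f.
Proof.
move=> cf fp; have [P hP] := prim_exists cf.
pose Q t := P (t + p).
have hQ : is_prim f Q.
  move=> t; rewrite -(fp t).
  have h1 : is_derive t 1 (fun t : R => t + p) 1 by der; ring.
  by have h2 := der_comp (g := fun t : R => t + p) (hP (t + p)) h1; apply: der_eq h2 _; rewrite mulr1.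
rewrite !(ointE _ _ hP).
have := prim_uniq a 0 hP hQ; rewrite /Q add0r; lra.
Qed.

(** The Steklov average over [t, t + h]. Averaging a C1 function makes its
    mixed second derivative exist. *)
Definition avg_t (h : R) g (z : R * R) := h^-1 * oint 0 h (fun t => g (z.1, z.2 + t)).

Lemma avg_tE h g s t : continuous g -> avg_t h g (s, t) = h^-1 * oint t (t + h) (fun x => g (s, x)).
Proof.
move=> cg; rewrite /avg_t /=; congr (_ * _).
have [P hP] := prim_exists (cont_slice1 (s := s) cg).
rewrite (ointE _ _ hP) (@ointE _ _ (fun x => P (t + x))); first by rewrite addr0.
move=> x.
have h1 : is_derive x 1 (fun x : R => t + x) 1 by der; ring.
by have h2 := der_comp (g := fun x : R => t + x) (hP (t + x)) h1; apply: der_eq h2 _; rewrite mulr1.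
Qed.

Lemma avg_t_cont h g : continuous g -> continuous (avg_t h g).
Proof.
move=> cg; apply: contM; first by cts.
by apply: (cont_oint_param (g := fun p : (R * R) * R => g (p.1.1, p.1.2 + p.2))); cts.
Qed.

Lemma avg_t_close h g s t e : 0 < h -> continuous g ->
  (forall x, t <= x <= t + h -> `|g (s, x) - g (s, t)| <= e) -> `|avg_t h g (s, t) - g (s, t)| <= e.
Proof.
move=> h0 cg hg; rewrite avg_tE//.
have -> : g (s, t) = h^-1 * oint t (t + h) (fun _ => g (s, t)).
  by rewrite oint_cst; field; lra.
have cs := cont_slice1 (s := s) cg.
have hV : 0 < h^-1 by rewrite invr_gt0.
have e1 : oint t (t + h) (fun x => g (s, x)) <= oint t (t + h) (fun _ => g (s, t) + e).
  by apply: le_oint => //; [cts|lra|move=> x /hg; rewrite ler_norml; lra].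
have e2 : oint t (t + h) (fun _ => g (s, t) - e) <= oint t (t + h) (fun x => g (s, x)).
  by apply: le_oint => //; [cts|lra|move=> x /hg; rewrite ler_norml; lra].
rewrite !oint_cst in e1 e2 *; rewrite -mulrBr normrM gtr0_norm// mulrC ler_pdivrMr//.
rewrite ler_norml; lra.
Qed.

Lemma avg_t_dt (h : R) g (s t : R) : continuous g ->
  is_derive t 1 (fun x => avg_t h g (s, x)) (h^-1 * (g (s, t + h) - g (s, t))).
Proof.
move=> cg; under eq_fun do rewrite avg_tE//.
have [P hP] := prim_exists (cont_slice1 (s := s) cg).
under eq_fun do rewrite (ointE _ _ hP).
have h1 : is_derive t 1 (fun t : R => t + h) 1 by der; ring.
have h2 := der_comp (g := fun t : R => t + h) (hP (t + h)) h1.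
have h3 := hP t.
by der; ring.
Qed.

(** The same function is the average of the derivative and the derivative of
    the average. *)
Lemma avg_t_slope h g gy s t : continuous gy ->
  (forall s t : R, is_derive t 1 (fun x => g (s, x)) (gy (s, t))) ->
  h^-1 * (g (s, t + h) - g (s, t)) = avg_t h gy (s, t).
Proof. by move=> cg hd; rewrite avg_tE// (ftc_t _ _ _ cg hd). Qed.

(** Differentiation of the quasi-periodicity relation. *)
Lemma periodic_der (g gx : R * R -> R) (p q s t : R) :
  (forall s t : R, is_derive s 1 (fun x => g (x, t)) (gx (s, t))) ->
  (forall s t, g (s, t + p) = g (s, t) + q) -> gx (s, t + p) = gx (s, t).
Proof.
move=> hd hp; have h1 := hd s (t + p).
have h2 : is_derive s 1 (fun x => g (x, t + p)) (gx (s, t)).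
  rewrite (_ : (fun x => _) = fun x => g (x, t) + q); last by apply/funext => x; rewrite hp.
  by have := hd s t => ?; der; ring.
by rewrite -(@derive_val _ _ _ _ _ _ _ h1) -(@derive_val _ _ _ _ _ _ _ h2).
Qed.

(** The averages of Vs and Vt are the partial derivatives of the average of V,
    and they have the common mixed derivative M. Hence ws Vt - wt Vs is the
    difference of an s-derivative and a t-derivative. The latter integrates to
    0 by periodicity; the former gives wb - wa times the increment 2 pi of
    V. *)
Lemma green_avg (h a b wa wb : R) w ws wt V Vs Vt : 0 < h -> a <= b -> C1 w ws wt -> C1 V Vs Vt ->
  (forall s t, w (s, t + 2 * pi) = w (s, t)) -> (forall s t, V (s, t + 2 * pi) = V (s, t) + 2 * pi) ->
  (forall t, w (a, t) = wa) -> (forall t, w (b, t) = wb) ->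
  dint a b 0 (2 * pi) (fun z => ws z * avg_t h Vt z - wt z * avg_t h Vs z) = 2 * pi * (wb - wa).
Proof.
move=> h0 ab [cw cws cwt dws dwt] [cV cVs cVt dVs dVt] pw pV ha hb.
have pi0 : 0 <= 2 * pi :> R by have := @pi_ge0 R; lra.
have pVs s t : Vs (s, t + 2 * pi) = Vs (s, t) by exact: (periodic_der _ _ dVs pV).
have c1 := avg_t_cont (h := h) cVs; have c2 := avg_t_cont (h := h) cVt.
pose M (z : R * R) := h^-1 * (Vs (z.1, z.2 + h) - Vs (z.1, z.2)).
have cM : continuous M by rewrite /M; cts.
have hz (z : R * R) : z = (z.1, z.2) by case: z.
pose G z := w z * avg_t h Vt z; pose P z := w z * avg_t h Vs z.
pose Gs z := ws z * avg_t h Vt z + w z * M z.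
pose Pt z := wt z * avg_t h Vs z + w z * M z.
have cGs : continuous Gs by rewrite /Gs; cts.
have cPt : continuous Pt by rewrite /Pt; cts.
have dG (s t : R) : is_derive s 1 (fun x => G (x, t)) (Gs (s, t)).
  rewrite /G /Gs /M /=; have ? := dws s t.
  have -> : (fun x => w (x, t) * avg_t h Vt (x, t)) =
    (fun x => w (x, t) * (h^-1 * (V (x, t + h) - V (x, t)))).
    by apply/funext => x; rewrite (avg_t_slope _ _ _ cVt dVt).
  have ? := dVs s t; have ? := dVs s (t + h).
  der; rewrite -(avg_t_slope _ _ _ cVt dVt) /GRing.scale /=; ring.
have dP (s t : R) : is_derive t 1 (fun x => P (s, x)) (Pt (s, t)).
  rewrite /P /Pt /M /=; have ? := dwt s t; have ? := avg_t_dt h s t cVs.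
  by der; ring.
have -> : (fun z => ws z * avg_t h Vt z - wt z * avg_t h Vs z) = (fun z => Gs z + (-1) * Pt z).
  by apply/funext => z; rewrite /Gs /Pt; ring.
rewrite dintD//; last by cts.
rewrite dintZ// dintC// /dint.
have -> : (fun t => oint a b (fun s => Gs (s, t))) = (fun t => (wb - wa) * avg_t h Vt (b, t) + wa * (avg_t h Vt (b, t) + (-1) * avg_t h Vt (a, t))).
  by apply/funext => t; rewrite (ftc_s _ _ _ cGs dG) /G ha hb; ring.
have -> : (fun s => oint 0 (2 * pi) (fun t => Pt (s, t))) = (fun s => 0).
  apply/funext => s; rewrite (ftc_t _ _ _ cPt dP) /P.
  have := pw s 0; rewrite add0r => ->.
  rewrite !avg_tE// ?(addrC (2 * pi)) add0r.
  have -> : oint (2 * pi) (h + 2 * pi) (fun x => Vs (s, x)) = oint 0 h (fun x => Vs (s, x)); last by ring.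
  have [Q hQ] := prim_exists (cont_slice1 (s := s) cVs).
  rewrite (ointE _ _ hQ) (@ointE _ _ (fun x => Q (x + 2 * pi))) ?add0r// => x.
  have h1 : is_derive x 1 (fun x : R => x + 2 * pi) 1 by der; ring.
  have h2 := der_comp (g := fun x : R => x + 2 * pi) (hQ (x + 2 * pi)) h1.
  by apply: der_eq h2 _; rewrite mulr1.
rewrite oint_cst mul0r mulr0 addr0.
have hV s : oint 0 (2 * pi) (fun t => avg_t h Vt (s, t)) = 2 * pi.
  have -> : (fun t => avg_t h Vt (s, t)) = (fun t => h^-1 * (V (s, t + h) - V (s, t))).
    by apply/funext => t; rewrite (avg_t_slope _ _ _ cVt dVt).
  rewrite (@ointE _ _ (fun t => avg_t h V (s, t))); last by move=> t; exact: avg_t_dt.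
  rewrite !avg_tE//.
  have [Q hQ] := prim_exists (cont_slice1 (s := s) cV).
  have hQ2 : is_prim (fun x => V (s, x)) (fun x => Q (x + 2 * pi) - 2 * pi * x).
    move=> x.
    have h1 : is_derive x 1 (fun x : R => x + 2 * pi) 1 by der; ring.
    have h2 := der_comp (g := fun x : R => x + 2 * pi) (hQ (x + 2 * pi)) h1.
    by der; rewrite pV /GRing.scale /=; ring.
  rewrite (ointE 0 _ hQ2) (ointE _ _ hQ) !add0r (addrC h); field; lra.
have cb : continuous (fun t => avg_t h Vt (b, t)) by cts.
have ca : continuous (fun t => avg_t h Vt (a, t)) by cts.
rewrite ointD; [|by cts..].
rewrite ointZ//.
rewrite ointZ; [|by cts].
rewrite ointD//; [|by cts].
by rewrite (ointZ (-1) 0 (2 * pi) ca) !hV; ring.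
Qed.

(** Area of the image of an annulus under a map of degree 1. For w and V of
    class C1 the mixed derivative of V need not exist, so V is replaced by its
    averages, which converge uniformly on compact sets together with their
    first derivatives. *)
Lemma green_C1 (a b wa wb : R) w ws wt V Vs Vt : a <= b -> C1 w ws wt -> C1 V Vs Vt ->
  (forall s t, w (s, t + 2 * pi) = w (s, t)) -> (forall s t, V (s, t + 2 * pi) = V (s, t) + 2 * pi) ->
  (forall t, w (a, t) = wa) -> (forall t, w (b, t) = wb) ->
  dint a b 0 (2 * pi) (fun z => ws z * Vt z - wt z * Vs z) = 2 * pi * (wb - wa).
Proof.
move=> ab Cw CV pw pV ha hb.
have pi0 : 0 <= 2 * pi :> R by have := @pi_ge0 R; lra.
have [cw cws cwt dws dwt] := Cw; have [cV cVs cVt dVs dVt] := CV.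
apply/eqP; rewrite -subr_eq0 -normr_le0; apply/ler_addgt0Pl => e e0; rewrite addr0.
pose D := dint a b 0 (2 * pi) (fun z => `|ws z| + `|wt z|).
have D0 : 0 <= D by apply: dint_ge0 => //; cts.
have e1 : 0 < e / (D + 1) by rewrite divr_gt0//; lra.
pose B := `|a| + `|b| + 2 * pi.
have [d1 d10 hd1] := ucont_box B cVs e1.
have [d2 d20 hd2] := ucont_box B cVt e1.
pose h := Num.min d1 d2 / 2.
have m0 : 0 < Num.min d1 d2 by rewrite lt_min d10.
have h0 : 0 < h by rewrite divr_gt0.
have md1 : Num.min d1 d2 <= d1 by rewrite ge_min lexx.
have md2 : Num.min d1 d2 <= d2 by rewrite ge_min lexx orbT.
have hm1 : h < d1 by rewrite /h; clear -m0 md1; lra.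
have hm2 : h < d2 by rewrite /h; clear -m0 md2; lra.
rewrite -(green_avg h0 ab Cw CV pw pV ha hb).
have c1 := avg_t_cont (h := h) cVs; have c2 := avg_t_cont (h := h) cVt.
set X := dint _ _ _ _ _; set Y := dint _ _ _ _ _.
have -> : X - Y = dint a b 0 (2 * pi) (fun z => ws z * (Vt z - avg_t h Vt z) - wt z * (Vs z - avg_t h Vs z)).
  have -> : X - Y = X + (-1) * Y by ring.
  rewrite /X /Y -dintZ; last by cts.
  rewrite -dintD; [|by cts..].
  by congr dint; apply/funext => z; ring.
apply: le_trans (ler_norm_dint _ _ _) _ => //; first by cts.
have ED : e / (D + 1) * D <= e by rewrite -mulrA ler_piMr// 1?mulrC ?ler_pdivrMr; lra.
apply: le_trans ED; rewrite /D -dintZ; last by cts.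
apply: le_dint => //; [cts|cts|move=> s t sab tpi].
have sB : `|s| <= B by rewrite /B ler_norml; have := ler_norm b; have := ler_norm (-a); have := normr_ge0 a; have := normr_ge0 b; rewrite !normrN; clear -sab pi0; lra.
have tB : `|t| <= B by rewrite /B ger0_norm; have := normr_ge0 a; have := normr_ge0 b; clear -tpi; lra.
have k1 : `|Vt (s, t) - avg_t h Vt (s, t)| <= e / (D + 1).
  rewrite distrC; apply: avg_t_close => // x hx; apply/ltW/hd2 => //=; first by rewrite subrr normr0.
  by rewrite ger0_norm; clear -hx hm2; lra.
have k2 : `|Vs (s, t) - avg_t h Vs (s, t)| <= e / (D + 1).
  rewrite distrC; apply: avg_t_close => // x hx; apply/ltW/hd1 => //=; first by rewrite subrr normr0.
  by rewrite ger0_norm; clear -hx hm1; lra.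
apply: le_trans (ler_normB _ _) _; rewrite !normrM mulrDr !(mulrC (e / _)).
by apply: lerD; apply: ler_wpM2l.
Qed.

End Dint.

(** * Truncations and the Dirichlet energy *)

Section Trap.
Context {R : realType}.
Implicit Types (m M x y : R).

Lemma eq_oint (a b : R) f g : continuous f -> continuous g -> a <= b ->
  (forall x, a <= x <= b -> f x = g x) -> oint a b f = oint a b g.
Proof.
move=> cf cg ab h; apply/eqP; rewrite eq_le; apply/andP; split; apply: le_oint => // x /h ->//.
Qed.

(** The plateau function with value 1 on [m, M] and slopes of width 1; its
    primitive [ramp] truncates u. *)
Definition trap m M x := Num.max 0 (Num.min 1 (Num.min (x - m + 1) (M + 1 - x))).

Lemma trap_cont m M : continuous (trap m M).
Proof. by rewrite /trap; cts. Qed.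
Lemma trap_ge0 m M x : 0 <= trap m M x.
Proof. by rewrite /trap le_max lexx. Qed.
Lemma trap_le1 m M x : trap m M x <= 1.
Proof. by rewrite /trap ge_max ler01 ge_min lexx. Qed.
Lemma trap1 m M x : m <= x <= M -> trap m M x = 1.
Proof.
move=> h; apply/eqP; rewrite eq_le trap_le1 /= /trap le_max !le_min lexx /=.
by apply/orP; right; apply/andP; split; lra.
Qed.
Lemma trap0l m M x : x <= m - 1 -> trap m M x = 0.
Proof.
move=> h; apply/eqP; rewrite eq_le trap_ge0 andbT /trap ge_max lexx /= !ge_min.
by apply/orP; right; apply/orP; left; lra.
Qed.
Lemma trap0r m M x : M + 1 <= x -> trap m M x = 0.
Proof.
move=> h; apply/eqP; rewrite eq_le trap_ge0 andbT /trap ge_max lexx /= !ge_min.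
by apply/orP; right; apply/orP; right; lra.
Qed.

Definition ramp m M x := oint (m - 1) x (trap m M).

Lemma ramp_prim m M : is_prim (trap m M) (ramp m M).
Proof. by apply: oint_prim; exact: trap_cont. Qed.

Lemma rampB m M x y : ramp m M y - ramp m M x = oint x y (trap m M).
Proof. by rewrite /ramp -(oint_cat (m - 1) x y); [ring|exact: trap_cont]. Qed.

Lemma ramp_lo m M x : x <= m - 1 -> ramp m M x = 0.
Proof.
move=> h; rewrite /ramp ointC; last exact: trap_cont.
rewrite (@eq_oint _ _ _ (fun=> 0)) ?oint_cst ?mul0r ?oppr0//.
- exact: trap_cont.
- by cts.
- by move=> y /andP[_ ?]; exact: trap0l.
Qed.

Lemma ramp_hi m M x : M + 1 <= x -> ramp m M x = ramp m M (M + 1).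
Proof.
move=> h; apply/eqP; rewrite -subr_eq0 rampB.
rewrite (@eq_oint _ _ _ (fun=> 0)) ?oint_cst ?mul0r//.
- exact: trap_cont.
- by cts.
- by move=> y /andP[? _]; exact: trap0r.
Qed.

Lemma ramp_total m M : m <= M -> ramp m M (M + 1) <= M - m + 2.
Proof.
move=> mM; have -> : M - m + 2 = oint (m - 1) (M + 1) (fun=> 1) by rewrite oint_cst; ring.
apply: le_oint; [exact: trap_cont|by cts|lra|move=> *; exact: trap_le1].
Qed.

Lemma ramp_le m M x y : x <= y -> ramp m M x <= ramp m M y.
Proof.
move=> xy; rewrite -subr_ge0 rampB.
have -> : 0 = oint x y (fun=> 0) by rewrite oint_cst mul0r.
by apply: le_oint => //; [by cts|exact: trap_cont|move=> *; exact: trap_ge0].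
Qed.

Lemma ramp_id m M x y : m <= x -> x <= y -> y <= M -> ramp m M y - ramp m M x = y - x.
Proof.
move=> mx xy yM; rewrite rampB (@eq_oint _ _ _ (fun=> 1)) ?oint_cst ?mul1r//.
- exact: trap_cont.
- by cts.
- by move=> z hz; apply: trap1; lra.
Qed.

End Trap.

Section Energy.
Context {R : realType}.
Local Notation T := (2 * pi : R).

Definition energy (Us Ut Vs Vt : R * R -> R) (z : R * R) :=
  Us z ^+ 2 + Ut z ^+ 2 + Vs z ^+ 2 + Vt z ^+ 2.

Definition jac (Us Ut Vs Vt : R * R -> R) (z : R * R) := Us z * Vt z - Ut z * Vs z.

Lemma energy_cont Us Ut Vs Vt : continuous Us -> continuous Ut -> continuous Vs -> continuous Vt ->
  continuous (energy Us Ut Vs Vt).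
Proof. by move=> h1 h2 h3 h4; rewrite /energy; cts. Qed.

(** The upper bound for the energy. The Jacobian of (ramp U, V) is trap U
    times that of (U, V), and ramp U is constant on both ends of the strip; so
    by Green's identity the integral of trap U times the Jacobian is 2 pi
    times the height of the ramp, whatever the length of the strip. *)
Lemma energy_bound (K a b m M : R) (U Us Ut V Vs Vt E : R * R -> R) : 0 <= K -> a <= b -> m <= M ->
  C1 U Us Ut -> C1 V Vs Vt -> continuous E -> (forall z, 0 <= E z) ->
  (forall s t, U (s, t + T) = U (s, t)) -> (forall s t, V (s, t + T) = V (s, t) + T) ->
  (forall s t, a <= s <= b -> energy Us Ut Vs Vt (s, t) <= K * jac Us Ut Vs Vt (s, t) + E (s, t)) ->
  (forall t, U (a, t) <= m - 1) -> (forall t, M + 1 <= U (b, t)) ->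
  dint a b 0 T (fun z => trap m M (U z) * energy Us Ut Vs Vt z) <=
    K * T * (M - m + 2) + dint a b 0 T E.
Proof.
move=> K0 ab mM CU CV cE E0 pU pV hN ha hb.
have [cU cUs cUt dUs dUt] := CU; have [cV cVs cVt dVs dVt] := CV.
have pi0 : 0 <= T by have := @pi_ge0 R; lra.
have ct := @trap_cont _ m M.
have cr : continuous (ramp m M) by exact: is_prim_cont (@ramp_prim _ m M).
pose w z := ramp m M (U z); pose ws z := trap m M (U z) * Us z; pose wt z := trap m M (U z) * Ut z.
have Cw : C1 w ws wt.
  split; rewrite /w /ws /wt; [by cts..| |] => x y.
  - exact: (der_comp (g := fun t => U (t, y)) (ramp_prim _ _ _) (dUs x y)).
  - exact: (der_comp (g := fun t => U (x, t)) (ramp_prim _ _ _) (dUt x y)).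
have G : dint a b 0 T (fun z => ws z * Vt z - wt z * Vs z) = T * (ramp m M (M + 1) - 0).
  apply: (green_C1 ab Cw CV _ pV) => [s t|t|t]; rewrite /w ?pU//.
    by rewrite ramp_lo.
  by rewrite ramp_hi.
have cws : continuous ws by case: Cw. have cwt : continuous wt by case: Cw.
apply: (@le_trans _ _ (dint a b 0 T (fun z => K * (ws z * Vt z - wt z * Vs z) + E z))).
  apply: le_dint => //; [by rewrite /energy; cts|by cts|].
  move=> s t sab _; have := hN s t sab; rewrite /ws /wt /jac.
  have := trap_ge0 m M (U (s, t)); have := trap_le1 m M (U (s, t)).
  move: (trap _ _ _) (energy _ _ _ _ _) (E (s, t)) (E0 (s, t)) => h n e e0 h1 h0 hn.
  apply: (@le_trans _ _ (h * (K * (Us (s, t) * Vt (s, t) - Ut (s, t) * Vs (s, t)) + e))).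
    by apply: ler_wpM2l.
  have : h * e <= e by rewrite ler_piMl.
  by clear; lra.
rewrite dintD//; last by cts.
rewrite dintZ; last by cts.
rewrite G lerD2r subr0 -!mulrA; apply: ler_wpM2l => //; rewrite !mulrA; apply: ler_wpM2l => //.
exact: ramp_total.
Qed.

(** The hypothesis is integrated over [p, p + 1]; this interval and its
    translate by l do not overlap and lie in [p, q]. *)
Lemma pair_average (A : R -> R) (L B p q l : R) : continuous A -> (forall s, 0 <= A s) ->
  1 <= l -> p + 1 + l <= q ->
  (forall s, p <= s <= p + 1 -> L <= A s + A (s + l) + B) -> L <= oint p q A + B.
Proof.
move=> cA A0 l1 pq h.
have pos x y : x <= y -> 0 <= oint x y A.
  move=> xy; have -> : 0 = oint x y (fun=> 0) by rewrite oint_cst mul0r.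
  by apply: le_oint => //; cts.
have e1 : oint p (p + 1) (fun=> L) <= oint p (p + 1) (fun s => (A s + A (s + l)) + B).
  by apply: le_oint => //; [by cts|by cts|lra].
have cl : continuous (fun s : R => A (s + l)) by cts.
rewrite ointD ?ointD ?oint_cst// in e1; [|by cts|by cts].
have e2 : oint p (p + 1) (fun s => A (s + l)) = oint (p + l) (p + 1 + l) A.
  have [P hP] := prim_exists cA.
  rewrite (ointE _ _ hP) (@ointE _ _ (fun x => P (x + l)))// => x.
  have h1 : is_derive x 1 (fun x : R => x + l) 1 by der; ring.
  by have h2 := der_comp (g := fun x : R => x + l) (hP (x + l)) h1; apply: der_eq h2 _; rewrite mulr1.
rewrite e2 in e1.
have := oint_cat p (p + 1) q cA; have := oint_cat (p + 1) (p + l) q cA.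
have := oint_cat (p + l) (p + 1 + l) q cA.
have k1 : p + 1 <= p + l by lra.
have := pos _ _ k1; have := pos _ _ pq; lra.
Qed.

Lemma var_s (w ws : R * R -> R) (p q s s' t : R) : continuous ws ->
  (forall s t : R, is_derive s 1 (fun x => w (x, t)) (ws (s, t))) -> p <= s <= q -> p <= s' <= q ->
  w (s', t) - w (s, t) <= oint p q (fun x => `|ws (x, t)|).
Proof.
move=> cw hd sI sI'.
have cs : continuous (fun x => ws (x, t)) by cts.
have ca : continuous (fun x => `|ws (x, t)|) by cts.
have pos x y : x <= y -> 0 <= oint x y (fun x => `|ws (x, t)|).
  move=> xy; have -> : 0 = oint x y (fun=> 0) by rewrite oint_cst mul0r.
  by apply: le_oint => //; cts.
rewrite -(@ftc_s _ _ _ w ws)//.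
have [ss|/ltW ss] := leP s s'.
- apply: (@le_trans _ _ (oint s s' (fun x => `|ws (x, t)|))).
    by apply: le_oint => // x _; exact: ler_norm.
  have := oint_cat p s q ca; have := oint_cat s s' q ca.
  have /andP[/pos a1 _] := sI; have /andP[_ /pos a2] := sI'; lra.
- apply: (@le_trans _ _ (oint s' s (fun x => `|ws (x, t)|))).
    rewrite ointC// -mulN1r -ointZ//; apply: le_oint => //; first by cts.
    by move=> x _; rewrite mulN1r -normrN; exact: ler_norm.
  have := oint_cat p s' q ca; have := oint_cat s' s q ca.
  have /andP[_ /pos a1] := sI; have /andP[/pos a2 _] := sI'; lra.
Qed.

Lemma var_t (w wt : R * R -> R) (p q s t t' : R) : continuous wt ->
  (forall s t : R, is_derive t 1 (fun x => w (s, x)) (wt (s, t))) -> p <= t <= q -> p <= t' <= q ->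
  w (s, t') - w (s, t) <= oint p q (fun x => `|wt (s, x)|).
Proof.
move=> cw hd; apply: (@var_s (fun z => w (z.2, z.1)) (fun z => wt (z.2, z.1)) p q t t' s); first by cts.
by move=> x y; exact: hd.
Qed.

End Energy.

(** * Strip maps: oscillation and growth *)

Section Strip.
Context {R : realType}.
Local Notation T := (2 * pi : R).

Lemma two_pi_ge1 : 1 <= T. Proof. by have := @pi_ge2 R; lra. Qed.

Lemma amgm (l x : R) : 0 < l -> `|x| <= l * x ^+ 2 + (4 * l)^-1.
Proof.
move=> l0; rewrite -(real_normK (num_real x)); move: `|x| => y.
have -> : l * y ^+ 2 + (4 * l)^-1 = y + (2 * l * y - 1) ^+ 2 / (4 * l) by field; lra.
by rewrite lerDl divr_ge0// ?sqr_ge0//; lra.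
Qed.

(** The hypothesis is integrated over th. *)
Lemma theta_average (L D p q : R) (g : R * R -> R) : continuous g -> p <= q ->
  (forall th, 0 <= th <= T -> L <= D + oint p q (fun s => g (s, th))) ->
  T * L <= T * D + dint p q 0 T g.
Proof.
move=> cg pq h; have T1 := two_pi_ge1.
have cc : continuous (fun th : R => oint p q (fun s => g (s, th))).
  by apply: (cont_oint_param (g := fun z : R * R => g (z.2, z.1))); cts.
have e1 : oint 0 T (fun=> L) <= oint 0 T (fun th => D + oint p q (fun s => g (s, th))).
  apply: le_oint => //; [by cts|by cts|lra].
rewrite ointD// ?oint_cst in e1; last by cts.
rewrite dintC//; lra.
Qed.

(** Cauchy-Schwarz in additive form: lengths are compared with energies, at a
    rate l to be optimized. *)
Lemma dint_sq_le (l p q : R) (h f g E : R * R -> R) : 0 < l -> p <= q ->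
  continuous h -> continuous f -> continuous g -> continuous E ->
  (forall z, 0 <= h z <= 1) -> (forall z, f z ^+ 2 + g z ^+ 2 <= E z) ->
  dint p q 0 T (fun z => `|h z * f z|) + dint p q 0 T (fun z => `|h z * g z|) <=
  l * dint p q 0 T (fun z => h z * E z) + (2 * l)^-1 * (q - p) * T.
Proof.
move=> l0 pq ch cf cg cE h01 hE; have T1 := two_pi_ge1.
rewrite -dintD; [|by cts..].
rewrite -dintZ; last by cts.
have -> : (2 * l)^-1 * (q - p) * T = dint p q 0 T (fun=> (2 * l)^-1) by rewrite dint_cst; ring.
rewrite -dintD; [|by cts..].
apply: le_dint => //; [by cts|by cts|lra|move=> s t _ _].
have /andP[h0 h1] := h01 (s, t).
rewrite !normrM (ger0_norm h0) -mulrDr.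
have a1 := amgm (f (s, t)) l0; have a2 := amgm (g (s, t)) l0.
have hm := ler_wpM2l (ltW l0) (hE (s, t)).
have l2 : (4 * l)^-1 + (4 * l)^-1 = (2 * l)^-1 by field; lra.
have l3 : 0 <= (2 * l)^-1 by rewrite invr_ge0; lra.
rewrite mulrCA; move: (h (s, t)) (E (s, t)) h0 h1 hm => k e k0 k1 hm.
apply: (@le_trans _ _ (k * (l * e + (2 * l)^-1))).
  by apply: ler_wpM2l => //; clear -a1 a2 hm l2; lra.
by rewrite mulrDr lerD2l ler_piMl.
Qed.

Lemma energy_ge_t (a b c d : R * R -> R) z : b z ^+ 2 + a z ^+ 2 <= energy a b c d z.
Proof. by rewrite /energy; have := sqr_ge0 (c z); have := sqr_ge0 (d z); lra. Qed.
Lemma energy_ge_s (a b c d : R * R -> R) z : d z ^+ 2 + c z ^+ 2 <= energy a b c d z.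
Proof. by rewrite /energy; have := sqr_ge0 (a z); have := sqr_ge0 (b z); lra. Qed.

(** C1 approximations of (u, v) for which the Hilbert-Schmidt inequality holds
    up to an error of small integral. *)
Definition strip_approx (K S0 : R) (u v : R * R -> R) := forall a b e : R, a < b -> b <= S0 -> 0 < e ->
  exists U Us Ut V Vs Vt E : R * R -> R,
  [/\ C1 U Us Ut, C1 V Vs Vt, continuous E, (forall z, 0 <= E z) & dint a b 0 T E <= e] /\
  [/\ (forall s t, U (s, t + T) = U (s, t)), (forall s t, V (s, t + T) = V (s, t) + T) &
      forall s t, a <= s <= b -> [/\ `|U (s, t) - u (s, t)| <= e, `|V (s, t) - v (s, t)| <= e &
        energy Us Ut Vs Vt (s, t) <= K * jac Us Ut Vs Vt (s, t) + E (s, t)]].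

Definition rect_boundary (p q c d : R) (z : R * R) :=
  [/\ p <= z.1 <= q, c <= z.2 <= d & [\/ z.1 = p, z.1 = q, z.2 = c | z.2 = d]].

(** The properties of log (f (z0 + exp (s + i t)) - f z0) = u + i v on the
    half-strip s <= S0 from which the growth estimate follows:
    approximability, monotonicity of the extrema of u on circles, and the
    maximum and minimum principles for v on rectangles. *)
Record strip_map (K S0 : R) (u v : R * R -> R) : Prop := StripMap {
  strip_K : 0 < K;
  strip_C1 : strip_approx K S0 u v;
  strip_per : forall s t, s <= S0 -> v (s, t + T) = v (s, t) + T;
  strip_min : forall s s' t' : R, s < s' -> s' <= S0 -> exists2 t, 0 <= t <= T & u (s, t) <= u (s', t');
  strip_max : forall s s' t : R, s < s' -> s' <= S0 -> exists2 t', 0 <= t' <= T & u (s, t) <= u (s', t');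
  strip_inf : forall B : R, exists s1, forall s t, s <= s1 -> u (s, t) <= B;
  strip_low : exists c0, forall t, c0 <= u (S0, t);
  strip_vmax : forall p q c d B : R, p <= q -> q < S0 -> c <= d ->
    (forall z, rect_boundary p q c d z -> v z <= B) -> forall s t, p <= s <= q -> c <= t <= d -> v (s, t) <= B;
  strip_vmin : forall p q c d B : R, p <= q -> q < S0 -> c <= d ->
    (forall z, rect_boundary p q c d z -> B <= v z) -> forall s t, p <= s <= q -> c <= t <= d -> B <= v (s, t) }.

(** The strip is extended to the left until u < m - 1 and to the right up to
    S0, where u > M + 1, with a margin of 1 for the approximation error. The
    energy bound then applies, and its right-hand side does not see the length
    of the extension. *)
Lemma approx_energy (K S0 : R) (u v : R * R -> R) (a b m M e : R) : strip_map K S0 u v -> a <= b -> b < S0 -> m <= M -> 0 < e -> e <= 1 ->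
  (forall t, M + 2 <= u (S0, t)) ->
  exists U Us Ut V Vs Vt : R * R -> R,
  [/\ C1 U Us Ut, C1 V Vs Vt, (forall s t, V (s, t + T) = V (s, t) + T),
    (forall s t, a <= s <= b -> `|U (s, t) - u (s, t)| <= e /\ `|V (s, t) - v (s, t)| <= e) &
    dint a b 0 T (fun z => trap m M (U z) * energy Us Ut Vs Vt z) <= K * T * (M - m + 2) + 1].
Proof.
move=> [K0 approx vper Tmin Tmax Tinf Tlow TVmax TVmin] ab bS mM e0 e1 hM; have T1 := two_pi_ge1.
have [s1 hs1] := Tinf (m - 2).
pose a' := Num.min a s1 - 1.
have ma : Num.min a s1 <= a by rewrite ge_min lexx.
have ms : Num.min a s1 <= s1 by rewrite ge_min lexx orbT.
have aa : a' <= a by rewrite /a'; clear -ma; lra.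
have as1 : a' <= s1 by rewrite /a'; clear -ms; lra.
have aS : a' < S0 by apply: (le_lt_trans aa); apply: (le_lt_trans ab).
have [U [Us [Ut [V [Vs [Vt [E [[CU CV cE E0 hE] [pU pV hUV]]]]]]]]] := approx _ _ _ aS (lexx _) e0.
exists U, Us, Ut, V, Vs, Vt.
have [cU cUs cUt dUs dUt] := CU; have [cV cVs cVt dVs dVt] := CV.
have ct := @trap_cont _ m M.
have cen : continuous (energy Us Ut Vs Vt) by exact: energy_cont.
split => // [s t /andP[sa sb]|].
  have [] := hUV s t => //.
  by rewrite (le_trans aa sa) /=; apply: (le_trans sb); exact: ltW.
have en0 z : 0 <= trap m M (U z) * energy Us Ut Vs Vt z.
  by apply: mulr_ge0; [exact: trap_ge0|rewrite /energy !addr_ge0// sqr_ge0].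
apply: (@le_trans _ _ (dint a' S0 0 T (fun z => trap m M (U z) * energy Us Ut Vs Vt z))).
  by apply: le_dint_sub => //; [by cts|exact: ltW|lra].
apply: le_trans (_ : K * T * (M - m + 2) + dint a' S0 0 T E <= _); last first.
  by rewrite lerD2l (le_trans hE).
apply: (energy_bound (ltW K0) (ltW aS) mM CU CV cE E0 pU pV).
- by move=> s t h; have [] := hUV s t h.
- move=> t; have [|h _ _] := hUV a' t; first by rewrite lexx ltW.
  have := hs1 a' t as1; move: h; rewrite ler_norml; clear -e1; lra.
- move=> t; have [|h _ _] := hUV S0 t; first by rewrite lexx ltW.
  have := hM t; move: h; rewrite ler_norml; clear -e1; lra.
Qed.

(** Let m and M be values of u on the circles s0 - 2 and s0 + 2. By
    monotonicity, every circle s in [s0 - 4, s0 - 3] has a point with u <= m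
    and every circle s + 7 has a point with u >= M. Coordinate paths between
    such points show that, up to a constant, M - m is at most the average
    length, hence at most of the order of the square root of the energy; and
    the energy between the levels m and M is at most of the order of M - m. So
    M - m is bounded. *)
Lemma osc_u (K S0 : R) (u v : R * R -> R) : strip_map K S0 u v -> exists C S1 : R, [/\ S1 <= S0 - 10, 0 <= C,
  (forall s1 s2 t1 t2 s0, s0 <= S1 -> s0 - 2 <= s1 <= s0 + 2 -> s0 - 2 <= s2 <= s0 + 2 ->
    u (s1, t1) - u (s2, t2) <= C) &
  forall s t, s <= S1 + 5 -> exists2 c0, (forall t', c0 <= u (S0, t')) & u (s, t) <= c0 - 100 - 2 * C].
Proof.
move=> hyp; have [K0 approx vper Tmin Tmax Tinf Tlow TVmax TVmin] := hyp.
have T1 := two_pi_ge1.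
have [c0 hc0] := Tlow.
pose C := 6 + (T * K)^-1 + 16 * T ^+ 2 * K.
have TK : 0 < (T * K)^-1 by rewrite invr_gt0 mulr_gt0//; clear -T1; lra.
have TK2 : 0 <= 16 * T ^+ 2 * K by rewrite !mulr_ge0//; clear -T1 K0; lra.
have C6 : 6 <= C by rewrite /C; clear -TK TK2; lra.
have [s1 hs1] := Tinf (c0 - 100 - 2 * C).
(* all circles used below have s <= s0 + 5 < s1, where u stays below u (S0, t)
   by the margin 100 + 2 C *)
pose S1 := Num.min s1 S0 - 10.
have m1 : Num.min s1 S0 <= s1 by rewrite ge_min lexx.
have m2 : Num.min s1 S0 <= S0 by rewrite ge_min lexx orbT.
have S1s : S1 + 5 <= s1 by rewrite /S1; clear -m1; lra.
have S1S : S1 <= S0 - 10 by rewrite /S1; clear -m2; lra.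
exists C, S1; split => //; [by clear -C6; lra| |]; last first.
  by move=> s t hs; exists c0 => //; apply: hs1; clear -hs S1s; lra.
have core s0 t1 t2 : s0 <= S1 -> u (s0 + 2, t1) - u (s0 - 2, t2) <= C.
  move=> hs0; set M := u (s0 + 2, t1); set m := u (s0 - 2, t2).
  have [M4|M4] := leP (M - m) 4; first by clear -C6 M4; lra.
  have mM : m <= M by clear -M4; lra.
  have [U [Us [Ut [V [Vs [Vt [CU CV pV hUV hE]]]]]]] :
    exists U Us Ut V Vs Vt : R * R -> R,
    [/\ C1 U Us Ut, C1 V Vs Vt, (forall s t, V (s, t + T) = V (s, t) + T),
    (forall s t, s0 - 4 <= s <= s0 + 4 -> `|U (s, t) - u (s, t)| <= 1 /\ `|V (s, t) - v (s, t)| <= 1) &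
    dint (s0 - 4) (s0 + 4) 0 T (fun z => trap m M (U z) * energy Us Ut Vs Vt z) <= K * T * (M - m + 2) + 1].
    apply: (approx_energy hyp) => //; [by clear; lra|by clear -hs0 S1S; lra|].
    move=> t; apply: le_trans (hc0 t).
    have : M <= c0 - 100 - 2 * C by apply: hs1; clear -hs0 S1s; lra.
    by clear -C6; lra.
  have [cU cUs cUt dUs dUt] := CU; have [cV cVs cVt dVs dVt] := CV.
  have ct := @trap_cont _ m M.
  have cr : continuous (ramp m M) by exact: is_prim_cont (@ramp_prim _ m M).
  have cen : continuous (energy Us Ut Vs Vt) by exact: energy_cont.
  pose w z := ramp m M (U z); pose ws z := trap m M (U z) * Us z; pose wt z := trap m M (U z) * Ut z.
  have [cw cws cwt dws dwt] : C1 w ws wt.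
    split; rewrite /w /ws /wt; [by cts..| |] => x y.
    - exact: (der_comp (g := fun t => U (t, y)) (ramp_prim _ _ _) (dUs x y)).
    - exact: (der_comp (g := fun t => U (x, t)) (ramp_prim _ _ _) (dUt x y)).
  pose A s := oint 0 T (fun t => `|wt (s, t)|).
  have cA : continuous A by apply: (cont_inner (g := fun z => `|wt z|)); cts.
  have A0 s : 0 <= A s.
    have -> : 0 = oint 0 T (fun=> 0) by rewrite oint_cst mul0r.
    by apply: le_oint => //; [cts|cts|clear -T1; lra].
  have key th : 0 <= th <= T -> M - m - 2 <= oint (s0 - 4) (s0 + 4) A + oint (s0 - 4) (s0 + 4) (fun s => `|ws (s, th)|).
    move=> hth; apply: (@pair_average _ A _ _ _ _ 7) => //; [by clear; lra|by clear; lra|].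
    move=> s hs.
    have [t ht ut] : exists2 t, 0 <= t <= T & u (s, t) <= m.
      by apply: Tmin; clear -hs hs0 S1S; lra.
    have [t' ht' ut'] : exists2 t', 0 <= t' <= T & M <= u (s + 7, t').
      by apply: Tmax; clear -hs hs0 S1S; lra.
    have w1 : w (s, t) <= ramp m M (m + 1).
      apply: ramp_le; have [|k _] := hUV s t; first by clear -hs; lra.
      by move: k; rewrite ler_norml; clear -ut; lra.
    have w2 : ramp m M (M - 1) <= w (s + 7, t').
      apply: ramp_le; have [|k _] := hUV (s + 7) t'; first by clear -hs; lra.
      by move: k; rewrite ler_norml; clear -ut'; lra.
    have w3 : ramp m M (M - 1) - ramp m M (m + 1) = M - 1 - (m + 1) by apply: ramp_id; clear -M4; lra.
    have v1 := var_t s cwt dwt ht hth.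
    have v2 := var_t (s + 7) cwt dwt hth ht'.
    have v3 : w (s + 7, th) - w (s, th) <= oint (s0 - 4) (s0 + 4) (fun s => `|ws (s, th)|).
      by apply: var_s => //; clear -hs; lra.
    rewrite -/(A s) in v1; rewrite -/(A (s + 7)) in v2.
    clear -w1 w2 w3 v1 v2 v3; lra.
  have caw : continuous (fun z => `|ws z|) by cts.
  have s04 : s0 - 4 <= s0 + 4 by clear; lra.
  have key2 := theta_average caw s04 key.
  (* at this rate the energy contributes (M - m) / 2 plus a constant, which is
     absorbed by the left-hand side *)
  have l0 : 0 < (2 * T * K)^-1 by rewrite invr_gt0 !mulr_gt0//; clear -T1; lra.
  have key3 := dint_sq_le l0 s04 (h := fun z => trap m M (U z)) (f := Ut) (g := Us) (E := energy Us Ut Vs Vt).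
  have {}key3 := key3 ltac:(by cts) cUt cUs cen _ _.
  have {}key3 := key3 (fun z => introT andP (conj (trap_ge0 _ _ _) (trap_le1 _ _ _))) (energy_ge_t _ _ _ _).
  have E1 : (2 * T * K)^-1 * (K * T * (M - m + 2) + 1) = (M - m + 2) / 2 + (T * K)^-1 / 2.
    by field; apply/andP; split; clear -T1 K0; lra.
  have E2 : (2 * (2 * T * K)^-1)^-1 * (s0 + 4 - (s0 - 4)) * T = 8 * T ^+ 2 * K.
    by field; apply/andP; split; clear -T1 K0; lra.
  have hm := ler_wpM2l (ltW l0) hE.
  rewrite E1 in hm; rewrite E2 in key3.
  have D0 : 0 <= dint (s0 - 4) (s0 + 4) 0 T (fun z => `|ws z|).
    by apply: dint_ge0 => //; clear -T1; lra.
  move: D0 key2 key3 hm; rewrite /C -/(ws _) /ws /wt.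
  rewrite -[oint _ _ A]/(dint (s0 - 4) (s0 + 4) 0 T (fun z => `|wt z|)).
  rewrite /wt /ws.
  set D1 := dint _ _ _ _ (fun z => `|trap m M (U z) * Us z|).
  set D2 := dint _ _ _ _ (fun z => `|trap m M (U z) * Ut z|).
  set X := (_ * dint _ _ _ _ _) => D0 k2 k3 k4.
  have k5 : T * (M - m - 2) <= T * (D2 + D1).
    apply: (le_trans k2); rewrite [leRHS]mulrDr lerD2l; rewrite -[leLHS]mul1r; exact: ler_wpM2r.
  rewrite ler_pM2l in k5; last by clear -T1; lra.
  clear -k5 k3 k4; lra.
move=> s1' s2' t1 t2 s0 hs0 h1 h2.
have [t1' u1] : exists t, u (s1', t1) <= u (s0 + 2, t).
  have [->|ne] := eqVneq s1' (s0 + 2); first by exists t1.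
  have lt1 : s1' < s0 + 2 by rewrite lt_neqAle ne; case/andP: h1.
  by have [|t _ ?] := Tmax _ _ t1 lt1; [clear -hs0 S1S; lra|exists t].
have [t2' u2] : exists t, u (s0 - 2, t) <= u (s2', t2).
  have [->|ne] := eqVneq s2' (s0 - 2); first by exists t2.
  have lt2 : s0 - 2 < s2' by rewrite lt_neqAle eq_sym ne; case/andP: h2.
  by have [|t _ ?] := Tmin _ _ t2 lt2; [clear -hs0 S1S h2; lra|exists t].
have := core s0 t1' t2' hs0; clear -u1 u2; lra.
Qed.

Lemma oint_per3 (f : R -> R) (a : R) : continuous f -> (forall t, f (t + T) = f t) ->
  oint a (a + 3 * T) f = 3 * oint 0 T f.
Proof.
move=> cf fp.
have e1 := oint_periodic a cf fp; have e2 := oint_periodic (a + T) cf fp.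
have e3 := oint_periodic (a + T + T) cf fp.
rewrite -(oint_cat a (a + T) (a + 3 * T))// -(oint_cat (a + T) (a + T + T) (a + 3 * T))//.
have -> : a + 3 * T = a + T + T + T by ring.
by rewrite e1 e2 e3; ring.
Qed.

(** By the maximum principle, v on the circle s0 oscillates no more than on
    the boundary of a rectangle around it. The boundary length of [s, s + 3] x
    [th, th + 3 T] is averaged over s in [s0 - 2, s0 - 1] and th in [0, T].
    The energy there is bounded because u varies by a bounded amount on the
    annulus. *)
Lemma osc_v (K S0 : R) (u v : R * R -> R) : strip_map K S0 u v -> exists C S1 : R, [/\ S1 <= S0 - 10, 0 <= C &
  forall s0 t t', s0 <= S1 -> 0 <= t <= T -> 0 <= t' <= T -> v (s0, t) - v (s0, t') <= C].
Proof.
move=> hyp; have [K0 approx vper Tmin Tmax Tinf Tlow TVmax TVmin] := hyp.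
have T1 := two_pi_ge1.
have [Cu [S1 [S1S Cu0 hu hlow]]] := osc_u hyp.
pose X0 := K * T * (2 * Cu + 4) + 1.
have X00 : 0 <= X0 by rewrite /X0 addr_ge0// mulr_ge0// ?mulr_ge0//; clear -T1 K0 Cu0; lra.
exists (2 + 6 * (X0 + 2 * T)), S1; split => //; first by clear -X00 T1; lra.
move=> s0 t t' hs0 ht ht'.
(* the plateau contains all values of the approximation of u on the annulus *)
pose m := u (s0, 0) - Cu - 1; pose M := u (s0, 0) + Cu + 1.
have [U [Us [Ut [V [Vs [Vt [CU CV pV hUV hE]]]]]]] :
    exists U Us Ut V Vs Vt : R * R -> R,
    [/\ C1 U Us Ut, C1 V Vs Vt, (forall s t, V (s, t + T) = V (s, t) + T),
    (forall s t, s0 - 2 <= s <= s0 + 2 -> `|U (s, t) - u (s, t)| <= 1 /\ `|V (s, t) - v (s, t)| <= 1) &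
    dint (s0 - 2) (s0 + 2) 0 T (fun z => trap m M (U z) * energy Us Ut Vs Vt z) <= K * T * (M - m + 2) + 1].
  apply: (approx_energy hyp) => //; [by clear; lra|by clear -hs0 S1S; lra|by rewrite /m /M; clear -Cu0; lra|].
  move=> x; have [|c0 hc0 hcu] := hlow s0 0; first by clear -hs0; lra.
  by apply: le_trans (hc0 x); rewrite /M; clear -hcu Cu0; lra.
have [cU cUs cUt dUs dUt] := CU; have [cV cVs cVt dVs dVt] := CV.
have ct := @trap_cont _ m M.
have cen : continuous (energy Us Ut Vs Vt) by exact: energy_cont.
have pVs s x : Vs (s, x + T) = Vs (s, x) by exact: (periodic_der _ _ dVs pV).
have pVt s x : Vt (s, x + T) = Vt (s, x).
  have h1 : is_derive x 1 (fun x : R => x + T) 1 by der; ring.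
  have h2 := der_comp (g := fun x : R => x + T) (dVt s (x + T)) h1.
  have h3 : is_derive x 1 (fun y => V (s, y + T)) (Vt (s, x)).
    rewrite (_ : (fun y => _) = fun y => V (s, y) + T); last by apply/funext => y; rewrite pV.
    by have ? := dVt s x; der; ring.
  by rewrite -(@derive_val _ _ _ _ _ _ _ h3) (@derive_val _ _ _ _ _ _ _ h2) mulr1.
have s02 : s0 - 2 <= s0 + 2 by clear; lra.
have {}hE : dint (s0 - 2) (s0 + 2) 0 T (fun z => 1 * energy Us Ut Vs Vt z) <= X0.
  apply: (@le_trans _ _ (dint (s0 - 2) (s0 + 2) 0 T (fun z => trap m M (U z) * energy Us Ut Vs Vt z))).
    apply: le_dint => //; [by cts|by cts|by clear -T1; lra|].
    move=> s x hs _; rewrite trap1// /m /M.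
    have [k _] := hUV s x hs.
    have s00 : s0 - 2 <= s0 <= s0 + 2 by clear; lra.
    have k1 := hu s s0 x 0 s0 hs0 hs s00; have k2 := hu s0 s 0 x s0 hs0 s00 hs.
    by move: k; rewrite ler_norml; clear -k1 k2; lra.
  by apply: (le_trans hE); rewrite /X0 /m /M; rewrite le_eqVlt; apply/orP; left; apply/eqP; ring.
pose A s := oint 0 T (fun y => `|Vt (s, y)|).
have cA : continuous A by apply: (cont_inner (g := fun z => `|Vt z|)); cts.
have A0 s : 0 <= A s.
  have -> : 0 = oint 0 T (fun=> 0) by rewrite oint_cst mul0r.
  by apply: le_oint => //; [cts|cts|clear -T1; lra].
have A3 s a : oint a (a + 3 * T) (fun y => `|Vt (s, y)|) = 3 * A s.
  by apply: oint_per3 => [|y]; [cts|rewrite pVt].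
pose L := (v (s0, t) - v (s0, t') - 2) / 2.
have key th : 0 <= th <= T -> L <= 3 * oint (s0 - 2) (s0 + 2) A + oint (s0 - 2) (s0 + 2) (fun s => `|Vs (s, th)|).
  move=> hth; set B := oint _ _ (fun s => `|Vs (s, th)|).
  have B0 : 0 <= B.
    have -> : 0 = oint (s0 - 2) (s0 + 2) (fun=> 0) by rewrite oint_cst mul0r.
    by apply: le_oint => //; cts.
  rewrite /B -ointZ//; apply: (@pair_average _ (fun s => 3 * A s) _ _ _ _ 3); [by cts| | by clear; lra|by clear; lra|].
    by move=> s; rewrite mulr_ge0.
  move=> s hs.
  (* V gains 3 T from the bottom to the top edge, so both edges give the same
     radial variation *)
  have per3 x y : V (x, y + 3 * T) = V (x, y) + 3 * T.
    by rewrite (_ : y + 3 * T = y + T + T + T) ?pV; ring.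
  pose D := 3 * A s + 3 * A (s + 3) + B.
  have bd z : rect_boundary s (s + 3) th (th + 3 * T) z -> `|V z - V (s, th)| <= D.
    case: z => x y [/= hx hy hxy].
    have hxx : s0 - 2 <= x <= s0 + 2 by clear -hx hs; lra.
    have hss : s0 - 2 <= s <= s0 + 2 by clear -hs; lra.
    have hs3 : s0 - 2 <= s + 3 <= s0 + 2 by clear -hs; lra.
    have hth2 : th <= th <= th + 3 * T by clear -T1; lra.
    have hth3 : th <= th + 3 * T <= th + 3 * T by clear -T1; lra.
    have A1 := A0 s; have A2 := A0 (s + 3).
    have vs a : th = a \/ th + 3 * T = a -> `|V (x, a) - V (s, a)| <= B.
      have vv (e : R) : `|V (x, e) - V (s, e)| <= oint (s0 - 2) (s0 + 2) (fun x => `|Vs (x, e)|).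
        by rewrite ler_norml lerNl opprB; apply/andP; split; apply: var_s.
      case=> <-; first exact: vv.
      have := vv th; rewrite !per3; rewrite (_ : V (x, th) + 3 * T - (V (s, th) + 3 * T) = V (x, th) - V (s, th)); last by ring.
      by [].
    have vt a : `|V (a, y) - V (a, th)| <= 3 * A a.
      by rewrite -(A3 a th) ler_norml lerNl opprB; apply/andP; split; apply: var_t.
    have vt3 : `|V (s, th + 3 * T) - V (s, th)| <= 3 * A s.
      by rewrite -(A3 s th) ler_norml lerNl opprB; apply/andP; split; apply: var_t.
    rewrite /D; case: hxy => [exs|exs|eyt|eyt].
    - have := vt s; rewrite exs; clear -B0 A2; rewrite !ler_norml; lra.
    - have := vs _ (or_introl erefl); have := vt (s + 3); rewrite exs; clear -B0 A1; rewrite !ler_norml; lra.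
    - have := vs th (or_introl erefl); rewrite eyt; clear -A1 A2; rewrite !ler_norml; lra.
    - have := vs _ (or_intror erefl); rewrite eyt; move: vt3; clear -A1 A2; rewrite !ler_norml; lra.
  have bv z : rect_boundary s (s + 3) th (th + 3 * T) z -> V (s, th) - D - 1 <= v z <= V (s, th) + D + 1.
    case: z => x y hz; have := bd _ hz; case: hz => /= hx hy _.
    have [|_] := hUV x y; first by clear -hx hs; lra.
    by rewrite !ler_norml; clear; lra.
  have ss3 : s <= s + 3 by clear; lra.
  have sS : s + 3 < S0 by clear -hs hs0 S1S; lra.
  have tt3 : th <= th + 3 * T by clear -T1; lra.
  have i1 : s <= s0 <= s + 3 by clear -hs; lra.
  have i2 : th <= t + T <= th + 3 * T by clear -ht hth; lra.
  have i3 : th <= t' + T <= th + 3 * T by clear -ht' hth; lra.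
  (* t and t' are shifted by one period, to [T, 2 T], which lies in [th, th +
     3 T] for all th in [0, T] *)
  have w1 := TVmax _ _ _ _ _ ss3 sS tt3 (fun z hz => proj2 (andP (bv z hz))) _ _ i1 i2.
  have w2 := TVmin _ _ _ _ _ ss3 sS tt3 (fun z hz => proj1 (andP (bv z hz))) _ _ i1 i3.
  have s0S : s0 <= S0 by clear -hs0 S1S; lra.
  rewrite !vper// in w1 w2; rewrite -/B; rewrite /L; move: w1 w2; rewrite /D; clear; lra.
have caw : continuous (fun z => `|Vs z|) by cts.
have key2 := theta_average caw s02 key.
have key3 := dint_sq_le ltr01 s02 (h := fun=> 1) (f := Vt) (g := Vs) (E := energy Us Ut Vs Vt).
have {}key3 := key3 ltac:(by cts) cVt cVs cen _ (energy_ge_s _ _ _ _).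
have {}key3 := key3 (fun z => introT andP (conj ler01 (lexx 1))).
have D0 : 0 <= dint (s0 - 2) (s0 + 2) 0 T (fun z => `|Vs z|).
  by apply: dint_ge0 => //; clear -T1; lra.
move: D0 key2 key3 hE.
rewrite -[oint _ _ A]/(dint (s0 - 2) (s0 + 2) 0 T (fun z => `|Vt z|)).
have -> : (fun z => `|1 * Vt z|) = (fun z => `|Vt z|) by apply/funext => z; rewrite mul1r.
have -> : (fun z => `|1 * Vs z|) = (fun z => `|Vs z|) by apply/funext => z; rewrite mul1r.
set D1 := dint _ _ _ _ (fun z => `|Vs z|).
set D2 := dint _ _ _ _ (fun z => `|Vt z|).
set X := dint _ _ _ _ _ => D10 k2 k3 k4.
have k5 : T * L <= T * (3 * D2 + 3 * D1).
  apply: (le_trans k2); rewrite [leRHS]mulrDr lerD2l.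
  by apply: (@le_trans _ _ (1 * (3 * D1))); [clear -D10; lra|apply: ler_wpM2r => //; clear -D10; lra].
rewrite ler_pM2l in k5; last by clear -T1; lra.
have k6 : (2 * 1)^-1 * (s0 + 2 - (s0 - 2)) * T = 2 * T by field.
rewrite k6 mul1r in k3.
move: k5; rewrite /L; clear -k3 k4; lra.
Qed.

(** The energy of a <= s <= b is bounded below by a linear expression in the
    gradient, whose integral is computed from boundary values, and above by
    the energy bound with a plateau just wide enough to contain the values of
    u. The oscillation bounds replace circle averages by values on the radius
    t = 0. *)
Lemma strip_bound (K S0 al be : R) (u v : R * R -> R) : strip_map K S0 u v -> exists C b : R, b <= S0 /\
  forall a, a < b ->
  2 * al * (u (b, 0) - u (a, 0)) + 2 * be * (v (b, 0) - v (a, 0)) + 2 * (b - a) - (al ^+ 2 + be ^+ 2 + 1) * (b - a)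
  <= K * (u (b, 0) - u (a, 0)) + C.
Proof.
move=> hyp; have [K0 approx vper Tmin Tmax Tinf Tlow TVmax TVmin] := hyp.
have T1 := two_pi_ge1.
have [Cu [S1 [S1S Cu0 hu hlow]]] := osc_u hyp.
have [Cv [S2 [S2S Cv0 hv]]] := osc_v hyp.
pose b := Num.min S1 S2.
have bS1 : b <= S1 by rewrite ge_min lexx.
have bS2 : b <= S2 by rewrite ge_min lexx orbT.
exists (K * (2 * Cu + 4) + 1 + 2 * `|al| * (2 * Cu + 2) + 2 * `|be| * (2 * Cv + 2)), b.
split; first by clear -bS1 S1S; lra.
move=> a ab.
have own (s : R) : s - 2 <= s <= s + 2 by clear; lra.
have ou s t t' : s <= b -> u (s, t) - u (s, t') <= Cu.
  by move=> sb; apply: (hu _ _ _ _ s) => //; exact: (le_trans sb).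
pose m := u (a, 0) - Cu - 1; pose M := u (b, 0) + Cu + 1.
have lo s t : a <= s <= b -> u (a, 0) - Cu <= u (s, t).
  move=> /andP[]; rewrite le_eqVlt => /orP[/eqP <- _|as_ sb].
    by have := ou a 0 t (ltW ab); clear; lra.
  have [|x _ hx] := Tmin _ _ t as_; first by clear -sb bS1 S1S; lra.
  by have := ou a 0 x (ltW ab); clear -hx; lra.
have hi s t : a <= s <= b -> u (s, t) <= u (b, 0) + Cu.
  move=> /andP[as_]; rewrite le_eqVlt => /orP[/eqP ->|sb].
    by have := ou b t 0 (lexx _); clear; lra.
  have [|x _ hx] := Tmax _ _ t sb; first by clear -bS1 S1S; lra.
  by have := ou b x 0 (lexx _); clear -hx; lra.
have mM : m <= M.
  have aab : a <= a <= b by rewrite lexx ltW.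
  by have := hi a 0 aab; rewrite /m /M; clear -Cu0; lra.
have [U [Us [Ut [V [Vs [Vt [CU CV pV hUV hE]]]]]]] :
    exists U Us Ut V Vs Vt : R * R -> R,
    [/\ C1 U Us Ut, C1 V Vs Vt, (forall s t, V (s, t + T) = V (s, t) + T),
    (forall s t, a <= s <= b -> `|U (s, t) - u (s, t)| <= 1 /\ `|V (s, t) - v (s, t)| <= 1) &
    dint a b 0 T (fun z => trap m M (U z) * energy Us Ut Vs Vt z) <= K * T * (M - m + 2) + 1].
  apply: (approx_energy hyp) => //; [exact: ltW|by clear -bS1 S1S; lra|].
  move=> x; have [|c0 hc0 hcu] := hlow b 0; first by clear -bS1; lra.
  by apply: le_trans (hc0 x); rewrite /M; clear -hcu Cu0; lra.
have [cU cUs cUt dUs dUt] := CU; have [cV cVs cVt dVs dVt] := CV.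
have ct := @trap_cont _ m M.
have cen : continuous (energy Us Ut Vs Vt) by exact: energy_cont.
have ab' := ltW ab.
have T0 : 0 <= T by clear -T1; lra.
have pt : dint a b 0 T (fun z => 2 * al * Us z + (2 * be * Vs z + (2 * Vt z + - (al ^+ 2 + be ^+ 2 + 1)))) <= K * T * (M - m + 2) + 1.
  apply: le_trans hE; apply: le_dint => //; [by cts|by cts|].
  move=> s t hs _; rewrite trap1.
    rewrite mul1r /energy.
    (* squares are bounded below by their tangents at al, be and 1; the slope
       1 is that of the model argument v = be s + t *)
    have := sqr_ge0 (Us (s, t) - al); have := sqr_ge0 (Vs (s, t) - be); have := sqr_ge0 (Vt (s, t) - 1); have := sqr_ge0 (Ut (s, t)).
    rewrite !sqrrB expr1n; clear; lra.
  have [k _] := hUV s t hs; have := lo s t hs; have := hi s t hs.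
  by move: k; rewrite ler_norml /m /M; clear; lra.
rewrite dintD in pt; [|by cts..]. rewrite dintD in pt; [|by cts..]. rewrite dintD in pt; [|by cts..].
rewrite !dintZ// dint_cst in pt.
have iVt : dint a b 0 T Vt = T * (b - a).
  rewrite /dint; have -> : (fun s => oint 0 T (fun t => Vt (s, t))) = (fun=> T).
    by apply/funext => s; rewrite (ftc_t _ _ _ cVt dVt); have := pV s 0; rewrite add0r => ->; ring.
  by rewrite oint_cst.
have avg (g gs : R * R -> R) (c k : R) : continuous gs -> continuous g ->
    (forall s t : R, is_derive s 1 (fun x => g (x, t)) (gs (s, t))) ->
    (forall t, 0 <= t <= T -> `|g (b, t) - g (a, t) - c| <= k) -> `|dint a b 0 T gs - T * c| <= T * k.
  move=> cgs cg dg hk; rewrite dintC//.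
  have -> : (fun t => oint a b (fun s => gs (s, t))) = (fun t => g (b, t) - g (a, t)).
    by apply/funext => t; rewrite (ftc_s _ _ _ cgs dg).
  have k1 : oint 0 T (fun t => g (b, t) - g (a, t)) <= oint 0 T (fun=> c + k).
    by apply: le_oint => //; [cts|cts|move=> t /hk; rewrite ler_norml; clear; lra].
  have k2 : oint 0 T (fun=> c - k) <= oint 0 T (fun t => g (b, t) - g (a, t)).
    by apply: le_oint => //; [cts|cts|move=> t /hk; rewrite ler_norml; clear; lra].
  by move: k1 k2; rewrite !oint_cst ler_norml; clear; lra.
have aa : a <= a <= b by rewrite lexx.
have bb : a <= b <= b by rewrite lexx andbT.
have tt : (0 : R) <= 0 <= T by apply/andP.
have jU : `|dint a b 0 T Us - T * (u (b, 0) - u (a, 0))| <= T * (2 * Cu + 2).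
  apply: (avg U) => // t ht.
  have [k1 _] := hUV a t aa; have [k2 _] := hUV b t bb.
  have := ou a t 0 ab'; have := ou a 0 t ab'; have := ou b t 0 (lexx _); have := ou b 0 t (lexx _).
  by move: k1 k2; rewrite !ler_norml; clear; lra.
have jV : `|dint a b 0 T Vs - T * (v (b, 0) - v (a, 0))| <= T * (2 * Cv + 2).
  apply: (avg V) => // t ht.
  have [_ k1] := hUV a t aa; have [_ k2] := hUV b t bb.
  have aS2 : a <= S2 by apply: (le_trans ab').
  have := hv a t 0 aS2 ht tt; have := hv a 0 t aS2 tt ht; have := hv b t 0 bS2 ht tt; have := hv b 0 t bS2 tt ht.
  by move: k1 k2; rewrite !ler_norml; clear; lra.
have nrm (x y z k : R) : `|y - T * z| <= T * k -> 2 * x * T * z - 2 * `|x| * T * k <= 2 * x * y.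
  move=> h; have : `|2 * x * (y - T * z)| <= 2 * `|x| * (T * k).
    by rewrite !normrM (ger0_norm (_ : 0 <= 2)) ?ler_wpM2l ?mulr_ge0// ler0n.
  by rewrite ler_norml; clear; lra.
have {}jU := nrm al _ _ _ jU; have {}jV := nrm be _ _ _ jV.
rewrite iVt /m /M in pt.
move: pt jU jV.
set I1 := dint _ _ _ _ Us; set I2 := dint _ _ _ _ Vs.
set du := u (b, 0) - u (a, 0); set dv := v (b, 0) - v (a, 0); set d := b - a => pt jU jV.
have edu : u (b, 0) + Cu + 1 - (u (a, 0) - Cu - 1) = du + 2 * Cu + 2 by rewrite /du; ring.
rewrite edu in pt.
have tot : T * (2 * al * du + 2 * be * dv + 2 * d - (al ^+ 2 + be ^+ 2 + 1) * d) <=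
  T * (K * du + (K * (2 * Cu + 4) + 1 + 2 * `|al| * (2 * Cu + 2) + 2 * `|be| * (2 * Cv + 2))).
  move: (al ^+ 2 + be ^+ 2 + 1) pt => q pt; move: pt jU jV T1; move: T => P; clear; lra.
by rewrite ler_pM2l in tot; last by clear -T1; lra.
Qed.

End Strip.

(** * Continuous arguments *)

Section Angles.
Context {R : realType}.
Implicit Types (c d : R * R) (v w : R).
Local Notation T := (2 * pi : R).

Definition is_arg c v := c.1 = modulus c * cos v /\ c.2 = modulus c * sin v.
Definition dot c d := c.1 * d.1 + c.2 * d.2.
Definition cross c d := c.1 * d.2 - c.2 * d.1.

Lemma modulus_ge0 c : 0 <= modulus c.
Proof. exact: sqrtr_ge0. Qed.

Lemma sqr_modulus c : modulus c ^+ 2 = c.1 ^+ 2 + c.2 ^+ 2.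
Proof. by rewrite sqr_sqrtr// addr_ge0// sqr_ge0. Qed.

Lemma modulus_gt0 c : c != 0 -> 0 < modulus c.
Proof.
move=> c0; rewrite lt_neqAle modulus_ge0 andbT eq_sym; apply: contra c0 => /eqP m0.
have := sqr_modulus c; rewrite m0 expr0n /= => /esym/eqP.
rewrite paddr_eq0 ?sqr_ge0// !sqrf_eq0 => /andP[/eqP h1 /eqP h2].
by apply/eqP; case: c h1 h2 {m0} => x y /= -> ->.
Qed.

Lemma modulus_cont : continuous (@modulus R).
Proof.
apply: (@cont_comp _ _ _ (@Num.sqrt R) (fun z : R * R => z.1 ^+ 2 + z.2 ^+ 2)); last by cts.
exact: sqrt_continuous.
Qed.

Lemma within_comp_cont {X U V : topologicalType} (A : set U) (f : U -> V) (cl : X -> U) :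
  continuous cl -> (forall x, A (cl x)) -> {within A, continuous f} -> continuous (fun x => f (cl x)).
Proof.
move=> ccl Acl /subspace_continuousP cf x.
have h := cf _ (Acl x).
apply: (@cvg_comp _ _ _ cl f _ (within A (nbhs (cl x))) _ _ h).
move=> P /= hP; have := ccl x _ hP; rewrite /nbhs /= => h2.
by apply: filterS h2 => y; apply; exact: Acl.
Qed.

Lemma cos1_eq0 v : `|v| <= pi -> cos v = 1 -> v = 0.
Proof.
move=> h; rewrite -cos_norm -cos0 => /cos_inj h0.
by apply/eqP; rewrite -normr_eq0 h0// in_itv/= ?lexx ?pi_ge0// normr_ge0.
Qed.

(** The condition cos (v - w) = 1 is the form in which equality modulo 2 pi is
    used. *)
Lemma is_arg_cos c v w : 0 < modulus c -> is_arg c v -> is_arg c w -> cos (v - w) = 1.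
Proof.
move=> c0 [h1 h2] [h3 h4]; have c1 : modulus c != 0 by rewrite gt_eqF.
have cv : cos v = c.1 / modulus c by rewrite {1}h1 mulrC mulrA mulVf ?mul1r.
have cw : cos w = c.1 / modulus c by rewrite {1}h3 mulrC mulrA mulVf ?mul1r.
have sv : sin v = c.2 / modulus c by rewrite {1}h2 mulrC mulrA mulVf ?mul1r.
have sw : sin w = c.2 / modulus c by rewrite {1}h4 mulrC mulrA mulVf ?mul1r.
rewrite cosB -(cos2Dsin2 v) cv cw sv sw; ring.
Qed.

Lemma is_arg_close c v w : 0 < modulus c -> is_arg c v -> is_arg c w -> `|v - w| <= pi -> v = w.
Proof.
move=> c0 h1 h2 h; apply/eqP; rewrite -subr_eq0; apply/eqP.
by apply: cos1_eq0 => //; exact: is_arg_cos h1 h2.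
Qed.

Lemma dot_cross c d : dot c d ^+ 2 + cross c d ^+ 2 = (modulus c * modulus d) ^+ 2.
Proof. by rewrite exprMn !sqr_modulus /dot /cross; ring. Qed.

Lemma sin_atan (x : R) : sin (atan x) = x * cos (atan x).
Proof.
have := atan_def x => -[h1 h2]; rewrite -{2}h2 /tan divfK// gt_eqF//.
exact: cos_gt0_pihalf.
Qed.

(** The angle between vectors of positive inner product is the arctangent of
    cross / dot. *)
Lemma is_arg_shift c d v : 0 < dot c d -> is_arg c v -> is_arg d (v + atan (cross c d / dot c d)).
Proof.
move=> h [h1 h2].
have m0 : 0 < modulus c * modulus d.
  rewrite lt_neqAle mulr_ge0 ?modulus_ge0// andbT eq_sym; apply/eqP => m0.
  have := dot_cross c d; rewrite m0 expr0n /= => /eqP.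
  by rewrite paddr_eq0 ?sqr_ge0// sqrf_eq0 gt_eqF.
have c0 : modulus c != 0 by apply: contraTneq m0 => ->; rewrite mul0r ltxx.
have d0 : modulus d != 0 by apply: contraTneq m0 => ->; rewrite mulr0 ltxx.
have dt0 : dot c d != 0 by rewrite gt_eqF.
set x := cross c d / dot c d.
have E : 1 + x ^+ 2 = (modulus c * modulus d / dot c d) ^+ 2.
  by rewrite !exprMn exprVn -exprMn -dot_cross; field.
have ca : cos (atan x) = dot c d / (modulus c * modulus d).
  rewrite cos_atan E sqrtr_sqr ger0_norm ?invf_div//.
  by rewrite divr_ge0// ltW.
have sa : sin (atan x) = cross c d / (modulus c * modulus d).
  by rewrite sin_atan ca /x; field; apply/and3P; split.
have cv : cos v = c.1 / modulus c by rewrite {1}h1 mulrC mulrA mulVf ?mul1r.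
have sv : sin v = c.2 / modulus c by rewrite {1}h2 mulrC mulrA mulVf ?mul1r.
have mc : modulus c ^+ 2 != 0 by rewrite sqrf_eq0.
have mc2 : c.1 ^+ 2 + c.2 ^+ 2 != 0 by rewrite -sqr_modulus.
split.
- rewrite cosD ca sa cv sv; apply: (mulfI mc); rewrite {1}sqr_modulus.
  rewrite /dot /cross; field; exact/andP.
- rewrite sinD ca sa cv sv; apply: (mulfI mc); rewrite {1}sqr_modulus.
  rewrite /dot /cross; field; exact/andP.
Qed.

Lemma atan_lt_pi (x : R) : `|atan x| < pi / 2.
Proof. by rewrite ltr_norml atan_gtNpi2 atan_ltpi2. Qed.

Lemma is_arg_diff c d v w : 0 < modulus c -> 0 < modulus d -> is_arg c v -> is_arg d w -> `|w - v| < pi / 2 ->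
  0 < dot c d /\ w = v + atan (cross c d / dot c d).
Proof.
move=> c0 d0 hv hw h.
have dt : 0 < dot c d.
  have -> : dot c d = modulus c * modulus d * cos (w - v).
    by have [h1 h2] := hv; have [h3 h4] := hw; rewrite /dot {1}h1 {1}h2 {1}h3 {1}h4 cosB; ring.
  by rewrite !mulr_gt0// cos_gt0_pihalf// -ltr_norml.
split=> //; apply: (is_arg_close d0 hw (is_arg_shift dt hv)).
have := atan_lt_pi (cross c d / dot c d); move: h; rewrite !ltr_norml ler_norml; lra.
Qed.

(** If h took two different values, then by the intermediate value theorem it
    would also take a value at a distance e <= pi, e > 0, from its value at a,
    where the cosine is not 1. *)
Lemma cos1_const (h : R -> R) (a b : R) : continuous h -> (forall t, a <= t <= b -> cos (h t) = 1) ->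
  forall t, a <= t <= b -> h t = h a.
Proof.
move=> ch h1 t tab.
pose e := Num.min `|h t - h a| pi.
have e0 : 0 <= e by rewrite le_min normr_ge0 pi_ge0.
pose y := h a + (if h a <= h t then e else - e).
have em : e <= `|h t - h a| by rewrite ge_min lexx.
have at_ : a <= t by case/andP: tab.
have [|x] := @IVT _ h a t y at_ (continuous_subspaceT ch).
  rewrite ge_min le_max /y; move: em e0; clearbody e; clear -e; case: (leP (h a) (h t)) => hh.
    by rewrite ger0_norm ?subr_ge0// => ? ?; apply/andP; split; apply/orP; [left|right]; lra.
  by rewrite ltr0_norm ?subr_lt0// => ? ?; apply/andP; split; apply/orP; [right|left]; lra.
rewrite in_itv /= => /andP[ax xt] hx.
have xab : a <= x <= b by rewrite ax (le_trans xt)//; case/andP: tab.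
have aab : a <= a <= b by rewrite lexx (le_trans ax)//; case/andP: xab.
have s1 : sin (h a) = 0 by apply: cos1sin0; rewrite h1// normr1.
have ce : cos e = 1.
  have : cos (h x - h a) = 1 by rewrite cosB s1 !h1// mulr0 addr0 mulr1.
  by rewrite hx /y addrC addKr; case: ifP => // _; rewrite cosN.
have e00 : e = 0 by apply: cos1_eq0 => //; rewrite ger0_norm// ge_min lexx orbT.
move: e00; rewrite /e /Num.min; case: ifP => _ h0; last by have := @pi_gt0 R; rewrite h0 ltxx.
by apply/eqP; rewrite -subr_eq0 -normr_eq0 h0.
Qed.

(** Near x the argument is v x plus the angle between the vectors at x and at
    t, which is an explicit differentiable function. *)
Lemma lift_derive (X Y v : R -> R) (x X' Y' : R) : continuous v -> (forall t, 0 < modulus (X t, Y t)) ->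
  (forall t, is_arg (X t, Y t) (v t)) -> is_derive x 1 X X' -> is_derive x 1 Y Y' ->
  is_derive x 1 v ((X x * Y' - Y x * X') / (X x ^+ 2 + Y x ^+ 2)).
Proof.
move=> cv m0 hv dX dY.
have S0 : X x ^+ 2 + Y x ^+ 2 != 0 by rewrite -(sqr_modulus (X x, Y x)) gt_eqF// exprn_gt0.
pose N t := X x * Y t + - (Y x * X t); pose D t := X x * X t + Y x * Y t.
have hD : D x = X x ^+ 2 + Y x ^+ 2 by rewrite /D; ring.
have hN : N x = 0 by rewrite /N; ring.
have D0 : D x != 0 by rewrite hD.
have dN : is_derive x 1 N (X x * Y' + - (Y x * X')) by rewrite /N; der; rewrite /GRing.scale/=; ring.
have dD : is_derive x 1 D (X x * X' + Y x * Y') by rewrite /D; der; rewrite /GRing.scale/=; ring.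
have dDV := derV D0 dD.
have dq := der_atan (derM dN dDV).
have dc : is_derive x 1 (fun _ : R => v x) 0 by exact: der_cst.
have dt := derD dc dq.
have val : 0 + (1 + (N x * (D x)^-1) ^+ 2)^-1 * ((X x * Y' + - (Y x * X')) * (D x)^-1 +
   N x * (- D x ^- 2 * (X x * X' + Y x * Y'))) = (X x * Y' - Y x * X') / (X x ^+ 2 + Y x ^+ 2).
  rewrite hN hD; field; rewrite S0 /=; lra.
rewrite -val; apply: near_eq_is_derive dt.
have pi20 : 0 < pi / 2 :> R by rewrite divr_gt0// pi_gt0.
have /cvgrPdist_lt/(_ _ pi20) hn := cv x.
near=> t.
have ht : `|v t - v x| < pi / 2 by rewrite distrC; near: t.
by have [_] := is_arg_diff (m0 x) (m0 t) (hv x) (hv t) ht; rewrite /cross /dot /= => <-.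
Unshelve. all: by end_near. Qed.

(** The extension is th (t - k T) + k T with k the integral part of t / T.
    Around each t0 two consecutive branches are given by the single formula
    Wk, which is continuous. *)
Lemma lift_extend (th : R -> R) : {within `[0, T], continuous th} -> th T = th 0 + T ->
  exists W : R -> R, [/\ continuous W, forall t, 0 <= t <= T -> W t = th t & forall t, W (t + T) = W t + T].
Proof.
move=> cth hT.
have T0 : 0 < T by have := @pi_gt0 R; lra.
pose cl (t : R) := Num.max 0 (Num.min t T).
have ccl : continuous cl by rewrite /cl; cts.
have cl_in t : cl t \in `[0, T].
  by rewrite in_itv /= /cl le_max lexx /= ge_max (ltW T0) /= ge_min lexx orbT.
have cl_id t : 0 <= t <= T -> cl t = t.
  by move=> /andP[a b]; rewrite /cl min_l// max_r.
have cl_lo t : t <= 0 -> cl t = 0.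
  by move=> a; rewrite /cl min_l ?max_l//; apply: (le_trans a); exact: ltW.
have cl_hi t : T <= t -> cl t = T.
  by move=> a; rewrite /cl min_r// max_r// ltW.
pose h t := th (cl t).
have ch : continuous h by apply: within_comp_cont cth.
have hT' : h T = th T by rewrite /h cl_id// (ltW T0) lexx.
have h0' : h 0 = th 0 by rewrite /h cl_id// (ltW T0) lexx.
pose k (t : R) : int := Num.floor (t / T).
have kP t : (k t)%:~R * T <= t < ((k t)%:~R + 1) * T.
  by rewrite -ler_pdivlMr// -ltr_pdivrMr// -intrD1; exact: floor_itv.
have kE t (i : int) : i%:~R * T <= t < (i%:~R + 1) * T -> k t = i.
  by move=> h1; apply: floor_def; rewrite intrD1 ler_pdivlMr// ltr_pdivrMr.
pose W t := h (t - (k t)%:~R * T) + (k t)%:~R * T.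
exists W; split.
- move=> t0; set q : R := (k t0)%:~R.
  have q0 : q * T <= t0 < (q + 1) * T by exact: kP.
  pose Wk t := h (t - q * T) + q * T + (h (t - (q - 1) * T) - h T).
  have cWk : continuous Wk by rewrite /Wk; cts.
  have WE t : (q - 1) * T < t < (q + 1) * T -> W t = Wk t.
    move=> /andP[t1 t2]; rewrite /Wk /W; have [qt|tq] := leP (q * T) t.
    + rewrite (kE t (k t0)) -/q ?qt//.
      by rewrite [h (t - (q - 1) * T)]/h cl_hi -?hT' ?subrr ?addr0//; lra.
    + rewrite (kE t (k t0 - 1)) rmorphB/= -/q ?subrK ?tq ?(ltW t1)//.
      rewrite [h (t - q * T)]/h cl_lo; last by lra.
      by rewrite hT' hT; ring.
  apply: (@cvg_trans _ (Wk t @[t --> t0])); last first.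
    by rewrite WE; [exact: cWk|lra].
  apply: near_eq_cvg; near=> t; rewrite WE//; apply/andP; split.
    by near: t; apply: lt_nbhsr; lra.
  by near: t; apply: lt_nbhsl; lra.
- move=> t /andP[t0]; rewrite le_eqVlt => /orP[/eqP ->|tT].
    by rewrite /W (kE T 1) ?mul1r ?subrr ?h0' ?hT//; lra.
  by rewrite /W (kE t 0) ?mul0r ?subr0 ?addr0 /h ?cl_id// ?add0r ?mul1r ?t0// ltW.
- move=> t; rewrite /W; have E : k (t + T) = k t + 1.
    by apply: kE; rewrite intrD1; have := kP t; lra.
  by rewrite E intrD1; set q : R := (k t)%:~R; rewrite (_ : t + T - (q + 1) * T = t - q * T); ring.
Unshelve. all: by end_near. Qed.

(** Passing from the circle s0 to a nearby circle s turns the vector at t by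
    the angle A (s, t), a continuous function of (s, t). The difference v (s,
    t) - v (s0, t) - A (s, t) is a multiple of 2 pi, continuous in t and small
    for t = 0, hence zero. *)
Lemma lift_joint (c : R * R -> R * R) (v : R * R -> R) : continuous c -> (forall z, 0 < modulus (c z)) ->
  (forall z, is_arg (c z) (v z)) -> (forall s, continuous (fun t : R => v (s, t))) -> continuous (fun s : R => v (s, 0)) ->
  continuous v.
Proof.
move=> cc c0 hv cvt cvs [s0 t0].
pose g (z : R * R) := dot (c (s0, z.2)) (c z).
pose gx (z : R * R) := cross (c (s0, z.2)) (c z).
have cg : continuous g by rewrite /g /dot; cts.
have cgx : continuous gx by rewrite /gx /cross; cts.
pose N := `|t0| + `|s0| + 1.
have N0 : 0 <= N by rewrite /N !addr_ge0.
have tN : `|t0| < N by rewrite /N; have := normr_ge0 s0; lra.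
have sN : `|s0| <= N by rewrite /N; have := normr_ge0 t0; lra.
have NN : - N <= N by lra.
have cm : continuous (fun t : R => modulus (c (s0, t)) ^+ 2).
  by apply: contX; apply: (cont_comp modulus_cont); cts.
have [t1 _ ht1] := EVT_min NN (continuous_subspaceT cm).
pose m := modulus (c (s0, t1)) ^+ 2.
have m0 : 0 < m by rewrite exprn_gt0.
have gm t : g (s0, t) = modulus (c (s0, t)) ^+ 2 by rewrite sqr_modulus /g /dot /=; ring.
have m2 : 0 < m / 2 by lra.
have [d d0 hd] := ucont_box N cg m2.
have gpos s t : `|s - s0| < d -> `|t| <= N -> m / 2 <= g (s, t).
  move=> hs ht; have := hd (s0, t) (s, t) sN ht hs; rewrite /= subrr normr0 => /(_ d0).
  have : m <= g (s0, t) by rewrite gm; apply: ht1; rewrite in_itv /= -ler_norml.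
  by rewrite ltr_norml; lra.
pose A (z : R * R) := atan (gx z * (Num.max (g z) (m / 2))^-1).
have cA : continuous A.
  apply: (cont_comp cont_atan); apply: contM => //; apply: contV; last by cts.
  by move=> z; rewrite gt_eqF// lt_max m2 orbT.
have AE s t : `|s - s0| < d -> `|t| <= N -> A (s, t) = atan (gx (s, t) / g (s, t)).
  by move=> hs ht; rewrite /A max_l// gpos.
have A0 t : A (s0, t) = 0.
  by rewrite /A /gx /cross /= (_ : _ - _ = 0) ?mul0r ?atan0//; ring.
pose h s t := v (s, t) - v (s0, t) - A (s, t).
have ch s : continuous (h s) by rewrite /h; cts.
have hcos s t : `|s - s0| < d -> - N <= t <= N -> cos (h s t) = 1.
  move=> hs; rewrite -ler_norml => ht; rewrite /h AE// -addrA -opprD; apply: is_arg_cos (hv (s, t)) _ => //.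
  by apply: is_arg_shift (hv (s0, t)); apply: lt_le_trans m2 _; exact: gpos.
have ch0 : continuous (fun s => h s 0) by rewrite /h; cts.
have h00 : h s0 0 = 0 by rewrite /h A0; ring.
have [d2 d20 hd2] : exists2 d2, 0 < d2 & forall s, `|s - s0| < d2 -> `|h s 0| < pi.
  have /cvgrPdist_lt/(_ _ (@pi_gt0 R))/nbhs_ballP[d2 /= d20 hd2] := ch0 s0.
  exists d2 => // s hs; have := hd2 s; rewrite /ball /= distrC => /(_ hs).
  by rewrite h00 sub0r normrN.
have hz s t : `|s - s0| < d -> `|s - s0| < d2 -> - N <= t <= N -> v (s, t) = v (s0, t) + A (s, t).
  move=> hs hs2 ht; apply/eqP; rewrite -subr_eq0 opprD addrA; apply/eqP; rewrite -/(h s t).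
  have hc := fun x => hcos s x hs.
  rewrite (cos1_const (ch s) hc ht) -(cos1_const (ch s) hc (t := 0)); last by lra.
  apply: cos1_eq0; [exact/ltW/hd2|apply: hc; lra].
pose f (z : R * R) := v (s0, z.2) + A z.
have cf : continuous f.
  rewrite /f; apply: contD => //; exact: (@cont_comp _ _ _ (fun t : R => v (s0, t)) (fun z : R * R => z.2) (cvt s0) cont_snd).
have fE : v (s0, t0) = f (s0, t0) by rewrite /f A0 addr0.
have key : \forall z \near nbhs ((s0, t0) : R * R), f z = v z; last first.
  apply: (@cvg_trans _ (f z @[z --> (s0, t0)])); last by rewrite fE; exact: cf.
  exact: near_eq_cvg key.
have nd : 0 < Num.min d (Num.min d2 (N - `|t0|)) by rewrite !lt_min d0 d20 subr_gt0 tN.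
apply/nbhs_ballP; exists (Num.min d (Num.min d2 (N - `|t0|))) => //= -[s t] [/= ].
rewrite /ball /= !lt_min distrC (distrC t0) => /and3P[hs hs2 _] /and3P[_ _ ht].
have tN2 : - N <= t <= N by rewrite -ler_norml; have := ler_normD (t - t0) t0; rewrite subrK; lra.
by rewrite (hz s t).
Qed.

End Angles.

(** * Integration in logarithmic polar coordinates *)

Section Polar.
Context {R : realType}.
Implicit Types (G : R * R -> R).
Local Notation T := (2 * pi : R).

(** Composition of a primitive with phi. *)
Lemma oint_subst (f phi phi' : R -> R) (a b : R) : continuous f ->
  (forall x : R, is_derive x 1 phi (phi' x)) ->
  oint a b (fun x => f (phi x) * phi' x) = oint (phi a) (phi b) f.
Proof.
move=> cf hd; have [P hP] := prim_exists cf.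
rewrite (ointE _ _ hP) (@ointE _ _ (fun x => P (phi x)))// => x.
exact: der_comp (hP (phi x)) (hd x).
Qed.

Lemma oint_shift (f : R -> R) (a b c : R) : continuous f ->
  oint a b (fun x => f (c + x)) = oint (c + a) (c + b) f.
Proof.
move=> cf; have hd (x : R) : is_derive x 1 (fun x => c + x) 1 by der; ring.
rewrite -(@oint_subst f (fun x => c + x) (fun=> 1) a b cf hd).
by congr oint; apply/funext => x; rewrite mulr1.
Qed.

Lemma oint_sub_le (f : R -> R) (a b a' b' : R) : continuous f -> a' <= a -> a <= b -> b <= b' ->
  (forall x, a' <= x <= b' -> 0 <= f x) -> oint a b f <= oint a' b' f.
Proof.
move=> cf aa ab bb f0.
rewrite -(oint_cat a' a b' cf) -(oint_cat a b b' cf).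
have pos x y : a' <= x -> x <= y -> y <= b' -> 0 <= oint x y f.
  move=> h1 h2 h3; have -> : 0 = oint x y (fun=> 0) by rewrite oint_cst mul0r.
  by apply: le_oint => //; [cts|move=> z hz; apply: f0; lra].
have := pos a' a (lexx _) aa (le_trans ab bb).
have := pos b b' (le_trans aa ab) bb (lexx _); lra.
Qed.

(** The complex exponential in real coordinates. *)
Definition pol (z : R * R) : R * R := (expR z.1 * cos z.2, expR z.1 * sin z.2).
(** The quarter turn. *)
Definition rot (z : R * R) : R * R := (- z.2, z.1).

Lemma pol_cont : continuous pol. Proof. by rewrite /pol; cts. Qed.
Lemma rot_cont : continuous rot. Proof. by rewrite /rot; cts. Qed.

Lemma pol_shift s t : pol (s, t + pi / 2) = rot (pol (s, t)).
Proof. by rewrite /pol /rot /= cosDpihalf sinDpihalf mulrN. Qed.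

Lemma pol_per s t : pol (s, t + T) = pol (s, t).
Proof. by rewrite /pol /= (mulr_natl pi 2) cosD2pi sinD2pi. Qed.

(** The ray of slope tau is parametrized by its abscissa x = exp s cos (atan
    tau), for which ds = dx / x. The maximum with exp a / 2 keeps the weight
    continuous at 0 and is inactive on the ray, because the cosine is at least
    1/2 there. *)
Lemma ray_le G (a b : R) (tau : R) : continuous G -> (forall z, 0 <= G z) -> a <= b -> -1 <= tau <= 1 ->
  oint a b (fun s => G (pol (s, atan tau))) <=
  oint (expR a / 2) (expR b) (fun x => G (x, x * tau) * (Num.max x (expR a / 2))^-1).
Proof.
move=> cG G0 ab ht.
pose k := cos (atan tau).
have k2 : k ^+ 2 = (1 + tau ^+ 2)^-1.
  by rewrite /k cos_atan exprVn sqr_sqrtr// addr_ge0// ?sqr_ge0.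
have k0 : 0 < k by apply: cos_gt0_pihalf; rewrite atan_gtNpi2 atan_ltpi2.
have k1 : k <= 1 by exact: cos_le1.
have t3 : 0 <= (1 - tau) * (1 + tau) by apply: mulr_ge0; lra.
have t2 : tau ^+ 2 <= 1 by lra.
have kh : 1 / 2 <= k.
  rewrite leNgt; apply/negP => kl.
  have kk : k ^+ 2 * (1 + tau ^+ 2) = 1 by rewrite k2 mulVf// gt_eqF// ltr_wpDr// sqr_ge0.
  have h1 : 0 < (1 / 2 - k) * (1 / 2 + k) by apply: mulr_gt0; lra.
  have h2 : 0 <= k ^+ 2 * (1 - tau ^+ 2) by apply: mulr_ge0; [exact: sqr_ge0|lra].
  lra.
pose d := expR a / 2.
have ea := expR_gt0 a.
have d0 : 0 < d by rewrite /d; lra.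
pose f x := G (x, x * tau) * (Num.max x d)^-1.
have cf : continuous f.
  by apply: contM; [cts|apply: contV; [move=> x; rewrite gt_eqF// lt_max d0 orbT|cts]].
have cs : continuous (fun s => f (expR s * k) * (expR s * k)) by cts.
have cp := pol_cont.
have -> : oint a b (fun s => G (pol (s, atan tau))) = oint a b (fun s => f (expR s * k) * (expR s * k)).
  apply: eq_oint => //; first by cts.
  move=> s /andP[as_ _]; rewrite /f /pol /= sin_atan -/k (mulrCA _ tau) (mulrC tau).
  have es := expR_gt0 s.
  rewrite max_l ?mulfVK ?gt_eqF ?mulr_gt0//.
  have : expR a <= expR s by rewrite ler_expR.
  rewrite /d => h; have : expR a * (1 / 2) <= expR s * k by apply: ler_pM => //; lra.
  lra.
have hd (s : R) : is_derive s 1 (fun s => expR s * k) (expR s * k) by der; rewrite /GRing.scale /=; ring.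
rewrite (@oint_subst f (fun s => expR s * k) (fun s => expR s * k) a b cf hd).
have eab : expR a <= expR b by rewrite ler_expR.
apply: oint_sub_le => //.
- have : expR a * (1 / 2) <= expR a * k by apply: ler_wpM2l => //; lra.
  by rewrite /d; lra.
- by apply: ler_wpM2r => //; exact: ltW.
- by rewrite ler_piMr// expR_ge0.
- by move=> x _; rewrite mulr_ge0// invr_ge0 le_max (ltW d0) orbT.
Qed.

Definition square_int (M : R) G := dint (- M) M (- M) M G.

(** In the sector |t| <= pi/4 the slope tau = tan t and the abscissa x are
    coordinates, so that two one-dimensional substitutions, t = atan tau along
    circles and y = x tau along vertical lines, compare the integrals. *)
Lemma sector_le G (a b : R) : continuous G -> (forall z, 0 <= G z) -> a <= b ->
  dint a b (- (pi / 4)) (pi / 4) (fun z => G (pol z)) <= (expR a / 2) ^- 2 * square_int (expR b) G.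
Proof.
move=> cG G0 ab; have cp := pol_cont; have p0 := @pi_gt0 R.
have ea := expR_gt0 a; have eb := expR_gt0 b.
have eab : expR a <= expR b by rewrite ler_expR.
pose d := expR a / 2; pose M := expR b; rewrite -/d -/M.
have d0 : 0 < d by rewrite /d; lra.
have dM : d <= M by rewrite /d /M; lra.
rewrite dintC//; [|by cts|lra].
pose H t := oint a b (fun s => G (pol (s, t))).
have cH : continuous H by apply: (cont_oint_param (g := fun z : R * R => G (pol (z.2, z.1)))); cts.
have H0 t : 0 <= H t.
  have -> : 0 = oint a b (fun=> 0) by rewrite oint_cst mul0r.
  by apply: le_oint => //; cts.
have -> : oint (- (pi / 4)) (pi / 4) H = oint (-1) 1 (fun u => H (atan u) * (1 + u ^+ 2)^-1).
  by rewrite oint_subst// ?atanN ?atan1// => u; exact: is_derive1_atan.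
pose g (z : R * R) := G (z.1, z.1 * z.2) * (Num.max z.1 d)^-1.
have cg : continuous g.
  by apply: contM; [cts|apply: contV; [move=> x; rewrite gt_eqF// lt_max d0 orbT|cts]].
have c1 : continuous (fun u : R => H (atan u) * (1 + u ^+ 2)^-1).
  by apply: contM; [cts|apply: contV; [move=> u; rewrite gt_eqF// ltr_wpDr// sqr_ge0|cts]].
have c2 : continuous (fun u : R => oint d M (fun x => g (x, u))).
  by apply: (cont_oint_param (g := fun z : R * R => g (z.2, z.1))); cts.
apply: (@le_trans _ _ (oint (-1) 1 (fun u => oint d M (fun x => g (x, u))))).
  apply: le_oint => //.
  move=> u hu; apply: le_trans (ray_le cG G0 ab hu).
  by rewrite ler_piMr// invf_le1 ?lerDl ?sqr_ge0// ltr_wpDr// sqr_ge0.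
rewrite -(@dintC _ d M (-1) 1 g)//.
have cin : continuous (fun x : R => oint (- M) M (fun y => G (x, y))) by exact: cont_inner.
apply: (@le_trans _ _ (oint d M (fun x => d ^- 2 * oint (- M) M (fun y => G (x, y))))).
  apply: le_oint => //; [exact: cont_inner|by cts|].
  move=> x /andP[dx xM].
  have x0 : 0 < x by exact: lt_le_trans dx.
  have -> : oint (-1) 1 (fun y => g (x, y)) = x ^- 2 * oint (- x) x (fun y => G (x, y)).
    have hd (u : R) : is_derive u 1 (fun u => x * u) x by der; rewrite /GRing.scale /=; ring.
    have := @oint_subst (fun y => G (x, y)) (fun u => x * u) (fun=> x) (-1) 1 ltac:(by cts) hd.
    rewrite mulrN1 mulr1 => <-.
    rewrite -ointZ; last by cts.
    by congr oint; apply/funext => u; rewrite /g /= max_l//; field; rewrite gt_eqF.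
  apply: ler_pM.
  - by rewrite invr_ge0 sqr_ge0.
  - have -> : 0 = oint (- x) x (fun=> 0) by rewrite oint_cst mul0r.
    by apply: le_oint => //; [cts|cts|lra].
  - by rewrite lef_pV2 ?posrE ?exprn_gt0// lerXn2r ?nnegrE// ltW.
  - by apply: oint_sub_le => //; [cts|lra|lra].
rewrite ointZ//; apply: ler_wpM2l; first by rewrite invr_ge0 sqr_ge0.
apply: oint_sub_le => //; first by lra.
move=> x _; have -> : 0 = oint (- M) M (fun=> 0) by rewrite oint_cst mul0r.
by apply: le_oint => //; [cts|cts|lra].
Qed.

Lemma oint_flip (f : R -> R) (M : R) : continuous f -> oint (- M) M (fun x => f (- x)) = oint (- M) M f.
Proof.
move=> cf; have hd (x : R) : is_derive x 1 (fun x => - x) (-1) by der; ring.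
have := @oint_subst f (fun x => - x) (fun=> -1) (- M) M cf hd.
rewrite opprK => h; rewrite [RHS]ointC// -h.
by rewrite -[RHS]mulN1r -ointZ; [congr oint; apply/funext => x; ring|cts].
Qed.

Lemma square_rot G (M : R) : continuous G -> 0 <= M -> square_int M (fun z => G (rot z)) = square_int M G.
Proof.
move=> cG M0; have MM : - M <= M by lra.
have cr := rot_cont.
rewrite /square_int dintC//; last by cts.
rewrite /dint /rot /= (@oint_flip (fun x => oint (- M) M (fun s => G (x, s)))) //.
exact: cont_inner.
Qed.

(** The four quarter turns of the sector cover the circle, and the integral
    over a centred square is invariant under quarter turns. *)
Lemma polar_le G (a b : R) : continuous G -> (forall z, 0 <= G z) -> a <= b ->
  dint a b 0 T (fun z => G (pol z)) <= 4 * (expR a / 2) ^- 2 * square_int (expR b) G.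
Proof.
move=> cG G0 ab; have cp := pol_cont; have cr := rot_cont; have p0 := @pi_gt0 R.
set C := _ ^- 2.
have eb := expR_gt0 b.
pose sec (G : R * R -> R) (k : R) := dint a b (- (pi / 4) + k * (pi / 2)) (pi / 4 + k * (pi / 2)) (fun z => G (pol z)).
have sec0 G' : continuous G' -> (forall z, 0 <= G' z) -> sec G' 0 <= C * square_int (expR b) G'.
  by move=> c h; rewrite /sec mul0r !addr0; exact: sector_le.
have secS G' k : continuous G' -> sec G' (k + 1) = sec (fun z => G' (rot z)) k.
  move=> c; rewrite /sec /dint; congr oint; apply/funext => s.
  have -> : (fun t => G' (rot (pol (s, t)))) = (fun t => G' (pol (s, pi / 2 + t))).
    by apply/funext => t; rewrite addrC pol_shift.
  rewrite (@oint_shift (fun t => G' (pol (s, t)))); last by cts.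
  by congr oint; ring.
have step k G' : continuous G' -> (forall z, 0 <= G' z) -> sec G' k%:R <= C * square_int (expR b) G'.
  elim: k G' => [|k IH] G' c h; first exact: sec0.
  rewrite -natr1 secS//; rewrite -(square_rot c (ltW eb)).
  by apply: IH => //; cts.
have -> : dint a b 0 T (fun z => G (pol z)) = sec G 0%:R + sec G 1%:R + sec G 2%:R + sec G 3%:R.
  have cI (p q : R) : continuous (fun s => oint p q (fun t => G (pol (s, t)))).
    by apply: (cont_inner (g := fun z => G (pol z))); cts.
  rewrite /sec /dint -ointD; [|exact: cI|exact: cI].
  rewrite -ointD; [|by apply: contD; exact: cI|exact: cI].
  rewrite -ointD; [|by do 2 (apply: contD; last exact: cI); exact: cI|exact: cI].
  congr oint; apply/funext => s.
  have cs : continuous (fun t => G (pol (s, t))) by cts.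
  rewrite -(@oint_periodic _ (fun t => G (pol (s, t))) T (- (pi / 4)) cs); last by move=> t; rewrite pol_per.
  have [P hP] := prim_exists cs; rewrite !(ointE _ _ hP).
  have -> : - ((pi : R) / 4) + 0%:R * (pi / 2) = - (pi / 4) by field.
  have -> : - ((pi : R) / 4) + 1%:R * (pi / 2) = pi / 4 + 0%:R * (pi / 2) by field.
  have -> : - ((pi : R) / 4) + 2%:R * (pi / 2) = pi / 4 + 1%:R * (pi / 2) by field.
  have -> : - ((pi : R) / 4) + 3%:R * (pi / 2) = pi / 4 + 2%:R * (pi / 2) by field.
  have -> : - (pi / 4) + T = pi / 4 + 3%:R * (pi / 2) by field.
  by ring.
have := step 0 G cG G0; have := step 1 G cG G0; have := step 2 G cG G0; have := step 3 G cG G0.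
clear; lra.
Qed.

Lemma square_shift G (M : R) (z0 : R * R) : continuous G ->
  square_int M (fun z => G (z0 + z)) = dint (z0.1 - M) (z0.1 + M) (z0.2 - M) (z0.2 + M) G.
Proof.
move=> cG; rewrite /square_int /dint -(@oint_shift (fun x => oint (z0.2 - M) (z0.2 + M) (fun t => G (x, t)))); last exact: cont_inner.
congr oint; apply/funext => x.
by rewrite -(@oint_shift (fun y => G (z0.1 + x, y))); last by cts.
Qed.

End Polar.

(** * The logarithmic polar chart *)

Section PolarPoints.
Context {R : realType}.
Local Notation T := (2 * pi : R).
Implicit Types (z w c : R * R).

Lemma subE2 z w : z - w = (z.1 - w.1, z.2 - w.2).
Proof. by []. Qed.
Lemma pair_eq z w : z.1 = w.1 -> z.2 = w.2 -> z = w.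
Proof. by case: z w => [a b] [c d] /= -> ->. Qed.

Lemma cont_sub2 {X : topologicalType} (g : X -> R * R) w : continuous g -> continuous (fun x => g x - w).
Proof. by move=> cg; rewrite (_ : (fun x => _) = fun x => ((g x).1 - w.1, (g x).2 - w.2))//; cts. Qed.
Lemma cont_add2 {X : topologicalType} (g : X -> R * R) w : continuous g -> continuous (fun x => w + g x).
Proof. by move=> cg; rewrite (_ : (fun x => _) = fun x => (w.1 + (g x).1, w.2 + (g x).2))//; cts. Qed.

Lemma modulus_sub_cont w : continuous (fun z => modulus (z - w)).
Proof. by apply: (cont_comp modulus_cont); apply: cont_sub2; cts. Qed.

Lemma norm1_le_modulus z : `|z.1| <= modulus z.
Proof. by rewrite -sqrtr_sqr ler_wsqrtr// lerDl sqr_ge0. Qed.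
Lemma norm2_le_modulus z : `|z.2| <= modulus z.
Proof. by rewrite -sqrtr_sqr ler_wsqrtr// lerDr sqr_ge0. Qed.

Lemma modulus0 : modulus (0 : R * R) = 0.
Proof. by rewrite /modulus /= expr0n /= addr0 sqrtr0. Qed.

Lemma modulus_scale (k : R) z : 0 <= k -> modulus (k * z.1, k * z.2) = k * modulus z.
Proof.
move=> k0; apply/eqP; rewrite -(@eqrXn2 _ 2)// ?modulus_ge0 ?mulr_ge0 ?modulus_ge0//.
by apply/eqP; rewrite exprMn !sqr_modulus /=; ring.
Qed.

Lemma modulus_pol (s t : R) : modulus (pol (s, t)) = expR s.
Proof.
apply/eqP; rewrite -(@eqrXn2 _ 2)// ?modulus_ge0 ?expR_ge0//.
by apply/eqP; rewrite sqr_modulus /pol /= !exprMn -mulrDr cos2Dsin2 mulr1.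
Qed.

(** The arc cosine or its reflection, according to the sign of the second
    coordinate. *)
Lemma is_arg_exists c : exists2 t, 0 <= t <= T & is_arg c t.
Proof.
have p0 := @pi_ge0 R.
have [c0|/modulus_gt0 c0] := eqVneq c 0.
  by exists 0; [lra|rewrite c0 /is_arg modulus0 /= !mul0r].
have m0 : modulus c != 0 by rewrite gt_eqF.
have mV : modulus c * (modulus c)^-1 = 1 by rewrite divff.
pose x := c.1 / modulus c.
have x1 : -1 <= x <= 1.
  by rewrite -ler_norml /x normrM normfV (ger0_norm (modulus_ge0 c)) ler_pdivrMr// mul1r norm1_le_modulus.
have [/andP[a0 a1] ca] := acos_def x1.
have e1 : c.1 = modulus c * cos (acos x) by rewrite ca /x mulrCA mV mulr1.
have e2 : `|c.2| = modulus c * sin (acos x).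
  rewrite sin_acos//; apply/eqP; rewrite -(@eqrXn2 _ 2)// ?mulr_ge0 ?sqrtr_ge0 ?modulus_ge0//.
  have x2 : x ^+ 2 <= 1 by have : 0 <= (1 - x) * (1 + x) by [apply: mulr_ge0; lra]; lra.
  have e3 : (modulus c * Num.sqrt (1 - x ^+ 2)) ^+ 2 = modulus c ^+ 2 * (1 - x ^+ 2).
    by rewrite exprMn; congr (_ * _); rewrite sqr_sqrtr // subr_ge0.
  have e4 : modulus c ^+ 2 * x ^+ 2 = c.1 ^+ 2 by rewrite -exprMn mulrC /x divfK.
  by apply/eqP; rewrite e3 mulrBr e4 sqr_modulus mulr1 -normrX ger0_norm ?sqr_ge0//; ring.
have [h|h] := leP 0 c.2.
  by exists (acos x); [lra|split; rewrite // -e2 ger0_norm].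
exists (T - acos x); first lra.
rewrite /is_arg (mulr_natl pi 2) (addrC (pi *+ 2)) cosD2pi sinD2pi cosN sinN; split => //.
by rewrite mulrN -e2 ltr0_norm// opprK.
Qed.

Lemma polar_repr z : z != 0 -> exists2 t, 0 <= t <= T & z = pol (ln (modulus z), t).
Proof.
move=> z0; have [t ht [h1 h2]] := is_arg_exists z.
by exists t => //; apply: pair_eq; rewrite /pol /= lnK ?posrE ?modulus_gt0.
Qed.

Lemma cont_ln {X : topologicalType} (g : X -> R) : (forall x, 0 < g x) -> continuous g -> continuous (fun x => ln (g x)).
Proof.
move=> g0 cg x; have h := @continuous_ln R (g x) (g0 x).
exact: (@cvg_comp _ _ _ g (@ln R) (nbhs x) (nbhs (g x)) (nbhs (ln (g x))) (cg x) h).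
Qed.

Lemma nbhs_box z (V : set (R * R)) : nbhs z V -> exists2 e, 0 < e &
  forall w, `|w.1 - z.1| < e -> `|w.2 - z.2| < e -> V w.
Proof.
move=> /nbhs_ballP[e /= e0 he]; exists e => // w h1 h2; apply: he.
by split; rewrite /ball /= distrC.
Qed.

(** After rotation by - t and scaling by exp (- s), a local inverse is given
    by the logarithm of the modulus and the arctangent of the slope. The
    maxima with 1/2 make this inverse a globally defined continuous function
    and are inactive near the point. *)
Lemma pol_open (s t : R) (N : set (R * R)) : nbhs (s, t) N -> nbhs (pol (s, t)) (pol @` N).
Proof.
move=> nN.
pose z1 w := (w.1 * cos t + w.2 * sin t) / expR s.
pose z2 w := (w.2 * cos t - w.1 * sin t) / expR s.
have es : expR s != 0 by rewrite gt_eqF// expR_gt0.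
have c1 : continuous z1 by rewrite /z1; cts.
have c2 : continuous z2 by rewrite /z2; cts.
have h1 : z1 (pol (s, t)) = 1.
  rewrite /z1 /pol /= (_ : _ + _ = expR s * (cos t ^+ 2 + sin t ^+ 2)); last ring.
  by rewrite cos2Dsin2 mulr1 divff.
have h2 : z2 (pol (s, t)) = 0.
  by rewrite /z2 /pol /= (_ : _ - _ = 0) ?mul0r//; ring.
pose L w := (s + ln (Num.max (1 / 2) (modulus (z1 w, z2 w))), t + atan (z2 w / Num.max (1 / 2) (z1 w))).
have cm : continuous (fun w => modulus (z1 w, z2 w)) by apply: (cont_comp modulus_cont); cts.
have half0 (x : R) : 0 < Num.max (1 / 2) x by rewrite lt_max; apply/orP; left; lra.
have cL : continuous L.
  apply: cont_pair.
    by apply: contD; [cts|apply: cont_ln => //; cts].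
  apply: contD; first by cts.
  by apply: (cont_comp cont_atan); apply: contM => //; apply: contV => [w|]; [rewrite gt_eqF|cts].
have m1 : modulus (z1 (pol (s, t)), z2 (pol (s, t))) = 1.
  by rewrite h1 h2 /modulus /= expr1n expr0n /= addr0 sqrtr1.
have LP : L (pol (s, t)) = (s, t).
  rewrite /L m1 h1 h2 mul0r atan0 addr0.
  by rewrite max_r ?ln1 ?addr0//; lra.
have nL : nbhs (pol (s, t)) [set w | N (L w)] by apply: cL; rewrite LP.
have n1 : nbhs (pol (s, t)) [set w | 1 / 2 < z1 w].
  have /cvgrPdist_lt := c1 (pol (s, t)); rewrite h1 => /(_ (1/2)) h.
  have {}h := h ltac:(lra); apply: filterS h => w; rewrite ltr_norml /=; lra.
apply: filterS (filterI nL n1) => w [/= NL zw]; exists (L w) => //.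
have zp : 0 < z1 w by lra.
have mp : 1 / 2 < modulus (z1 w, z2 w).
  by apply: (lt_le_trans zw); apply: le_trans (norm1_le_modulus (z1 w, z2 w)); exact: ler_norm.
have a1 : is_arg (z1 w, z2 w) (atan (z2 w / z1 w)).
  have a0 : is_arg ((1, 0) : R * R) 0 by rewrite /is_arg /modulus /= expr1n expr0n /= addr0 sqrtr1 cos0 sin0 !mul1r.
  have := @is_arg_shift R (1, 0) (z1 w, z2 w) 0; rewrite /dot /cross /= !mul0r !mul1r addr0 subr0 add0r.
  exact.
have [b1 b2] := a1; rewrite /= in b1 b2.
rewrite /L /pol /= max_r ?(ltW mp)// max_r ?(ltW zw)// expRD lnK; last by rewrite posrE; lra.
rewrite cosD sinD; set th := atan _; set m := modulus _.
rewrite -/m -/th in b1 b2.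
have e1 : expR s * m * (cos t * cos th - sin t * sin th) = expR s * (cos t * z1 w - sin t * z2 w).
  by rewrite [in RHS]b1 [in RHS]b2; ring.
have e2 : expR s * m * (sin t * cos th + cos t * sin th) = expR s * (sin t * z1 w + cos t * z2 w).
  by rewrite [in RHS]b1 [in RHS]b2; ring.
rewrite e1 e2; apply: pair_eq => /=.
- rewrite /z1 /z2 -[RHS](mulr1 w.1) -(cos2Dsin2 t); field.
  by [].
- rewrite /z1 /z2 -[RHS](mulr1 w.2) -(cos2Dsin2 t); field.
  by [].
Qed.

(** A maximum over the rectangle is attained by compactness, and it cannot be
    attained in the interior. *)
Lemma max_principle (v : R * R -> R) (S0 : R) : continuous v ->
  (forall z N, z.1 < S0 -> nbhs z N -> exists2 y, N y & v z < v y) ->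
  forall p q c d B : R, p <= q -> q < S0 -> c <= d ->
    (forall z, rect_boundary p q c d z -> v z <= B) -> forall s t, p <= s <= q -> c <= t <= d -> v (s, t) <= B.
Proof.
move=> cv hv p q c d B pq qS cd hB s t hs ht.
have ne : rect p q c d !=set0 by exists (p, c); split; rewrite /= in_itv/= lexx.
have [z] := compact_EVT_max ne (@rect_compact R p q c d) (continuous_subspaceT cv).
rewrite inE => -[/= z1 z2] hz; rewrite !in_itv /= in z1 z2.
have le1 : v (s, t) <= v z.
  by apply: hz; rewrite inE; split; rewrite /= in_itv.
apply: (le_trans le1).
apply: contrapT => /negP; rewrite -ltNge => Bz.
have int : [/\ p < z.1, z.1 < q, c < z.2 & z.2 < d].
  split; rewrite lt_neqAle; apply/andP; split; try lra.
  - by apply/eqP => e; have : v z <= B by [apply: hB; split => //; rewrite -e; constructor 1]; lra.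
  - by apply/eqP => e; have : v z <= B by [apply: hB; split => //; constructor 2]; lra.
  - by apply/eqP => e; have : v z <= B by [apply: hB; split => //; rewrite -e; constructor 3]; lra.
  - by apply/eqP => e; have : v z <= B by [apply: hB; split => //; constructor 4]; lra.
have [i1 i2 i3 i4] := int.
have nb : nbhs z (rect p q c d).
  apply/nbhs_ballP; exists (Num.min (Num.min (z.1 - p) (q - z.1)) (Num.min (z.2 - c) (d - z.2))) => /=.
    by rewrite !lt_min !subr_gt0 i1 i2 i3 i4.
  move=> y [/= ]; rewrite /ball /= !lt_min !ltr_norml => b1 b2.
  by split; rewrite /= in_itv/=; lra.
have zS : z.1 < S0 by lra.
have [y yN] := hv z _ zS nb.
by apply/negP; rewrite -leNgt; apply: hz; rewrite inE.
Qed.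

End PolarPoints.

(** * Topology of an open injective map near a point *)

Section MapTopology.
Context {R : realType}.
Local Notation T := (2 * pi : R).

Lemma nbhs_curve (g : R -> R * R) (N : set (R * R)) : continuous g -> nbhs (g 0) N ->
  exists2 e, 0 < e & forall x, `|x| <= e -> N (g x).
Proof.
move=> cg nN; have /nbhs_ballP[e /= e0 he] := cg 0 _ nN.
exists (e / 2); first by rewrite divr_gt0.
move=> x hx; apply: he; rewrite /ball /= sub0r normrN; lra.
Qed.

(** The image of a neighbourhood of z contains the set of the points of W'
    that the inverse maps into it. *)
Lemma homeo_open (W W' : set (R * R)) f : open W' -> homeo_between W W' f ->
  forall z V, W z -> nbhs z V -> nbhs (f z) [set w | exists z', [/\ V z', W z' & f z' = w]].
Proof.
move=> oW' [bij [_ [g [cg gf]]]] z V Wz nV.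
have W'f : W' (f z) by apply: (set_bij_sub bij); exists z.
move: cg; rewrite continuous_open_subspace// => /(_ (f z)).
rewrite inE => /(_ W'f); rewrite /continuous_at gf// => /(_ V nV) n1.
have n2 : nbhs (f z) W' by exact: open_nbhs_nbhs.
have n3 : nbhs (f z) [set w | V (g w)] := n1.
apply: filterS (filterI n3 n2) => w [/= Vg W'w].
have [z' Wz' fz'] := set_bij_surj bij W'w.
by exists z'; split; rewrite -?fz' // -(gf z')// fz'.
Qed.

Context (W : set (R * R)) (f F : R * R -> R * R) (z0 : R * R) (S3 : R).
Context (openf : forall z V, W z -> nbhs z V -> nbhs (f z) [set w | exists z', [/\ V z', W z' & f z' = w]]).
Context (injf : forall z z', W z -> W z' -> f z = f z' -> z = z').
Context (cF : continuous F).
Context (discF : forall z, modulus (z - z0) <= expR S3 -> W z /\ F z = f z).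

(** The point with logarithmic polar coordinates (s, t) around z. *)
Definition ppt (z : R * R) (s t : R) : R * R := z + pol (s, t).
(** The exponential of u. *)
Definition hgt (z : R * R) := modulus (F z - f z0).
Local Notation P := (ppt z0).

Lemma W_center : W z0.
Proof. by apply: (proj1 (discF _)); rewrite subrr modulus0 expR_ge0. Qed.

Lemma ppt_dist s t : modulus (P s t - z0) = expR s.
Proof. by rewrite /ppt addrC addKr modulus_pol. Qed.

Lemma ppt_disc s t : s <= S3 -> modulus (P s t - z0) <= expR S3.
Proof. by rewrite ppt_dist ler_expR. Qed.

Lemma hgt_cont : continuous hgt.
Proof. by apply: (cont_comp modulus_cont); apply: cont_sub2. Qed.

Lemma hgt_gt0 z : modulus (z - z0) <= expR S3 -> z != z0 -> 0 < hgt z.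
Proof.
move=> hz nz; have [Wz Fz] := discF hz; apply: modulus_gt0.
rewrite Fz subr_eq0; apply: contra nz => /eqP/injf e; apply/eqP; apply: e => //; exact: W_center.
Qed.

Lemma ppt_neq s t : P s t != z0.
Proof.
apply/eqP => e; have := ppt_dist s t; rewrite e subrr modulus0.
by have := expR_gt0 s; move=> + h; rewrite -h ltxx.
Qed.

Lemma disc_compact (s : R) : compact [set z : R * R | modulus (z - z0) <= expR s].
Proof.
apply: (@subclosed_compact _ _ (rect (z0.1 - expR s) (z0.1 + expR s) (z0.2 - expR s) (z0.2 + expR s))).
- have /continuous_closedP := @modulus_sub_cont R z0.
  by move=> /(_ [set x | x <= expR s]); apply; exact: closed_le.
- exact: rect_compact.
- move=> z /= hz; split; rewrite /= in_itv/=.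
  + have := norm1_le_modulus (z - z0); rewrite /= => h1.
    by have := le_trans h1 hz; rewrite ler_norml; lra.
  + have := norm2_le_modulus (z - z0); rewrite /= => h1.
    by have := le_trans h1 hz; rewrite ler_norml; lra.
Qed.

Lemma circle_pt (s : R) z : modulus (z - z0) = expR s -> exists2 t, 0 <= t <= T & z = P s t.
Proof.
move=> hz; have nz : z - z0 != 0.
  by apply/eqP => e; move: hz; rewrite e modulus0 => h; have := expR_gt0 s; rewrite -h ltxx.
have [t ht e] := polar_repr nz; exists t => //.
by rewrite /ppt -[LHS](subrK z0) e hz expRK addrC.
Qed.

(** The maximum of |f - f z0| over the disc of radius exp s' is attained on
    its boundary circle: at an interior point, openness of f provides nearby
    points whose image is moved radially away from f z0. *)
Lemma circle_max_le s s' t : s < s' -> s' <= S3 -> exists2 t', 0 <= t' <= T & hgt (P s t) <= hgt (P s' t').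
Proof.
move=> ss sS.
have sS' : s <= S3 by lra.
have ne : [set z : R * R | modulus (z - z0) <= expR s'] !=set0.
  by exists (P s t); rewrite /= ppt_dist ler_expR ltW.
have [z] := compact_EVT_max ne (@disc_compact s') (continuous_subspaceT hgt_cont).
rewrite inE /= => hz zmax.
have inS y : modulus (y - z0) <= expR s' -> modulus (y - z0) <= expR S3.
  by move=> h; apply: (le_trans h); rewrite ler_expR.
have Pz : hgt (P s t) <= hgt z by apply: zmax; rewrite inE /= ppt_dist ler_expR ltW.
have P0 : 0 < hgt (P s t) by apply: hgt_gt0; [exact: ppt_disc|exact: ppt_neq].
have [e|] := eqVneq (modulus (z - z0)) (expR s').
  by have [t' ht' ze] := circle_pt e; exists t' => //; rewrite -ze.
move=> ne2; exfalso.
have lt2 : modulus (z - z0) < expR s' by rewrite lt_neqAle ne2.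
have [Wz Fz] := discF (inS _ hz).
have nV : nbhs z [set y | modulus (y - z0) < expR s'].
  have := @modulus_sub_cont R z0 z [set x | x < expR s']; apply.
  exact: lt_nbhsl.
have nb := openf Wz nV.
pose g (x : R) : R * R := ((f z).1 + x * ((f z).1 - (f z0).1), (f z).2 + x * ((f z).2 - (f z0).2)).
have cg : continuous g by rewrite /g; cts.
have g0 : g 0 = f z by rewrite /g !mul0r !addr0; case: (f z).
rewrite -g0 in nb; have [e e0 he] := nbhs_curve cg nb.
have [|z' [/= z'd Wz' fz']] := he e; first by rewrite ger0_norm// ltW.
have Fz' : F z' = f z' by apply: (proj2 (discF _)); apply: inS; exact: ltW.
have : hgt z' <= hgt z by apply: zmax; rewrite inE /= ltW.
rewrite {1}/hgt Fz' fz' (_ : g e - f z0 = ((1 + e) * (f z - f z0).1, (1 + e) * (f z - f z0).2)); last first.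
  by rewrite /g subE2 /=; congr (_, _); ring.
rewrite modulus_scale; last by lra.
rewrite -Fz -/(hgt z) leNgt => /negP; apply.
by rewrite ltr_pMl ?ltrDl// (lt_le_trans P0).
Qed.

(** Otherwise the segment from f z0 to f (P s' t') does not meet the image of
    the circle s. The part of the segment in the image of the open disc is
    then open and closed, so f (P s' t') is attained in that disc, against
    injectivity. *)
Lemma circle_min_le s s' t' : s < s' -> s' <= S3 -> exists2 t, 0 <= t <= T & hgt (P s t) <= hgt (P s' t').
Proof.
move=> ss sS; apply: contrapT => hn.
have sS' : s <= S3 by lra.
have big t : 0 <= t <= T -> hgt (P s' t') < hgt (P s t).
  by move=> ht; rewrite ltNge; apply/negP => h; apply: hn; exists t.
have inS y : modulus (y - z0) <= expR s -> modulus (y - z0) <= expR S3.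
  by move=> h; apply: (le_trans h); rewrite ler_expR.
have [WP FP] := discF (ppt_disc t' sS).
set w := f (P s' t') in FP *.
pose g (x : R) : R * R := ((f z0).1 + x * (w.1 - (f z0).1), (f z0).2 + x * (w.2 - (f z0).2)).
have cg : continuous g by rewrite /g; cts.
have hg x : 0 <= x <= 1 -> modulus (g x - f z0) <= hgt (P s' t').
  move=> /andP[x0 x1].
  rewrite (_ : g x - f z0 = (x * (w - f z0).1, x * (w - f z0).2)); last first.
    by rewrite /g subE2 /=; congr (_, _); ring.
  by rewrite modulus_scale// /hgt FP ler_piMl// modulus_ge0.
pose Do := [set y : R * R | modulus (y - z0) < expR s].
pose Dc := [set y : R * R | modulus (y - z0) <= expR s].
have oO : open (f @` Do).
  rewrite openE => _ [y /= hy <-].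
  have nV : nbhs y Do.
    have := @modulus_sub_cont R z0 y [set x | x < expR s]; apply.
    exact: lt_nbhsl.
  have Wy : W y by apply: (proj1 (discF _)); apply: inS; exact: ltW.
  apply: filterS (openf Wy nV) => v [z' [h1 _ h2]]; by exists z'.
have cC : closed (f @` Dc).
  have -> : f @` Dc = F @` Dc.
    by apply/seteqP; split => _ [y hy <-]; exists y => //; have [_ ->] := discF (inS _ hy).
  apply: compact_closed; first exact: norm_hausdorff.
  by apply: continuous_compact; [exact: continuous_subspaceT|exact: disc_compact].
pose B := [set x : R | 0 <= x <= 1 /\ (f @` Do) (g x)].
have h01 x : (`[0, 1]%classic : set R) x = (0 <= x <= 1 : Prop) by rewrite /= in_itv.
have : B = `[0, 1]%classic.
  apply: (@segment_connected R 0 1).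
  - exists 0; split; first by rewrite lexx ler01.
    exists z0; first by rewrite /Do /= subrr modulus0 expR_gt0.
    by rewrite /g !mul0r !addr0; case: (f z0).
  - exists (g @^-1` (f @` Do)); first by move/continuousP : cg; apply.
    by apply/seteqP; split => x; rewrite /B /= in_itv/=.
  - exists (g @^-1` (f @` Dc)); first by move/continuous_closedP : cg; apply.
    apply/seteqP; split => x; rewrite /B /= in_itv/=.
      by move=> [? [y hy <-]]; split => //; exists y => //; exact: ltW.
    move=> [hx [y hy fy]]; split => //; exists y => //.
    rewrite /Do /= lt_neqAle hy andbT; apply/eqP => e.
    have [t ht ye] := circle_pt e.
    have := big t ht; rewrite -ye /hgt -/(hgt _) ltNge => /negP; apply.
    by have [_ ->] := discF (inS _ hy); rewrite fy; exact: hg.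
move=> BE; have : B 1 by rewrite BE /= in_itv/= ler01 lexx.
move=> [_ [y hy fy]].
have Wy : W y by apply: (proj1 (discF _)); apply: inS; exact: ltW.
have yP : y = P s' t'.
  apply: injf => //; rewrite fy -/w (_ : w = (w.1, w.2)); last by case: (w).
  by rewrite /g /= !mul1r; congr (_, _); ring.
by move: hy; rewrite /Do /= yP ppt_dist ltr_expR ltNge ltW.
Qed.

(** Compactness of a closed annulus. *)
Lemma annulus_low s1 s2 : s1 <= s2 -> s2 <= S3 -> exists2 m, 0 < m & forall s t, s1 <= s <= s2 -> m <= hgt (P s t).
Proof.
move=> s12 sS.
pose A := [set z : R * R | modulus (z - z0) <= expR s2] `&` [set z | expR s1 <= modulus (z - z0)].
have cA : compact A.
  apply: compact_closedI; first exact: disc_compact.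
  have /continuous_closedP := @modulus_sub_cont R z0.
  by move=> /(_ [set x | expR s1 <= x]); apply; exact: closed_ge.
have PA s t : s1 <= s <= s2 -> A (P s t).
  by move=> /andP[h1 h2]; split; rewrite /= ppt_dist ler_expR.
have ne : A !=set0 by exists (P s1 0); apply: PA; rewrite lexx.
have [z] := compact_EVT_min ne cA (continuous_subspaceT hgt_cont).
rewrite inE => -[/= h1 h2] hz.
exists (hgt z); last by move=> s t hs; apply: hz; rewrite inE; exact: PA.
apply: hgt_gt0; first by apply: (le_trans h1); rewrite ler_expR.
apply/eqP => e; move: h2; rewrite e subrr modulus0 leNgt => /negP; apply; exact: expR_gt0.
Qed.

Lemma hgt_small (B : R) : 0 < B -> exists s1, forall s t, s <= s1 -> hgt (P s t) <= B.
Proof.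
move=> B0.
have h0 : hgt z0 = 0 by rewrite /hgt (proj2 (discF _)) ?subrr ?modulus0// expR_ge0.
have /nbhs_box[e e0 he] : nbhs z0 [set z | hgt z < B].
  by have := @hgt_cont z0 [set x | x < B]; apply; rewrite h0; exact: lt_nbhsl.
exists (ln (e / 2)) => s t hs; apply: ltW; apply: he.
- rewrite /ppt /= addrC addKr; apply: le_lt_trans (norm1_le_modulus (pol (s, t))) _.
  rewrite modulus_pol; apply: (@le_lt_trans _ _ (e / 2)); last lra.
  by rewrite -(@lnK _ (e / 2)) ?ler_expR// posrE divr_gt0.
- rewrite /ppt /= addrC addKr; apply: le_lt_trans (norm2_le_modulus (pol (s, t))) _.
  rewrite modulus_pol; apply: (@le_lt_trans _ _ (e / 2)); last lra.
  by rewrite -(@lnK _ (e / 2)) ?ler_expR// posrE divr_gt0.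
Qed.

(** The point f z is turned around f z0 by a small angle x. By openness of f
    and of the exponential the turned point has a preimage in N, where the
    argument is v z + x up to a multiple of 2 pi, which vanishes by continuity
    of v. *)
Lemma arg_open (v : R * R -> R) : continuous v ->
  (forall s t, s <= S3 -> is_arg (F (P s t) - f z0) (v (s, t))) ->
  forall z N, z.1 < S3 -> nbhs z N ->
    exists2 e, 0 < e & forall x, `|x| <= e -> exists2 y, N y & v y = v z + x.
Proof.
move=> cv hv [s t] N /= sS nN.
have [Wz Fz] := discF (ppt_disc t (ltW sS)).
have n1 : nbhs (s, t) [set y | `|v y - v (s, t)| < pi / 2].
  have /cvgrPdist_lt /(_ (pi / 2)) h := cv (s, t).
  have {}h := h ltac:(by rewrite divr_gt0// pi_gt0).
  by apply: filterS h => y; rewrite /= distrC.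
have n2 : nbhs (s, t) [set y : R * R | y.1 < S3].
  by have := @cont_fst R R (s, t) [set x | x < S3]; apply; exact: lt_nbhsl.
have nM : nbhs (s, t) (N `&` ([set y | `|v y - v (s, t)| < pi / 2] `&` [set y | y.1 < S3])).
  by apply: filterI => //; apply: filterI.
have nP : nbhs (P s t) [set z | exists2 y : R * R, (N `&` ([set y | `|v y - v (s, t)| < pi / 2] `&` [set y | y.1 < S3])) y & z = P y.1 y.2].
  have h := pol_open nM.
  have cs : continuous (fun z : R * R => z - z0) by apply: cont_sub2; cts.
  have := cs (P s t) (pol @` (N `&` ([set y | `|v y - v (s, t)| < pi / 2] `&` [set y | y.1 < S3]))).
  rewrite {1}/ppt addrC addKr => /(_ h) h2.
  have h3 : nbhs (P s t) [set z | (pol @` (N `&` ([set y | `|v y - v (s, t)| < pi / 2] `&` [set y | y.1 < S3]))) (z - z0)] := h2.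
  apply: filterS h3 => z [y hy e]; exists y => //.
  by rewrite /ppt -[LHS](subrK z0) -e addrC; case: (y).
have nb := openf Wz nP.
pose r := modulus (f (P s t) - f z0).
have r0 : 0 < r by rewrite /r -Fz; apply: hgt_gt0; [exact/ppt_disc/ltW|exact: ppt_neq].
pose g (x : R) : R * R := ((f z0).1 + r * cos (v (s, t) + x), (f z0).2 + r * sin (v (s, t) + x)).
have cg : continuous g by rewrite /g; cts.
have g0 : g 0 = f (P s t).
  have := hv s t (ltW sS); rewrite Fz => -[/= e1 e2].
  by rewrite /g addr0 -e1 -e2 [RHS]surjective_pairing; congr (_, _); rewrite addrC subrK.
rewrite -g0 in nb; have [e e0 he] := nbhs_curve cg nb.
exists (Num.min e (pi / 2)); first by rewrite lt_min e0 divr_gt0// pi_gt0.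
move=> x; rewrite le_min => /andP[xe xpi].
have [z' [[y [Ny [/= vy yS]] z'E] Wz' fz']] := he x xe.
exists y => //.
have := hv y.1 y.2 (ltW yS); rewrite -z'E.
have [|_ ->] := @discF z'; first by rewrite z'E; exact/ppt_disc/ltW.
rewrite fz' => ay.
have gE : g x - f z0 = (r * cos (v (s, t) + x), r * sin (v (s, t) + x)).
  by rewrite /g subE2 /=; congr (_, _); ring.
have gm : modulus (g x - f z0) = r.
  by rewrite gE /modulus /= !exprMn -mulrDr cos2Dsin2 mulr1 sqrtr_sqr ger0_norm//; exact: ltW.
have ax : is_arg (g x - f z0) (v (s, t) + x) by rewrite /is_arg gm gE.
have -> : v y = v (y.1, y.2) by case: (y).
apply: (is_arg_close _ ay ax); first by rewrite gm.
have -> : (y.1, y.2) = y by case: (y).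
by move: vy xpi; rewrite ltr_norml !ler_norml; lra.
Qed.

End MapTopology.

(** * Approximation in logarithmic coordinates *)

Section Chain.
Context {R : realType}.
Local Notation T := (2 * pi : R).

(** The product rule at a zero of g needs only continuity of phi. *)
Lemma der_mul_vanish (g phi : R -> R) (t g' : R) : is_derive t 1 g g' -> g t = 0 -> {for t, continuous phi} ->
  is_derive t 1 (fun x => g x * phi x) (g' * phi t).
Proof.
move=> dg g0 cphi; apply: cvg_is_derive.
have h1 := is_derive_cvg dg.
have c0 : {for 0, continuous (fun h : R => h *: (1 : R) + t)}.
  by apply: (_ : continuous _); rewrite /GRing.scale /=; cts.
have h2 : phi (h *: 1 + t) @[h --> (0 : R)^'] --> phi t.
  apply: (@cvg_comp _ _ _ (fun h : R => h *: (1 : R) + t) phi) cphi.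
  move=> N nN; have := c0 N; rewrite scale0r add0r => /(_ nN) nN2.
  rewrite /nbhs /=; apply: (@filterS _ (nbhs (0 : R)) _ _ _ _ nN2) => x hx _; exact: hx.
rewrite (_ : (fun h => _) = (fun h : R => h^-1 *: (g (h *: 1 + t) - g t) * phi (h *: 1 + t))).
  exact: cvgM h1 h2.
by apply/funext => h; rewrite g0 mul0r !subr0 /GRing.scale /= mulrA.
Qed.

(** Hadamard's formula p (a, b) = p (x t, b) + (a - x t) Phi (a, b), where Phi
    is an average of px and hence continuous, reduces the chain rule to one
    variable. *)
Lemma C1_chain (p px py : R * R -> R) (x y : R -> R) (t x' y' : R) : C1 p px py ->
  continuous x -> continuous y -> is_derive t 1 x x' -> is_derive t 1 y y' ->
  is_derive t 1 (fun t => p (x t, y t)) (px (x t, y t) * x' + py (x t, y t) * y').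
Proof.
move=> [cp cpx cpy dpx dpy] cx cy dx dy.
pose Phi (w : R * R) := oint 0 1 (fun th => px (x t + th * (w.1 - x t), w.2)).
have cPhi : continuous Phi.
  by apply: (cont_oint_param (g := fun z : (R * R) * R => px (x t + z.2 * (z.1.1 - x t), z.1.2))); cts.
have E a b : p (a, b) = p (x t, b) + (a - x t) * Phi (a, b).
  rewrite /Phi -ointZ; last by cts.
  have cs : continuous (fun a : R => px (a, b)) by cts.
  have hd (th : R) : is_derive th 1 (fun th => x t + th * (a - x t)) (a - x t) by der; rewrite /GRing.scale /=; ring.
  have := @oint_subst _ (fun a => px (a, b)) (fun th => x t + th * (a - x t)) (fun=> a - x t) 0 1 cs hd.
  rewrite mul0r addr0 mul1r (_ : x t + (a - x t) = a); last by ring.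
  rewrite (ftc_s _ _ _ cpx dpx) => h.
  rewrite -[LHS](subrK (p (x t, b))) -h addrC; congr (_ + oint _ _ _).
  by apply/funext => th; rewrite mulrC.
have -> : (fun t => p (x t, y t)) = (fun s => p (x t, y s) + (x s - x t) * Phi (x s, y s)).
  by apply/funext => s; exact: E.
have d1 := der_comp (g := y) (dpy (x t) (y t)) dy.
have d0 : is_derive t 1 (fun s => x s - x t) x' by der; ring.
have cc : continuous (fun s => Phi (x s, y s)) by cts.
have d2 := der_mul_vanish d0 (subrr _) (cc t).
have -> : px (x t, y t) = Phi (x t, y t).
  rewrite /Phi /=; under eq_fun do rewrite subrr mulr0 addr0.
  by rewrite oint_cst; ring.
by der; ring.
Qed.

Lemma atan_le (x : R) : `|atan x| <= `|x|.
Proof.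
have h (y : R) : 0 <= y -> 0 <= atan y <= y.
  move=> y0.
  have pos (z : R) : 0 < 1 + z ^+ 2 by rewrite ltr_wpDr// sqr_ge0.
  have c1 : continuous (fun z : R => (1 + z ^+ 2)^-1).
    by apply: contV; [move=> z; rewrite gt_eqF|cts].
  have -> : atan y = oint 0 y (fun z => (1 + z ^+ 2)^-1).
    rewrite (@ointE _ _ (@atan R)) ?atan0 ?subr0// => z; exact: is_derive1_atan.
  have e0 : 0 = oint 0 y (fun=> 0) by rewrite oint_cst mul0r.
  have e1 : y = oint 0 y (fun=> 1) by rewrite oint_cst; ring.
  apply/andP; split.
    by rewrite {1}e0; apply: le_oint => //; [cts|move=> z _; rewrite invr_ge0 ltW].
  rewrite {2}e1; apply: le_oint => //; first by cts.
  by move=> z _; rewrite invf_le1 ?lerDl ?sqr_ge0.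
have [x0|/ltW x0] := leP 0 x.
  by have /andP[a b] := h x x0; rewrite !ger0_norm.
have := h (- x); rewrite oppr_ge0 => /(_ x0) /andP[a b].
by move: a b; rewrite atanN => a b; rewrite !ler0_norm //; lra.
Qed.

Lemma dot_le (c d : R * R) : dot c d <= modulus c * modulus d.
Proof.
have h : dot c d ^+ 2 <= (modulus c * modulus d) ^+ 2 by rewrite -dot_cross lerDl sqr_ge0.
apply: le_trans (ler_norm _) _.
by rewrite -(@ler_pXn2r _ 2) ?nnegrE ?mulr_ge0 ?modulus_ge0// -normrX ger0_norm// sqr_ge0.
Qed.

Lemma perturb_dot (c w : R * R) (e : R) : `|w.1| <= e -> `|w.2| <= e -> `|dot c w| <= 2 * e * modulus c.
Proof.
move=> h1 h2; apply: le_trans (ler_normD _ _) _; rewrite !normrM.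
have := ler_pM (normr_ge0 _) (normr_ge0 _) (norm1_le_modulus c) h1.
have := ler_pM (normr_ge0 _) (normr_ge0 _) (norm2_le_modulus c) h2; lra.
Qed.

(** All estimates follow from the smallness of the inner products of d - c
    with c and with d. *)
Lemma perturb (c d : R * R) (e : R) : `|d.1 - c.1| <= e -> `|d.2 - c.2| <= e -> 2 * e <= modulus c / 2 -> 0 < modulus c ->
  [/\ 0 < modulus d, modulus c / 2 <= modulus d, `|modulus d - modulus c| <= 2 * e,
     modulus c ^+ 2 / 2 <= dot c d & `|cross c d| <= 2 * e * modulus c].
Proof.
move=> h1 h2 he c0.
have e0 : 0 <= e by apply: le_trans h1; exact: normr_ge0.
have d0 := modulus_ge0 d.
have k1 := @perturb_dot c (d - c) e h1 h2.
have k2 := @perturb_dot d (d - c) e h1 h2.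
have k3 : `|cross c d| <= 2 * e * modulus c.
  have -> : cross c d = dot c (d.2 - c.2, - (d.1 - c.1)) by rewrite /cross /dot /=; ring.
  by apply: perturb_dot; rewrite //= normrN.
have E1 : dot c d = modulus c ^+ 2 + dot c (d - c) by rewrite sqr_modulus /dot /=; ring.
have E2 : dot c d = modulus d ^+ 2 - dot d (d - c) by rewrite sqr_modulus /dot /=; ring.
have D := dot_le c d.
have k4 : modulus c ^+ 2 / 2 <= dot c d.
  have : 2 * e * modulus c <= modulus c / 2 * modulus c by apply: ler_wpM2r => //; exact: ltW.
  move: k1; rewrite ler_norml E1; lra.
have k5 : modulus c * (modulus c - 2 * e) <= modulus c * modulus d.
  by move: k1; rewrite ler_norml; lra.
rewrite ler_pM2l// in k5.
have dh : modulus c / 2 <= modulus d by lra.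
have dp : 0 < modulus d by lra.
have k6 : modulus d * (modulus d - 2 * e) <= modulus d * modulus c.
  by move: k2; rewrite ler_norml; lra.
rewrite ler_pM2l// in k6.
split => //; rewrite ler_norml; lra.
Qed.

(** From ln r <= r - 1, applied to the two quotients of x and y. *)
Lemma ln_close (x y e : R) : 0 < x -> x / 2 <= y -> `|y - x| <= e -> `|ln y - ln x| <= 2 * e / x.
Proof.
move=> x0 xy h; have y0 : 0 < y by lra.
have e0 : 0 <= e by apply: le_trans h; exact: normr_ge0.
have key (a b : R) : 0 < a -> 0 < b -> ln b - ln a <= (b - a) / a.
  move=> a0 b0; rewrite -ln_div ?posrE//.
  have := @le_ln1Dx R ((b - a) / a); rewrite (_ : 1 + (b - a) / a = b / a); last by field; lra.
  apply; rewrite (_ : (b - a) / a = b / a - 1); last by field; lra.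
  by have : 0 < b / a by [rewrite divr_gt0]; lra.
have := key x y x0 y0; have := key y x y0 x0.
have a1 : (y - x) / x <= 2 * e / x.
  by rewrite ler_pM2r ?invr_gt0//; move: h; rewrite ler_norml; lra.
have a2 : (x - y) / y <= 2 * e / x.
  rewrite ler_pdivrMr// mulrAC ler_pdivlMr//.
  have : (x - y) * x <= e * x by apply: ler_wpM2r; [exact: ltW|move: h; rewrite ler_norml; lra].
  have : 2 * e * (x / 2) <= 2 * e * y by apply: ler_wpM2l => //; lra.
  lra.
by rewrite ler_norml; lra.
Qed.

(** Conformal invariance under the logarithm in the target: the gradient is
    multiplied by a similarity of ratio 1 / r^(1/2). *)
Lemma energy_log (X Y a b c d : R) : X ^+ 2 + Y ^+ 2 != 0 ->
  let r := X ^+ 2 + Y ^+ 2 in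
  forall K, ((X * a + Y * c) / r) ^+ 2 + ((X * b + Y * d) / r) ^+ 2 + ((X * c - Y * a) / r) ^+ 2 + ((X * d - Y * b) / r) ^+ 2
  - K * ((X * a + Y * c) / r * ((X * d - Y * b) / r) - (X * b + Y * d) / r * ((X * c - Y * a) / r)) = distort K a b c d / r.
Proof. by move=> h r K; rewrite /distort /r; field. Qed.

(** Conformal invariance under the exponential in the source: the gradient is
    multiplied by a similarity of ratio e. *)
Lemma distort_rot (K a b c d e t : R) :
  distort K (e * (a * cos t + b * sin t)) (e * (- a * sin t + b * cos t))
    (e * (c * cos t + d * sin t)) (e * (- c * sin t + d * cos t)) = e ^+ 2 * distort K a b c d.
Proof.
rewrite /distort.
have -> : (e * (a * cos t + b * sin t)) ^+ 2 + (e * (- a * sin t + b * cos t)) ^+ 2 + (e * (c * cos t + d * sin t)) ^+ 2 +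
(e * (- c * sin t + d * cos t)) ^+ 2 -
K *
(e * (a * cos t + b * sin t) * (e * (- c * sin t + d * cos t)) -
 e * (- a * sin t + b * cos t) * (e * (c * cos t + d * sin t))) =
 e ^+ 2 * (a ^+ 2 + b ^+ 2 + c ^+ 2 + d ^+ 2 - K * (a * d - b * c)) * (cos t ^+ 2 + sin t ^+ 2) by ring.
by rewrite cos2Dsin2 mulr1.
Qed.

(** The ramp of slope 1 on [a, b], made C1 on both sides by the plateau
    function. Composed with it in the radial variable, functions defined on an
    annulus become functions on the whole plane. *)
Lemma clamp_exists (a b : R) : a <= b -> exists k k' : R -> R,
  [/\ continuous k, continuous k', (forall x : R, is_derive x 1 k (k' x)),
    (forall x, a <= x <= b -> k x = x /\ k' x = 1) & (forall x, a - 1 <= k x <= b + 1)].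
Proof.
move=> ab.
have dr (x : R) : is_derive x 1 (fun x => ramp a b x - ramp a b a + a) (trap a b x).
  by have ? := @ramp_prim R a b x; der; ring.
have up (x y : R) : x <= y -> ramp a b y - ramp a b x <= y - x.
  move=> xy; rewrite rampB (_ : y - x = oint x y (fun=> 1)); last by rewrite oint_cst; ring.
  by apply: le_oint => //; [exact: trap_cont|cts|move=> *; exact: trap_le1].
have r0 : ramp a b (a - 1) = 0 by rewrite ramp_lo.
exists (fun x => ramp a b x - ramp a b a + a), (trap a b); split.
- exact: is_prim_cont dr.
- exact: trap_cont.
- exact: dr.
- move=> x /andP[ax xb]; split; last by rewrite trap1// ax xb.
  by rewrite ramp_id//; ring.
- move=> x.
  have k1 : ramp a b a <= 1 by have := up (a - 1) a; rewrite r0; have h : a - 1 <= a by [lra]; move=> /(_ h); lra.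
  have k2 : 0 <= ramp a b x.
    have [h|/ltW h] := leP x (a - 1); first by rewrite ramp_lo.
    by rewrite -r0; exact: ramp_le.
  have k3 : ramp a b x <= ramp a b (b + 1).
    have [h|/ltW h] := leP x (b + 1); first exact: ramp_le.
    by rewrite (ramp_hi a h).
  have k4 : ramp a b (b + 1) - ramp a b a <= b + 1 - a by apply: up; lra.
  lra.
Qed.

Lemma polar_C1 (p px py : R * R -> R) (k k' : R -> R) (z0 : R * R) (c0 : R) : C1 p px py ->
  continuous k -> continuous k' -> (forall x : R, is_derive x 1 k (k' x)) ->
  C1 (fun z => p (ppt z0 (k z.1) z.2) - c0)
    (fun z => k' z.1 * (expR (k z.1) * (px (ppt z0 (k z.1) z.2) * cos z.2 + py (ppt z0 (k z.1) z.2) * sin z.2)))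
    (fun z => expR (k z.1) * (- px (ppt z0 (k z.1) z.2) * sin z.2 + py (ppt z0 (k z.1) z.2) * cos z.2)).
Proof.
move=> Cp ck ck' dk; have [cp cpx cpy _ _] := Cp.
have cP : continuous (fun z : R * R => ppt z0 (k z.1) z.2).
  by apply: cont_add2; apply: (cont_comp (@pol_cont R)); cts.
split; [by cts..| |] => x y.
- pose X (s : R) := z0.1 + expR (k s) * cos y; pose Y (s : R) := z0.2 + expR (k s) * sin y.
  have cX : continuous X by rewrite /X; cts.
  have cY : continuous Y by rewrite /Y; cts.
  have dkx := dk x.
  have dX : is_derive x 1 X (expR (k x) * k' x * cos y) by rewrite /X; der; rewrite /GRing.scale /=; ring.
  have dY : is_derive x 1 Y (expR (k x) * k' x * sin y) by rewrite /Y; der; rewrite /GRing.scale /=; ring.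
  have h := C1_chain Cp cX cY dX dY.
  rewrite (_ : (fun t => _) = fun s => p (X s, Y s) - c0)//.
  by der; rewrite /ppt /=; rewrite -[z0 + _]/(X x, Y x); ring.
- pose X (t : R) := z0.1 + expR (k x) * cos t; pose Y (t : R) := z0.2 + expR (k x) * sin t.
  have cX : continuous X by rewrite /X; cts.
  have cY : continuous Y by rewrite /Y; cts.
  have dX : is_derive y 1 X (- (expR (k x) * sin y)) by rewrite /X; der; rewrite /GRing.scale /=; ring.
  have dY : is_derive y 1 Y (expR (k x) * cos y) by rewrite /Y; der; rewrite /GRing.scale /=; ring.
  have h := C1_chain Cp cX cY dX dY.
  rewrite (_ : (fun t => _) = fun s => p (X s, Y s) - c0)//.
  by der; rewrite /ppt /=; rewrite -[z0 + _]/(X y, Y y); ring.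
Qed.

Lemma ln_modulus (c : R * R) : 0 < modulus c -> ln (modulus c) = 2^-1 * ln (c.1 ^+ 2 + c.2 ^+ 2).
Proof. by move=> c0; rewrite -sqr_modulus lnXn// mulr2n; field. Qed.

Lemma log_C1 (X Xs Xt Y Ys Yt : R * R -> R) : C1 X Xs Xt -> C1 Y Ys Yt -> (forall z, 0 < modulus (X z, Y z)) ->
  C1 (fun z => ln (modulus (X z, Y z))) (fun z => (X z * Xs z + Y z * Ys z) / (X z ^+ 2 + Y z ^+ 2))
    (fun z => (X z * Xt z + Y z * Yt z) / (X z ^+ 2 + Y z ^+ 2)).
Proof.
move=> [cX cXs cXt dXs dXt] [cY cYs cYt dYs dYt] m0.
have r0 z : 0 < X z ^+ 2 + Y z ^+ 2 by rewrite -(sqr_modulus (X z, Y z)) exprn_gt0.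
have r1 z : X z ^+ 2 + Y z ^+ 2 != 0 by rewrite gt_eqF.
have cr : continuous (fun z => (X z ^+ 2 + Y z ^+ 2)^-1) by apply: contV => //; cts.
split; [|by cts|by cts| |].
- by apply: cont_ln => //; apply: (cont_comp (@modulus_cont R)); cts.
- move=> x y; rewrite (_ : (fun t => _) = fun t => 2^-1 * ln (X (t, y) ^+ 2 + Y (t, y) ^+ 2)); last first.
    by apply/funext => t; rewrite ln_modulus.
  have h1 := dXs x y; have h2 := dYs x y.
  have h3 : is_derive x 1 (fun t => X (t, y) ^+ 2 + Y (t, y) ^+ 2) (2 * (X (x, y) * Xs (x, y) + Y (x, y) * Ys (x, y))).
    by der; rewrite /GRing.scale /=; ring.
  have h4 := der_ln (f := fun t => X (t, y) ^+ 2 + Y (t, y) ^+ 2) (r0 (x, y)) h3.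
  by der; rewrite /GRing.scale /=; field.
- move=> x y; rewrite (_ : (fun t => _) = fun t => 2^-1 * ln (X (x, t) ^+ 2 + Y (x, t) ^+ 2)); last first.
    by apply/funext => t; rewrite ln_modulus.
  have h1 := dXt x y; have h2 := dYt x y.
  have h3 : is_derive y 1 (fun t => X (x, t) ^+ 2 + Y (x, t) ^+ 2) (2 * (X (x, y) * Xt (x, y) + Y (x, y) * Yt (x, y))).
    by der; rewrite /GRing.scale /=; ring.
  have h4 := der_ln (f := fun t => X (x, t) ^+ 2 + Y (x, t) ^+ 2) (r0 (x, y)) h3.
  by der; rewrite /GRing.scale /=; field.
Qed.

(** This is [lift_derive] in each variable separately. *)
Lemma arg_C1 (X Xs Xt Y Ys Yt V : R * R -> R) : C1 X Xs Xt -> C1 Y Ys Yt -> (forall z, 0 < modulus (X z, Y z)) ->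
  continuous V -> (forall z, is_arg (X z, Y z) (V z)) ->
  C1 V (fun z => (X z * Ys z - Y z * Xs z) / (X z ^+ 2 + Y z ^+ 2))
    (fun z => (X z * Yt z - Y z * Xt z) / (X z ^+ 2 + Y z ^+ 2)).
Proof.
move=> [cX cXs cXt dXs dXt] [cY cYs cYt dYs dYt] m0 cV hV.
have r0 z : 0 < X z ^+ 2 + Y z ^+ 2 by rewrite -(sqr_modulus (X z, Y z)) exprn_gt0.
have r1 z : X z ^+ 2 + Y z ^+ 2 != 0 by rewrite gt_eqF.
have cr : continuous (fun z => (X z ^+ 2 + Y z ^+ 2)^-1) by apply: contV => //; cts.
split => //; [by cts|by cts| |] => x y.
- apply: (lift_derive (X := fun t => X (t, y)) (Y := fun t => Y (t, y)) (v := fun t => V (t, y))) => //; by cts.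
- apply: (lift_derive (X := fun t => X (x, t)) (Y := fun t => Y (x, t)) (v := fun t => V (x, t))) => //; by cts.
Qed.

Lemma ppt_per z0 (s t : R) : ppt z0 s (t + T) = ppt z0 s t.
Proof. by rewrite /ppt pol_per. Qed.

(** The disc of radius exp b around z0 lies in the square of half-side rho. *)
Lemma polar_integral_le (G : R * R -> R) (a b rho : R) (z0 : R * R) : continuous G -> (forall z, 0 <= G z) -> a <= b ->
  expR b <= rho ->
  dint a b 0 T (fun z => G (ppt z0 z.1 z.2)) <=
  4 * (expR a / 2) ^- 2 * dint (z0.1 - rho) (z0.1 + rho) (z0.2 - rho) (z0.2 + rho) G.
Proof.
move=> cG G0 ab hb.
have cG' : continuous (fun z => G (z0 + z)) by apply: (cont_comp cG); apply: cont_add2; cts.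
have -> : (fun z : R * R => G (ppt z0 z.1 z.2)) = (fun z => G (z0 + pol z)).
  by apply/funext => -[s t].
apply: le_trans (polar_le cG' (fun z => G0 _) ab) _.
apply: ler_wpM2l; first by rewrite mulr_ge0// invr_ge0 sqr_ge0.
rewrite square_shift//; have eb := expR_gt0 b.
apply: (@le_trans _ _ (dint (z0.1 - expR b) (z0.1 + expR b) (z0.2 - rho) (z0.2 + rho) G)).
  apply: le_oint; [exact: cont_inner|exact: cont_inner|lra|] => x _.
  by apply: oint_sub_le => //; [cts|lra|lra|lra].
apply: oint_sub_le; [exact: cont_inner|lra|lra|lra|] => x _.
have -> : 0 = oint (z0.2 - rho) (z0.2 + rho) (fun=> 0) by rewrite oint_cst mul0r.
by apply: le_oint => //; [cts|cts|lra].
Qed.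

Lemma ppt_in_box z0 (s t rho : R) : expR s <= rho ->
  rect (z0.1 - rho) (z0.1 + rho) (z0.2 - rho) (z0.2 + rho) (ppt z0 s t).
Proof.
move=> h; have h1 := norm1_le_modulus (pol (s, t)); have h2 := norm2_le_modulus (pol (s, t)).
rewrite modulus_pol !ler_norml in h1 h2.
by split; rewrite /= in_itv /=; move: h1 h2; rewrite /pol /=; lra.
Qed.

(** A mollified map g = (p, q) is so close to F that g - f0 stays away from 0
    on the annulus. Its logarithm U + i V is then of class C1, and V is v plus
    the small angle between F - f0 and g - f0. By conformal invariance, the
    error in the Hilbert-Schmidt inequality is the positive part of the
    distortion of g, multiplied by |z - z0|^2 / |g - f0|^2, and the latter is
    bounded on the annulus. *)
Lemma strip_approx_of_cart (K S3 rho : R) (z0 f0 : R * R) (F : R * R -> R * R) (v : R * R -> R) :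
  0 <= K -> continuous F -> expR S3 <= rho ->
  (forall s1 s2, s1 <= s2 -> s2 <= S3 -> exists2 m, 0 < m & forall s t, s1 <= s <= s2 -> m <= modulus (F (ppt z0 s t) - f0)) ->
  continuous v -> (forall s t, v (s, t + T) = v (s, t) + T) ->
  (forall s t, s <= S3 -> is_arg (F (ppt z0 s t) - f0) (v (s, t))) ->
  let Q := rect (z0.1 - rho) (z0.1 + rho) (z0.2 - rho) (z0.2 + rho) in
  (forall e : R, 0 < e -> exists p px py q qx qy : R * R -> R,
    [/\ C1 p px py, C1 q qx qy,
      (forall z, Q z -> `|p z - (F z).1| <= e /\ `|q z - (F z).2| <= e) &
      (\int[lebesgue2]_(z in Q) (Num.max 0 (distort K (px z) (py z) (qx z) (qy z)))%:E <= e%:E)%E]) ->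
  strip_approx K (S3 - 1) (fun z => ln (modulus (F (ppt z0 z.1 z.2) - f0))) v.
Proof.
move=> K0 cF hrho hlow cv vper varg Q cart a b e ab bS e0.
have rho0 : 0 < rho by apply: lt_le_trans hrho; exact: expR_gt0.
have s12 : a - 1 <= b + 1 by lra.
have sS3 : b + 1 <= S3 by lra.
have [m m0 hm] := hlow _ _ s12 sS3.
have [k [k' [ck ck' dk kid kran]]] := clamp_exists (ltW ab).
(* D is the constant by which the integral of the positive part of the
   distortion is multiplied in the passage to the strip *)
pose D := expR b ^+ 2 * (m / 2) ^- 2 * (4 * (expR a / 2) ^- 2).
have D0 : 0 < D by rewrite /D !mulr_gt0 ?invr_gt0 ?exprn_gt0 ?divr_gt0 ?expR_gt0.
pose ep := Num.min (Num.min (m / 8) (e * m / 8)) (e / D).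
have em0 : 0 < e * m by rewrite mulr_gt0.
have ep0 : 0 < ep by rewrite !lt_min !divr_gt0.
have ep1 : ep <= m / 8 by rewrite !ge_min lexx.
have ep2 : ep <= e * m / 8 by rewrite !ge_min lexx orbT.
have ep3 : ep <= e / D by rewrite !ge_min lexx !orbT.
clearbody ep.
have [p [px [py [q [qx [qy [Cp Cq hpq hint]]]]]]] := cart ep ep0.
have [cp cpx cpy _ _] := Cp; have [cq cqx cqy _ _] := Cq.
have CX := polar_C1 z0 f0.1 Cp ck ck' dk; have CY := polar_C1 z0 f0.2 Cq ck ck' dk.
set X := (X in C1 X _ _) in CX; set Xs := (X in C1 _ X _) in CX; set Xt := (X in C1 _ _ X) in CX.
set Y := (X in C1 X _ _) in CY; set Ys := (X in C1 _ X _) in CY; set Yt := (X in C1 _ _ X) in CY.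
pose c (z : R * R) := F (ppt z0 (k z.1) z.2) - f0.
have kS s : k s <= S3 by have := kran s; lra.
have cP : continuous (fun z : R * R => ppt z0 (k z.1) z.2).
  by apply: cont_add2; apply: (cont_comp (@pol_cont R)); cts.
have cc : continuous c by rewrite /c; apply: cont_sub2; cts.
have mc z : m <= modulus (c z) by apply: hm; exact: kran.
have inQ s t : s <= S3 -> Q (ppt z0 s t).
  by move=> h; apply: ppt_in_box; apply: le_trans hrho; rewrite ler_expR.
have near1 z : `|X z - (c z).1| <= ep /\ `|Y z - (c z).2| <= ep.
  have [h1 h2] := hpq _ (inQ (k z.1) z.2 (kS _)).
  rewrite /X /Y /c /=; split.
    by rewrite (_ : _ - f0.1 - _ = p (ppt z0 (k z.1) z.2) - (F (ppt z0 (k z.1) z.2)).1)//; ring.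
  by rewrite (_ : _ - f0.2 - _ = q (ppt z0 (k z.1) z.2) - (F (ppt z0 (k z.1) z.2)).2)//; ring.
have pert z : [/\ 0 < modulus (X z, Y z), modulus (c z) / 2 <= modulus (X z, Y z),
    `|modulus (X z, Y z) - modulus (c z)| <= 2 * ep,
     modulus (c z) ^+ 2 / 2 <= dot (c z) (X z, Y z) & `|cross (c z) (X z, Y z)| <= 2 * ep * modulus (c z)].
  have [h1 h2] := near1 z; apply: perturb => //; have := mc z; clear -ep1 m0; lra.
have dpos z : 0 < dot (c z) (X z, Y z).
  have [_ _ _ h _] := pert z; apply: lt_le_trans h.
  by rewrite divr_gt0// exprn_gt0//; have := mc z; clear -m0; lra.
have mpos z : 0 < modulus (X z, Y z) by have [] := pert z.
have [cX cXs cXt dXs dXt] := CX; have [cY cYs cYt dYs dYt] := CY.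
pose V (z : R * R) := v (k z.1, z.2) + atan (cross (c z) (X z, Y z) / dot (c z) (X z, Y z)).
have cV : continuous V.
  apply: contD; first by cts.
  apply: (cont_comp cont_atan); apply: contM; first by rewrite /cross /=; cts.
  by apply: contV; [move=> z; rewrite gt_eqF|rewrite /dot /=; cts].
have aV z : is_arg (X z, Y z) (V z).
  by apply: is_arg_shift => //; apply: varg.
have CU := log_C1 CX CY mpos; have CV := arg_C1 CX CY mpos cV aV.
pose Gd z := Num.max 0 (distort K (px z) (py z) (qx z) (qy z)).
have cGd : continuous Gd by rewrite /Gd /distort; cts.
have Gd0 z : 0 <= Gd z by rewrite /Gd le_max lexx.
have cP0 : continuous (fun z : R * R => ppt z0 z.1 z.2).
  by apply: cont_add2; apply: (cont_comp (@pol_cont R)); cts.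
pose E (z : R * R) := (m / 2) ^- 2 * (expR z.1 ^+ 2 * Gd (ppt z0 z.1 z.2)).
have cE : continuous E by rewrite /E; cts.
have m20 : 0 <= (m / 2) ^- 2 by rewrite invr_ge0 sqr_ge0.
exists (fun z => ln (modulus (X z, Y z))), (fun z => (X z * Xs z + Y z * Ys z) / (X z ^+ 2 + Y z ^+ 2)),
    (fun z => (X z * Xt z + Y z * Yt z) / (X z ^+ 2 + Y z ^+ 2)), V,
    (fun z => (X z * Ys z - Y z * Xs z) / (X z ^+ 2 + Y z ^+ 2)),
    (fun z => (X z * Yt z - Y z * Xt z) / (X z ^+ 2 + Y z ^+ 2)), E.
split; split => //.
- by move=> z; rewrite /E !mulr_ge0// sqr_ge0.
- have T1 := @two_pi_ge1 R.
  apply: (@le_trans _ _ (expR b ^+ 2 * (m / 2) ^- 2 * dint a b 0 T (fun z => Gd (ppt z0 z.1 z.2)))).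
    rewrite -dintZ; last by cts.
    apply: le_dint => //; [by cts|exact: ltW|lra|] => s t /andP[_ sb] _.
    rewrite /E /= mulrA; apply: ler_wpM2r => //; rewrite mulrC; apply: ler_wpM2r => //.
    by rewrite lerXn2r ?nnegrE ?expR_ge0// ler_expR.
  have hdint : dint (z0.1 - rho) (z0.1 + rho) (z0.2 - rho) (z0.2 + rho) Gd <= ep.
    have le1 : z0.1 - rho <= z0.1 + rho by clear -rho0; lra.
    have le2 : z0.2 - rho <= z0.2 + rho by clear -rho0; lra.
    have hd := dint_lebesgue cGd le1 le2.
    by move: hint; rewrite /Q hd lee_fin.
  have hbr : expR b <= rho by apply: le_trans hrho; rewrite ler_expR; lra.
  have h1 := polar_integral_le z0 cGd Gd0 (ltW ab) hbr.
  have q0 : 0 <= 4 * (expR a / 2) ^- 2 by rewrite mulr_ge0// invr_ge0 sqr_ge0.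
  have h2 := le_trans h1 (ler_wpM2l q0 hdint).
  have r0 : 0 <= expR b ^+ 2 * (m / 2) ^- 2 by rewrite mulr_ge0// sqr_ge0.
  apply: le_trans (ler_wpM2l r0 h2) _.
  by rewrite mulrA -/D mulrC -ler_pdivlMr.
- by move=> s t; rewrite /X /Y /= ppt_per.
- move=> s t; rewrite /V /c /X /Y /= ppt_per vper; ring.
- move=> s t sab; have [ks k's] := kid s sab.
  have cE2 : c (s, t) = F (ppt z0 s t) - f0 by rewrite /c /= ks.
  have [h1 h2 h3 h4 h5] := pert (s, t).
  have mcz := mc (s, t).
  have mcp : 0 < modulus (c (s, t)) by clear -m0 mcz; lra.
  split.
  + rewrite /= -cE2; apply: le_trans (ln_close mcp h2 h3) _.
    rewrite ler_pdivrMr//.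
    have : e * m <= e * modulus (c (s, t)) by rewrite ler_pM2l.
    clear -ep2 em0; lra.
  + rewrite /V /= ks addrC addKr; apply: le_trans (atan_le _) _.
    rewrite normrM normfV (gtr0_norm (dpos _)) ler_pdivrMr//.
    apply: (le_trans h5).
    apply: (@le_trans _ _ (e * (modulus (c (s, t)) ^+ 2 / 2))); last by rewrite ler_pM2l.
    rewrite expr2 (_ : e * (_ * _ / 2) = (e * modulus (c (s, t)) / 2) * modulus (c (s, t))); last by ring.
    rewrite ler_pM2r//.
    have : e * m <= e * modulus (c (s, t)) by rewrite ler_pM2l.
    by clear -ep2 em0; lra.
  + rewrite /energy /jac -lerBlDl.
    have r0 : X (s, t) ^+ 2 + Y (s, t) ^+ 2 != 0.
      by rewrite -(sqr_modulus (X (s, t), Y (s, t))) gt_eqF// exprn_gt0.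
    rewrite (energy_log (Xs (s, t)) (Xt (s, t)) (Ys (s, t)) (Yt (s, t)) r0 K).
    rewrite /Xs /Xt /Ys /Yt /= ks k's !mul1r distort_rot.
    rewrite -(sqr_modulus (X (s, t), Y (s, t))) /E /= mulrC.
    apply: (@le_trans _ _ (modulus (X (s, t), Y (s, t)) ^- 2 * (expR s ^+ 2 * Gd (ppt z0 s t)))).
      apply: ler_wpM2l; first by rewrite invr_ge0 sqr_ge0.
      by apply: ler_wpM2l; [exact: sqr_ge0|rewrite /Gd le_max lexx orbT].
    apply: ler_wpM2r; first by rewrite mulr_ge0// sqr_ge0.
    rewrite lef_pV2 ?posrE ?exprn_gt0//; last by clear -m0 h2 mcz; lra.
    by rewrite lerXn2r ?nnegrE//; clear -m0 h2 mcz; lra.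
Qed.

End Chain.

(** * The exponent inequality *)

Section Final.
Context {R : realType}.
Local Notation T := (2 * pi : R).

(** The growth estimate at a = a k, divided by - a k, passes to the limit. *)
Lemma exponent_ineq (K S0 al ga : R) (u v : R * R -> R) (a : nat -> R) : strip_map K S0 u v ->
  (forall B : R, \forall k \near \oo, a k < B) ->
  u (a k, 0) / a k @[k --> \oo] --> al -> v (a k, 0) / u (a k, 0) @[k --> \oo] --> ga ->
  al ^+ 2 + (al * ga) ^+ 2 + 1 <= K * al.
Proof.
move=> hyp ha hal hga.
set be := al * ga.
have [C [b [bS hb]]] := strip_bound al be hyp.
have [s1 hs1] := strip_inf hyp (-1).
pose x k := - (a k)^-1.
have hx : x k @[k --> \oo] --> (0 : R).
  apply/cvgrPdist_lt => e e0; near=> k.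
  have ak : a k < - e^-1 by near: k; exact: ha.
  have eV : 0 < e^-1 by rewrite invr_gt0.
  have na : 0 < - a k by lra.
  rewrite /x sub0r normrN normrN normfV ltr0_norm; last lra.
  by rewrite -(invrK e) ltf_pV2 ?posrE//; lra.
have hbe : v (a k, 0) / a k @[k --> \oo] --> be.
  rewrite /be mulrC; apply: cvg_trans (cvgM hga hal); apply: near_eq_cvg; near=> k.
  have as1 : a k <= s1 by apply: ltW; near: k; exact: ha.
  have u0 : u (a k, 0) != 0 by rewrite lt_eqF//; have := hs1 (a k) 0 as1; lra.
  by rewrite -[LHS]/(v (a k, 0) / u (a k, 0) * (u (a k, 0) / a k)) mulrA divfK.
set ub := u (b, 0) in hb; set vb := v (b, 0) in hb.
pose P k := u (a k, 0) / a k; pose Q k := v (a k, 0) / a k.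
pose f k := 2 * al * (x k * ub + P k) + 2 * be * (x k * vb + Q k) + 2 * (x k * b + 1) - (al ^+ 2 + be ^+ 2 + 1) * (x k * b + 1).
pose g k := K * (x k * ub + P k) + x k * C.
have cst (c : R) : (fun _ : nat => c) @ \oo --> c by exact: cvg_cst.
have c1 : x k * ub + P k @[k --> \oo] --> 0 * ub + al by exact: cvgD (cvgM hx (cst _)) hal.
have c2 : x k * vb + Q k @[k --> \oo] --> 0 * vb + be by exact: cvgD (cvgM hx (cst _)) hbe.
have c3 : x k * b + 1 @[k --> \oo] --> 0 * b + 1 by exact: cvgD (cvgM hx (cst _)) (cst _).
have cf : f k @[k --> \oo] --> 2 * al * (0 * ub + al) + 2 * be * (0 * vb + be) + 2 * (0 * b + 1) - (al ^+ 2 + be ^+ 2 + 1) * (0 * b + 1).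
  apply: cvgB; last exact: cvgM (cst _) c3.
  by apply: cvgD; [apply: cvgD; apply: cvgM|apply: cvgM].
have cg : g k @[k --> \oo] --> K * (0 * ub + al) + 0 * C.
  by apply: cvgD; [exact: cvgM (cst _) c1|exact: cvgM hx (cst _)].
have := ler_cvg_to cf cg; rewrite !mul0r !add0r => h.
have {h} : 2 * al * al + 2 * be * be + 2 * 1 - (al ^+ 2 + be ^+ 2 + 1) * 1 <= K * al + 0.
  apply: h; near=> k.
  have ab : a k < b by near: k; exact: ha.
  have a0 : a k < 0 by near: k; exact: ha.
  have na : a k != 0 by rewrite lt_eqF.
  have xp : 0 <= x k by rewrite /x oppr_ge0 invr_le0 ltW.
  have := ler_wpM2l xp (hb _ ab).
  have ex : x k * a k = -1 by rewrite /x mulNr mulVf.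
  have eP : x k * u (a k, 0) = - P k by rewrite /x /P; ring.
  have eQ : x k * v (a k, 0) = - Q k by rewrite /x /Q; ring.
  rewrite /f /g => h.
  have e1 : x k * (2 * al * (ub - u (a k, 0)) + 2 * be * (vb - v (a k, 0)) + 2 * (b - a k) -
    (al ^+ 2 + be ^+ 2 + 1) * (b - a k)) =
    2 * al * (x k * ub - x k * u (a k, 0)) + 2 * be * (x k * vb - x k * v (a k, 0)) + 2 * (x k * b - x k * a k) -
    (al ^+ 2 + be ^+ 2 + 1) * (x k * b - x k * a k) by ring.
  have e2 : x k * (K * (ub - u (a k, 0)) + C) = K * (x k * ub - x k * u (a k, 0)) + x k * C by ring.
  by move: h; rewrite e1 e2 eP eQ ex !opprK.
lra.
Unshelve. all: by end_near. Qed.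

(** Induction on the number of periods between t and 0, first for t >= 0. *)
Lemma periodic_ind (Q : R -> Prop) : (forall t, 0 <= t <= T -> Q t) -> (forall t, Q t <-> Q (t + T)) -> forall t, Q t.
Proof.
move=> h0 hS; have T1 := @two_pi_ge1 R.
have pos n : forall t, 0 <= t <= n%:R * T -> Q t.
  elim: n => [|n IH] t; first by rewrite mul0r => ht; apply: h0; lra.
  rewrite -natr1 => ht; have [tT|tT] := leP t T; first by apply: h0; lra.
  by rewrite -(subrK T t); apply: (proj1 (hS _)); apply: IH; lra.
have pos2 t : 0 <= t -> Q t.
  move=> t0; apply: (pos (Num.bound t)); rewrite t0 /=.
  have := archi_boundP t0; set N := _%:R => tN.
  apply: (le_trans (ltW tN)); rewrite ler_peMr//; exact: le_trans (ltW tN).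
have neg n : forall t, - (n%:R * T) <= t -> Q t.
  elim: n => [|n IH] t; first by rewrite mul0r oppr0; exact: pos2.
  by rewrite -natr1 => ht; apply/hS; apply: IH; lra.
move=> t; apply: (neg (Num.bound `|t|)).
have := archi_boundP (normr_ge0 t); set N := _%:R => tN.
have N0 : 0 <= N by apply: le_trans (ltW tN).
have NT : N <= N * T by rewrite ler_peMr.
have := ler_norm (- t); rewrite normrN; lra.
Qed.

Lemma is_arg_per (c : R * R) t : is_arg c t <-> is_arg c (t + T).
Proof. by rewrite /is_arg (mulr_natl pi 2) cosD2pi sinD2pi. Qed.

(** The difference a - b is a multiple of 2 pi. *)
Lemma is_arg_switch (c d : R * R) a b t : 0 < modulus d -> is_arg d a -> is_arg d b -> is_arg c t -> is_arg c (a + (t - b)).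
Proof.
move=> d0 ha hb [h1 h2]; have e := is_arg_cos d0 ha hb.
have s : sin (a - b) = 0 by apply: cos1sin0; rewrite e normr1.
rewrite (_ : a + (t - b) = t + (a - b)); last by ring.
by split; [rewrite cosD|rewrite sinD]; rewrite e s mulr1 mulr0 ?subr0 ?addr0.
Qed.

(** The arguments on the circles are extended by quasi-periodicity and
    normalized by th0 on the radius t = 0; joint continuity is then automatic.
    Radii are clamped at S3, which makes v globally defined. *)
Lemma map_lift (z0 f0 : R * R) (F : R * R -> R * R) (S3 : R) (th0 : R -> R) : continuous F ->
  (forall s t, s <= S3 -> 0 < modulus (F (ppt z0 s t) - f0)) ->
  (forall s, s <= S3 -> exists th : R -> R, [/\ {within `[0, T], continuous th},
    (forall t, 0 <= t <= T -> is_arg (F (ppt z0 s t) - f0) (th t)) & th T = th 0 + T]) ->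
  continuous (fun s => th0 (Num.min s S3)) -> (forall s, s <= S3 -> is_arg (F (ppt z0 s 0) - f0) (th0 s)) ->
  exists v : R * R -> R, [/\ continuous v, (forall s t, v (s, t + T) = v (s, t) + T),
    (forall s t, s <= S3 -> is_arg (F (ppt z0 s t) - f0) (v (s, t))) & (forall s, s <= S3 -> v (s, 0) = th0 s)].
Proof.
move=> cF F0 hth cth0 ath0.
pose m (s : R) := Num.min s S3.
have mS s : m s <= S3 by rewrite /m ge_min lexx orbT.
have mid s : s <= S3 -> m s = s by move=> h; rewrite /m min_l.
pose c (z : R * R) := F (ppt z0 (m z.1) z.2) - f0.
have cm : continuous m by rewrite /m; cts.
have cc : continuous c.
  by apply: cont_sub2; apply: (cont_comp cF); apply: cont_add2; apply: (cont_comp (@pol_cont R)); cts.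
have hW s : exists W : R -> R, [/\ continuous W, (forall t, is_arg (c (s, t)) (W t)) & forall t, W (t + T) = W t + T].
  have [th [c1 a1 e1]] := hth (m s) (mS s).
  have [W [cW Wth WT]] := lift_extend c1 e1.
  exists W; split => //; apply: periodic_ind => t.
    by move=> ht; rewrite Wth//; exact: a1.
  by rewrite /c /= ppt_per WT; exact: is_arg_per.
have [W hWf] := choice hW.
pose v (z : R * R) := th0 (m z.1) + (W z.1 z.2 - W z.1 0).
have c0 z : 0 < modulus (c z) by apply: F0.
have av z : is_arg (c z) (v z).
  case: z => s t; have [cW aW WT] := hWf s.
  by apply: (is_arg_switch (c0 (s, 0))) => //; apply: ath0.
have v0 s : v (s, 0) = th0 (m s) by rewrite /v /= subrr addr0.
have cvt s : continuous (fun t : R => v (s, t)).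
  by have [cW _ _] := hWf s; rewrite /v /=; cts.
have cv0 : continuous (fun s : R => v (s, 0)).
  by rewrite (_ : (fun s => _) = (fun s => th0 (m s)))//; apply/funext => s; rewrite v0.
exists v; split.
- exact: lift_joint cc c0 av cvt cv0.
- by move=> s t; have [_ _ WT] := hWf s; rewrite /v /= WT; ring.
- by move=> s t hs; have := av (s, t); rewrite /c /= mid.
- by move=> s hs; rewrite v0 mid.
Qed.

Lemma arg_branch_arg (I : set R) (c : R -> R * R) (theta : R -> R) t : arg_branch I c theta -> I t -> is_arg (c t) (theta t).
Proof. by move=> [_ h] It; rewrite /is_arg; have e := h t It; split; rewrite {1}e. Qed.

(** The square of the modulus is (alpha - K'/2)^2 + beta^2 with K' = K + 1/K,
    and (K'/2)^2 - 1 = ((K - 1/K)/2)^2. *)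
Lemma complex_disc (K al ga : R) : 1 <= K -> al ^+ 2 + (al * ga) ^+ 2 + 1 <= (K + K^-1) * al ->
  (`|al%:C * (1 + 'i * ga%:C) - (2^-1 * (K + K^-1))%:C| <= (2^-1 * (K - K^-1))%:C)%C.
Proof.
move=> K1 h.
have -> : (al%:C * (1 + 'i * ga%:C) - (2^-1 * (K + K^-1))%:C)%C = ((al - 2^-1 * (K + K^-1)) +i* (al * ga))%C.
  by simpc; congr (_ +i* _)%C; ring.
rewrite normc_def lecR /=.
have KV : K * K^-1 = 1 by rewrite divff// gt_eqF//; lra.
have K0 : 0 <= K^-1 by rewrite invr_ge0; lra.
have Kle : K^-1 <= 1 by rewrite invf_le1//; lra.
have d0 : 0 <= 2^-1 * (K - K^-1) by apply: mulr_ge0; [rewrite invr_ge0|lra].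
rewrite -(ger0_norm d0) -sqrtr_sqr ler_wsqrtr//.
have -> : (2^-1 * (K - K^-1)) ^+ 2 = (2^-1 * (K + K^-1)) ^+ 2 - K * K^-1 by field; lra.
by rewrite KV; lra.
Qed.

(** Composition with this retraction turns a map that is continuous near z0
    into a globally continuous one. *)
Lemma clamp_box (z0 : R * R) (r : R) : 0 <= r -> exists cl : R * R -> R * R,
  [/\ continuous cl, (forall z, rect (z0.1 - r) (z0.1 + r) (z0.2 - r) (z0.2 + r) (cl z)) &
   (forall z, rect (z0.1 - r) (z0.1 + r) (z0.2 - r) (z0.2 + r) z -> cl z = z)].
Proof.
move=> r0.
pose k (x0 x : R) := Num.max (x0 - r) (Num.min x (x0 + r)).
have kin x0 x : x0 - r <= k x0 x <= x0 + r.
  by rewrite /k le_max lexx /= ge_max ge_min lexx orbT andbT; lra.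
have kid x0 x : x0 - r <= x <= x0 + r -> k x0 x = x.
  by move=> /andP[h1 h2]; rewrite /k min_l// max_r.
exists (fun z => (k z0.1 z.1, k z0.2 z.2)); split.
- by rewrite /k; cts.
- by move=> z; split; rewrite /= in_itv/=; exact: kin.
- by move=> [x y] [/= ]; rewrite !in_itv/= => h1 h2; rewrite !kid.
Qed.

(** The analytic and topological properties of f near z0, in logarithmic
    coordinates. The radius exp S3 is so small that the closed disc lies well
    inside W and the given branch theta is defined on the radius. *)
Lemma quasiconformal_strip (K : R) (W W' : set (R * R)) (f : R * R -> R * R) (z0 : R * R) (delta : R) (theta : R -> R) :
  1 <= K -> open W -> open W' -> quasiconformal K W W' f -> W z0 -> 0 < delta ->
  arg_branch [set t : R | 0 < t < delta] (fun t => f (z0 + (t, 0)) - f z0) theta ->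
  exists (S : R) (u v : R * R -> R), strip_map (K + K^-1) S u v /\
    forall t : R, 0 < t -> ln t <= S -> u (ln t, 0) = ln (modulus (f (z0 + (t, 0)) - f z0)) /\ v (ln t, 0) = theta t.
Proof.
move=> K1 oW oW' [hom op [Df [hDf hae]]] Wz0 d0 hth.
have openf := homeo_open oW' hom.
have [bij [cfW _]] := hom.
have injf z z' : W z -> W z' -> f z = f z' -> z = z'.
  by move=> h1 h2; apply: (set_bij_inj bij); rewrite inE.
have [e1 e10 he1] := nbhs_box (open_nbhs_nbhs (conj oW Wz0)).
pose rho := e1 / 4.
have rho0 : 0 < rho by rewrite /rho; lra.
have BW : rect (z0.1 - 2 * rho) (z0.1 + 2 * rho) (z0.2 - 2 * rho) (z0.2 + 2 * rho) `<=` W.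
  move=> z [/=]; rewrite !in_itv/= /rho => h1 h2.
  by apply: he1; rewrite ltr_norml; lra.
have r20 : 0 <= 2 * rho by lra.
have [cl [ccl clB clid]] := clamp_box z0 r20.
pose F z := f (cl z).
have cF : continuous F by apply: (within_comp_cont ccl _ cfW) => z; exact/BW/clB.
have FB z : rect (z0.1 - 2 * rho) (z0.1 + 2 * rho) (z0.2 - 2 * rho) (z0.2 + 2 * rho) z -> F z = f z.
  by move=> h; rewrite /F clid.
pose S3 := ln (Num.min rho (delta / 2)).
have mn0 : 0 < Num.min rho (delta / 2) by rewrite lt_min rho0 divr_gt0.
have S3e : expR S3 = Num.min rho (delta / 2) by rewrite lnK.
have S3r : expR S3 <= rho by rewrite S3e ge_min lexx.
have S3d : expR S3 < delta.
  by apply: (@le_lt_trans _ _ (delta / 2)); [rewrite S3e ge_min lexx orbT|lra].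
have discF z : modulus (z - z0) <= expR S3 -> W z /\ F z = f z.
  move=> h; have inB : rect (z0.1 - 2 * rho) (z0.1 + 2 * rho) (z0.2 - 2 * rho) (z0.2 + 2 * rho) z.
    have h1 := le_trans (norm1_le_modulus (z - z0)) (le_trans h S3r).
    have h2 := le_trans (norm2_le_modulus (z - z0)) (le_trans h S3r).
    by move: h1 h2; rewrite !ler_norml /= => h1 h2; split; rewrite /= in_itv/=; lra.
  by split; [exact: BW|exact: FB].
have Pf s t : s <= S3 -> F (ppt z0 s t) = f (ppt z0 s t).
  by move=> hs; apply: (proj2 (discF _ _)); exact: ppt_disc.
have F0 s t : s <= S3 -> 0 < modulus (F (ppt z0 s t) - f z0).
  move=> hs; apply: (hgt_gt0 injf discF); [exact: ppt_disc|exact: ppt_neq].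
have pol0 s : pol (s, 0) = ((expR s, 0) : R * R) by rewrite /pol /= cos0 sin0 mulr1 mulr0.
have OP s : s <= S3 -> exists th : R -> R, [/\ {within `[0, T], continuous th},
    (forall t, 0 <= t <= T -> is_arg (F (ppt z0 s t) - f z0) (th t)) & th T = th 0 + T].
  move=> hs; have [|th [hth' e]] := op z0 (expR s) (expR_gt0 s).
    by move=> w /= hw; apply: (proj1 (discF _ _)); apply: (le_trans hw); rewrite ler_expR.
  exists th; split; [by case: hth'| |by rewrite -[LHS](subrK (th 0)) e addrC].
  move=> t ht; rewrite Pf//; apply: (arg_branch_arg hth').
  by rewrite /= in_itv.
have cth0 : continuous (fun s => theta (expR (Num.min s S3))).
  apply: (within_comp_cont _ _ (proj1 hth)); first by cts.
  move=> s /=; rewrite expR_gt0 /=; apply: le_lt_trans S3d.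
  by rewrite ler_expR ge_min lexx orbT.
have ath0 s : s <= S3 -> is_arg (F (ppt z0 s 0) - f z0) (theta (expR s)).
  move=> hs; rewrite Pf// /ppt pol0; apply: (arg_branch_arg hth) => /=.
  by rewrite expR_gt0 /=; apply: le_lt_trans S3d; rewrite ler_expR.
have [v [cv vper varg v0]] := map_lift (th0 := fun s => theta (expR s)) cF F0 OP cth0 ath0.
pose u (z : R * R) := ln (modulus (F (ppt z0 z.1 z.2) - f z0)).
have SS : S3 - 1 <= S3 by lra.
have K'0 : 0 < K + K^-1 by rewrite addr_gt0// ?invr_gt0//; lra.
exists (S3 - 1), u, v; split; last first.
  move=> t t0 ts; rewrite /u /=.
  have tS : ln t <= S3 by lra.
  rewrite Pf// /ppt pol0 lnK// v0//; split => //.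
  by rewrite lnK.
have lnle (x y : R) : 0 < x -> x <= y -> ln x <= ln y.
  by move=> x0 xy; rewrite ler_ln ?posrE// (lt_le_trans x0).
split => //.
- apply: (strip_approx_of_cart (rho := rho)) => //.
  + exact: ltW.
  + move=> s1 s2 s12 s2S; exact: (annulus_low injf cF discF s12 s2S).
  + move=> e e0.
    have hL i j : measurable_fun W (fun z => Df z i j) /\ forall C, C `<=` W -> compact C -> (\int[lebesgue2]_(z in C) ((Df z i j) ^+ 2)%:E < +oo)%E.
      by have [_ h] := hDf i; have [[h1 h2] _] := h j.
    have hP i j : weak_partial W j (coord2 i \o f) (fun z => Df z i j).
      by have [_ h] := hDf i; have [_ h1] := h j.
    have mW := plane_open_measurable oW.
    have cB := @rect_compact R (z0.1 - 2 * rho) (z0.1 + 2 * rho) (z0.2 - 2 * rho) (z0.2 + 2 * rho).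
    have mD i j := measurable_funS mW BW (proj1 (hL i j)).
    have sD i j := proj2 (hL i j) _ BW cB.
    have hdis : {ae lebesgue2, forall z, W z -> distort (K + K^-1) (Df z 0 0) (Df z 0 1) (Df z 1 0) (Df z 1 1) <= 0}.
      have sub : ~` [set z | W z -> distort (K + K^-1) (Df z 0 0) (Df z 0 1) (Df z 1 0) (Df z 1 1) <= 0] `<=`
          ~` [set z | W z -> op_norm (Df z) ^+ 2 <= K * \det (Df z)].
        move=> z /= hn hz; apply: hn => Wz; have := op_norm_HS K1 (hz Wz); rewrite /distort; lra.
      exact: (@negligibleS _ _ _ lebesgue2 _ _ sub hae).
    have [p [px [py [q [qx [qy [h1 h2 h3 h4]]]]]]] := @cart_approx R (K + K^-1) W (coord2 0 \o f) (coord2 1 \o f)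
      (fun z => Df z 0 0) (fun z => Df z 0 1) (fun z => Df z 1 0) (fun z => Df z 1 1) (fun z => (F z).1) (fun z => (F z).2) z0 rho
      (ltW K'0) rho0 BW ltac:(by cts) ltac:(by cts) (fun w hw => congr1 fst (FB w hw)) (fun w hw => congr1 snd (FB w hw))
      (hP 0 0) (hP 0 1) (hP 1 0) (hP 1 1) (mD 0 0) (sD 0 0) (mD 0 1) (sD 0 1) (mD 1 0) (sD 1 0) (mD 1 1) (sD 1 1) hdis e e0.
    exists p, px, py, q, qx, qy; split => // z hz; rewrite FB; first exact: h3.
    by move: hz => [/=]; rewrite !in_itv/= => k1 k2; split; rewrite /= in_itv/=; lra.
- move=> s s' t' ss sS; have sS' : s' <= S3 by lra.
  have [t ht h] := circle_min_le openf injf cF discF t' ss sS'.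
  by exists t => //; apply: lnle => //; apply: F0 => /=; lra.
- move=> s s' t ss sS; have sS' : s' <= S3 by lra.
  have [t' ht h] := circle_max_le openf injf cF discF t ss sS'.
  by exists t' => //; apply: lnle => //; apply: F0 => /=; lra.
- move=> B; have [s1 hs1] := hgt_small cF discF (expR_gt0 B).
  exists (Num.min s1 S3) => s t hs; rewrite -(expRK B); apply: lnle.
    by apply: F0; apply: (le_trans hs); rewrite ge_min lexx orbT.
  by apply: hs1; apply: (le_trans hs); rewrite ge_min lexx.
- have [m m0 hm] := annulus_low injf cF discF (lexx (S3 - 1)) SS.
  by exists (ln m) => t; apply: lnle => //; apply: hm; rewrite lexx.
- apply: max_principle => // z N zS nN.
  have [|e e0 he] := arg_open openf injf discF cv varg _ nN; first by lra.
  have [|y Ny vy] := he e; first by rewrite ger0_norm// ltW.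
  by exists y => //; rewrite vy; lra.
- move=> p q c d B pq qS cd hB s t hs ht.
  rewrite -lerN2; apply: (@max_principle R (fun z => - v z) (S3 - 1) _ _ p q c d (- B)) => //.
  + by cts.
  + move=> z N zS nN.
    have [|e e0 he] := arg_open openf injf discF cv varg _ nN; first by lra.
    have [|y Ny vy] := he (- e); first by rewrite normrN ger0_norm// ltW.
    by exists y => //; rewrite vy; lra.
  + by move=> z hz; rewrite lerN2; exact: hB.
Qed.

End Final.

Unset Implicit Arguments.
Local Open Scope complex_scope.

Theorem theorem3p3 (R : realType) (K : R) (W W' : set (R * R))
    (f : R * R -> R * R) (z0 : R * R) (r : nat -> R)
    (delta : R) (theta : R -> R) (alpha gamma : R)
    (hK : 1 <= K)
    (hW : planar_domain W) (hW' : planar_domain W')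
    (hf : quasiconformal K W W' f)
    (hz0 : W z0)
    (r_gt0 : forall k, 0 < r k)
    (r_cvg0 : r k @[k --> \oo] --> (0 : R))
    (delta_gt0 : 0 < delta)
    (hdelta : forall t : R, 0 < t < delta -> W (z0 + (t, 0)))
    (htheta : arg_branch [set t : R | 0 < t < delta]
                (fun t => f (z0 + (t, 0)) - f z0) theta)
    (halpha : ln (modulus (f (z0 + (r k, 0)) - f z0)) / ln (r k)
                @[k --> \oo] --> alpha)
    (hgamma : theta (r k) / ln (modulus (f (z0 + (r k, 0)) - f z0))
                @[k --> \oo] --> gamma) :
  let tau : R[i] := alpha%:C * (1 + 'i * gamma%:C) in
  `|tau - (2^-1 * (K + K^-1))%:C| <= (2^-1 * (K - K^-1))%:C.
Proof.
have [oW _ _] := hW; have [oW' _ _] := hW'.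
have [S [u [v [hyp huv]]]] := quasiconformal_strip hK oW oW' hf hz0 delta_gt0 htheta.
have small B : \forall k \near \oo, ln (r k) < B.
  have /cvgrPdist_lt/(_ _ (expR_gt0 B)) h := r_cvg0.
  near=> k; rewrite -ltr_expR lnK ?posrE//.
  have : `|0 - r k| < expR B by near: k.
  by rewrite sub0r normrN gtr0_norm.
apply: complex_disc => //.
apply: (exponent_ineq (a := fun k => ln (r k)) hyp small).
- apply: cvg_trans halpha; apply: near_eq_cvg; near=> k.
  have hk : ln (r k) <= S by apply: ltW; near: k; exact: small.
  by have [-> _] := huv _ (r_gt0 k) hk.
- apply: cvg_trans hgamma; apply: near_eq_cvg; near=> k.
  have hk : ln (r k) <= S by apply: ltW; near: k; exact: small.
  by have [-> ->] := huv _ (r_gt0 k) hk.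
Unshelve. all: by end_near. Qed.
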